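(* Let $\mathcal X,\mathcal Y$ be real separable Hilbert spaces with $\mathcal Y\ne\{0\}$, let $t>0$, $1\le p<\infty$, $B,L>0$, $\sigma>0$, and let $\mu$ be a probability measure on $\mathcal X$ satisfying conditions (i), (ii), (iii-L), (iii-U) of the context. Suppose the noise is Gaussian white noise on $\mathcal Y$, that $w_i=i$ for all $i$, and that the eigenvalues of the covariance operator of $\mu$ are $\lambda_i=i^{-\tau}$, $i\in\mathbb N$, for some $\tau>1$. Then, as $m\to\infty$, $$\frac{\tau-1}{2}\log\left(\frac{\log(m/\sigma^2)}{\log(\log(m/\sigma^2))}\right)+\mathcal O(1)\ \le\ \mathcal L_m(\mathcal F^t_{B,L};L^p_\mu)\ \lesssim_{\iota,p}\ \sqrt{\log(m/\sigma^2)},$$ where the constant implied by the $\mathcal O(1)$ term depends only on $\tau,\iota,t,B,L,p$ and the moment bound $\sup_i(\mathbb E|\xi_i|^{p'})^{1/p'}$, $\mathcal L_m(\mathcal F^t_{B,L};L^p_\mu)=-\log(\mathcal M_m(\mathcal F^t_{B,L};L^p_\mu))$, and $\mathcal M_m$ is either the fixed-design or the random-design minimax risk.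
   Context: Conditions on $\mu$ (a Borel probability measure on $\mathcal X$): (i) $\mu$ has mean zero and $\int_{\mathcal X}\|X\|_{\mathcal X}^2\,d\mu(X)<\infty$. (ii) Let $\lambda_1\ge\lambda_2\ge\cdots>0$ and $\{\phi_i\}_i\subset\mathcal X$ be the eigenvalues and an orthonormal basis of eigenvectors of the covariance operator of $\mu$. The real random variables $\xi_i=\langle X,\phi_i\rangle_{\mathcal X}/\sqrt{\lambda_i}$, $X\sim\mu$, are independent. (iii-L) Each $\xi_i$ has a density $\nu_i$ with respect to Lebesgue measure, and there are constants $a,b>0$ (independent of $i$) with $\nu_i(x)\ge b$ for all $|x|\le a$ and all $i$. Put $\iota=2ab\le1$. (iii-U) With $p'=\max\{p,2\}$, $\sup_i(\mathbb E|\xi_i|^{p'})^{1/p'}<\infty$. Observations: $Y_i=F(X_i)+\sigma E_i$, $i=1,\dots,m$, with $E_1,\dots,E_m$ i.i.d. Gaussian white noise on $\mathcal Y$, i.e. $Y_i$ is observed through $\langle Y_i,y\rangle=\langle F(X_i),y\rangle_{\mathcal Y}+\sigma\langle E_i,y\rangle$, $y\in\mathcal Y$, where $y\mapsto\langle E_i,y\rangle$ is a centered Gaussian linear process with $\mathbb E[\langle E_i,y\rangle\langle E_i,y'\rangle]=\langle y,y'\rangle_{\mathcal Y}$. Class: let $\{\psi_i\}_i$ be an orthonormal basis of $\mathcal Y$ and $(w_i)$ the weights; set $\|Y\|_{\mathcal Y^t}^2=\sum_i w_i^{2t}|\langle Y,\psi_i\rangle_{\mathcal Y}|^2$ and $\mathcal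 Y^t=\{Y\in\mathcal Y:\|Y\|_{\mathcal Y^t}<\infty\}$. $\mathcal F^t_{B,L}$ is the set of $F:\mathcal X\to\mathcal Y$ with $\|F(X)\|_{\mathcal Y^t}\le B$ and $\|F(X)-F(X')\|_{\mathcal Y}\le L\|X-X'\|_{\mathcal X}$ for all $X,X'\in\mathcal X$. Norm: $\|F\|_{L^p_\mu(\mathcal X;\mathcal Y)}=(\int_{\mathcal X}\|F(X)\|_{\mathcal Y}^p\,d\mu(X))^{1/p}$. Minimax risks: an estimator $\widehat F$ is a mapping from the data to $L^p_\mu(\mathcal X;\mathcal Y)$. Fixed design: $\mathcal M_m(\mathcal F;L^p_\mu)=\inf_{\mathcal D}\inf_{\widehat F}\sup_{F\in\mathcal F}\mathbb E\|F-\widehat F\|_{L^p_\mu(\mathcal X;\mathcal Y)}$, with infimum over designs $\mathcal D=\{X_1,\dots,X_m\}\subset\mathcal X$ and expectation over the $E_i$. Random design: $\mathcal M_m(\mathcal F;L^p_\mu)=\inf_\nu\inf_{\widehat F}\sup_{F\in\mathcal F}\mathbb E\|F-\widehat F\|_{L^p_\mu(\mathcal X;\mathcal Y)}$, with infimum over probability measures $\nu$ on $\mathcal X$, $X_1,\dots,X_m$ i.i.d. from $\nu$ independent of the $E_i$, and expectation over the $X_i$ and $E_i$. Asymptotic notation: $A(m)\lesssim_r A'(m)$ as $m\to\infty$ means there is a constant $c(r)>0$ depending only on the parameters $r$ such that $A(m)\le c(r)A'(m)$ for all sufficiently large $m$ (the threshold may depend on all fixed data). The left inequality with $\mathcal O(1)$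 means that there is a constant $C$, depending only on the indicated quantities, such that the inequality holds with $\mathcal O(1)$ replaced by $-C$ for all sufficiently large $m$. *)

(* Defs.v *)
From HB Require Import structures.
From mathcomp Require Import all_boot all_order all_algebra finmap.
From mathcomp Require Import all_classical all_reals all_analysis.

Set Implicit Arguments.
Unset Strict Implicit.
Unset Printing Implicit Defensive.

Import Order.TTheory GRing.Theory Num.Theory.
Import numFieldNormedType.Exports.

Local Open Scope classical_set_scope.
Local Open Scope ring_scope.

HB.mixin Record CompleteNormedModule_isHilbert (R : realType) H
    & CompleteNormedModule R H := {
  inner : {dot H for (@idfun R)} ;
  inner_norm : forall x : H, inner x x = `|x| ^+ 2
}.

#[short(type="hilbertType")]
HB.structure Definition Hilbert (R : realType) :=
  {H of CompleteNormedModule R H & CompleteNormedModule_isHilbert R H}.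

Definition separable (T : topologicalType) :=
  exists2 S : set T, countable S & dense S.

Definition initial_segment (D : set nat) :=
  forall i j : nat, (i <= j)%N -> D j -> D i.

(* Orthonormal bases are indexed from 0 by D, so that finite-dimensional spaces
   are covered by D = {0, ..., d - 1}; e outside D is irrelevant. *)
Definition orthonormal_basis (R : realType) (H : hilbertType R) (D : set nat)
    (e : nat -> H) :=
  (forall i j, D i -> D j -> inner (e i) (e j) = (i == j)%:R) /\
  dense [set x : H | exists n (c : nat -> R),
           x = \sum_(0 <= i < n | i \in D) c i *: e i].

Notation borel T := (g_sigma_algebraType (@open T)).

Section independence.
Context {d d' : measure_display} {T : measurableType d}
  {T' : measurableType d'} {R : realType}.

Definition independent_family (P : probability T R) (X : nat -> T -> T') :=
  forall (J : {fset nat}) (A : nat -> set T'),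
    (forall i, measurable (A i)) ->
    P (\bigcap_(i in [set` J]) (X i @^-1` A i)) =
    (\prod_(i <- J) P (X i @^-1` A i))%E.

End independence.

Section gaussian.
Context {d : measure_display} {T : measurableType d} {R : realType}.

(* Library normal_prob m 0 is not the point mass at m, whence the case s = 0. *)
Definition gaussian (P : probability T R) (Z : T -> R) :=
  exists m s : R, forall A, measurable A ->
    P (Z @^-1` A) = if s == 0 then \d_m A else normal_prob m s A.

End gaussian.

Section conditions.
Context {R : realType} {X : hilbertType R}.
Implicit Types (mu : probability (borel X) R) (C : X -> X) (lambda : nat -> R).

Definition mean_zero mu := forall h : X,
  (\int[mu]_x (inner (x : X) h)%:E = 0)%E.

Definition finite_second_moment mu :=
  (\int[mu]_x (`|x : X| ^+ 2)%:E < +oo)%E.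

Definition covariance_operator mu C := forall h k : X,
  (inner (C h) k)%:E = (\int[mu]_x (inner (x : X) h * inner (x : X) k)%:E)%E.

Definition xi lambda (phi : nat -> X) (i : nat) : borel X -> R :=
  fun x => inner (x : X) (phi i) / Num.sqrt (lambda i).

Record covariance_eigenbasis mu lambda (phi : nat -> X) : Prop := {
  eigenbasis_eigenvector : exists2 C, covariance_operator mu C &
    forall i, C (phi i) = lambda i *: phi i ;
  eigenbasis_gt0 : forall i, 0 < lambda i ;
  eigenbasis_nonincreasing : forall i j, (i <= j)%N -> lambda j <= lambda i ;
  eigenbasis_orthonormal : orthonormal_basis [set: nat] phi
}.

Definition density_of (mu : probability (borel X) R) (Z : borel X -> R)
    (nu : R -> R) :=
  [/\ measurable_fun [set: R] nu, (forall x, 0 <= nu x) &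
   forall A, measurable A ->
     mu (Z @^-1` A) = (\int[lebesgue_measure]_(x in A) (nu x)%:E)%E].

Definition densities_bounded_below mu lambda phi (a b : R) :=
  exists nu : nat -> R -> R,
    (forall i, density_of mu (xi lambda phi i) (nu i)) /\
    (forall i x, `|x| <= a -> b <= nu i x).

Definition moment_bound mu lambda phi (p : R) : \bar R :=
  ereal_sup (range (fun i : nat =>
    'N[mu]_((Num.max p 2)%:E)[EFin \o xi lambda phi i])%E).

End conditions.

Section smoothness_class.
Context {R : realType} {X Y : hilbertType R}.
Variables (w : nat -> R) (D : set nat) (psi : nat -> Y).

Definition Yt_norm (t : R) (y : Y) : \bar R :=
  ((\esum_(i in D) (w i `^ (2 * t) * `|inner y (psi i)| ^+ 2)%:E)
    `^ 2^-1)%E.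

Definition lipschitz_class (t B L : R) : set (X -> Y) :=
  [set F | (forall x, (Yt_norm t (F x) <= B%:E)%E) /\
           (forall x x', `|F x - F x'| <= L * `|x - x'|)].

End smoothness_class.

(* Data are recorded up to the product sigma-algebra on R^Y, i.e. the one
   generated by the evaluations at the points of Y. *)
Definition cylinders (R : realType) (Y : Type) : set (set (Y -> R)) :=
  [set S | exists y (A : set R), measurable A /\ S = [set z | A (z y)]].

Notation process R Y := (g_sigma_algebraType (@cylinders R Y)).

Section white_noise.
Context {d : measure_display} {Omega : measurableType d} {R : realType}
  {Y : hilbertType R}.
Variable P : probability Omega R.

Record white_noise (E : Omega -> process R Y) : Prop := {
  white_noise_linear : forall (c : R) (y y' : Y),
    {ae P, forall omega,
       E omega (c *: y + y') = c * E omega y + E omega y'} ;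
  white_noise_gaussian : forall n (c : 'I_n -> R) (y : 'I_n -> Y),
    gaussian P (fun omega => \sum_(i < n) c i * E omega (y i)) ;
  white_noise_centered : forall y : Y,
    ('E_P[fun omega => E omega y] = 0)%E ;
  white_noise_covariance : forall y y' : Y,
    ('E_P[(fun omega => E omega y * E omega y')%R] = (inner y y')%:E)%E
}.

Definition iid_white_noise (E : nat -> {RV P >-> process R Y}) :=
  (forall i, white_noise (E i)) /\ independent_family P E.

End white_noise.

Section iid_sample.
Context {d : measure_display} {T : measurableType d} {R : realType}.

Definition cons_pair n (z : T * n.-tuple T) : n.+1.-tuple T :=
  [tuple of z.1 :: z.2].

Lemma measurable_cons_pair n :
  measurable_fun [set: T * n.-tuple T] (@cons_pair n).
Proof. exact: measurable_cons. Qed.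

HB.instance Definition _ n :=
  isMeasurableFun.Build _ _ _ _ (@cons_pair n) (@measurable_cons_pair n).

(* The n-fold product measure of nu, i.e. the joint law of n i.i.d. draws. *)
Fixpoint iid_law (nu : probability T R) n : probability (n.-tuple T) R :=
  match n with
  | 0 => \d_([tuple] : 0.-tuple T)
  | n'.+1 => distribution (nu \x iid_law nu n')%E (@cons_pair n')
  end.

End iid_sample.

Section Lp.
Context {R : realType} {X Y : hilbertType R}.
Variables (mu : probability (borel X) R) (p : R).

Definition Lp_norm (F : X -> Y) : \bar R :=
  ('N[mu]_(p%:E)[(fun x : borel X => (`|F x|)%:E)])%E.

Definition Lp : set (X -> Y) :=
  [set F | measurable_fun [set: borel X] (F : borel X -> borel Y) /\
           (Lp_norm F < +oo)%E].

Definition Lp_open (U : set (X -> Y)) :=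
  forall G, Lp G -> U G -> exists2 e : R, 0 < e &
    forall H, Lp H -> (Lp_norm (G \- H)%R < e%:E)%E -> U H.

(* Estimators are Borel maps from the data into L^p; without measurability
   the expected errors below would only be lower integrals. *)
Definition estimator d (data : measurableType d) : set (data -> (X -> Y)) :=
  [set Fhat | (forall z, Lp (Fhat z)) /\
    (forall U, Lp_open U -> measurable (Fhat @^-1` U))].

End Lp.

Arguments estimator {R X Y} mu p {d} data _.

Inductive design := fixed_design | random_design.

Section risk.
Context {R : realType} {X Y : hilbertType R} {d : measure_display}
  {Omega : measurableType d}.
Variables (P : probability Omega R) (E : nat -> {RV P >-> process R Y}).
Variables (sigma : R) (m : nat) (cF : set (X -> Y)).
Variables (mu : probability (borel X) R) (p : R).

Definition observations (F : X -> Y) (x : m.-tuple (borel X)) (omega : Omega) :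
    m.-tuple (process R Y) :=
  [tuple (fun y : Y => inner (F (tnth x i)) y + sigma * E i omega y) | i < m].

(* fixed_minimax_risk optimizes over deterministic designs x; in
   random_minimax_risk the design is drawn from nu independently of the noise,
   whence the product measure, and is part of the data. *)
Definition fixed_minimax_risk : \bar R :=
  ereal_inf [set
    ereal_inf [set
      ereal_sup [set
        (\int[P]_omega
           Lp_norm mu p (F \- Fhat (observations F x omega))%R)%E
        | F in cF]
      | Fhat in estimator mu p (m.-tuple (process R Y))]
    | x in [set: m.-tuple (borel X)]].

Definition random_minimax_risk : \bar R :=
  ereal_inf [set
    ereal_inf [set
      ereal_sup [set
        (\int[iid_law nu m \x P]_z
           Lp_norm mu p (F \- Fhat (z.1, observations F z.1 z.2))%R)%E
        | F in cF]
      | Fhat in estimator mu p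
                  (m.-tuple (borel X) * m.-tuple (process R Y))%type]
    | nu in [set: probability (borel X) R]].

Definition minimax_risk (k : design) : \bar R :=
  match k with
  | fixed_design => fixed_minimax_risk
  | random_design => random_minimax_risk
  end.

Definition log_minimax_risk (k : design) : \bar R := (- lne (minimax_risk k))%E.

End risk.

(* Main.v *)
Require Import Defs.
From HB Require Import structures.
From mathcomp Require Import all_boot all_order all_algebra finmap.
From mathcomp Require Import all_classical all_reals all_analysis.
From mathcomp Require Import measurable_realfun ring lra zify.

Set Implicit Arguments.
Unset Strict Implicit.
Unset Printing Implicit Defensive.

Import Order.TTheory GRing.Theory Num.Theory.
Import numFieldNormedType.Exports.

Local Open Scope classical_set_scope.
Local Open Scope ring_scope.

(** Both inequalities are estimates of the minimax risk. Write
    [ell = ln (m / sigma ^ 2)].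

    The risk is at least [exp (- c * sqrt ell)] by a fooling argument. Cut the
    cube [[-a, a] ^ n] in the first [n] whitened coordinates into [N ^ n >= 2 m]
    small cubes, put a bump of height [h] with a free sign on each of them, and
    let the values point along [psi 0]. At least half of the cubes contain no
    design point, and then the data do not depend on their signs: on such a
    cube no estimator is close to both of two maps that differ in its sign
    ([pointwise_confusion]), so that averaging over all signs bounds the worst
    risk from below ([fooling_risk]). Independence and the lower bound on the
    densities give the small cubes, shrunk by half, the total mass
    [(a * b) ^ n] at least, and the class allows [h] of the order of [sqrt (lambda n.-1) / N]; this proves
    [minimax_risk_ge]. With [n] about [sqrt ell] and [N] about
    [exp (2 * sqrt ell)], every factor is exponential in [sqrt ell]
    ([exists_cubes]).

    The risk is at most a constant times [(ell / ln ell) `^ - s], where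
    [s = (tau - 1) / 2]. Cover a box in the first [n] whitened coordinates by a
    grid of cells, take observations at the nodes only, either in turn or by
    uniform random choice, and on each cell let the estimator be the truncated
    expansion in [psi] with averaged and rounded coefficients. Its error is
    the sum of a stochastic part and of a deterministic part
    ([minimax_risk_le]). The stochastic part is at most a polynomial in the
    number of nodes, divided by [sqrt m]. The deterministic part consists of the
    escape from the box, the mesh and the truncation of the output, and of the
    distance of [x] from the span of the first [n] eigenvectors. The last term
    is of order [n `^ - s] in L^p, by the moment bound and the decay of the
    eigenvalues ([projection_residual_norm], [eigenvalue_tail]). The other three
    are as small when the width, the inverse mesh and the number of output
    coordinates are a large fixed power of [n] ([deterministic_rate]). The grid
    then has [exp (O (n * ln n))] nodes, and if [n] is a small multiple of
    [ell / ln ell], this is so small a power of [m] that the stochastic part is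
    at most [n `^ - s] too ([stochastic_rate]). *)

(** * Orthonormal expansions in Hilbert spaces *)

Section hilbert.
Context {R : realType} {H : hilbertType R}.
Implicit Types x y z : H.

Lemma innerC x y : inner x y = inner y x.
Proof. by rewrite hermC /= expr0 mul1r. Qed.

Lemma innerZl (c : R) x y : inner (c *: x) y = c * inner x y.
Proof. exact: linearZl_LR. Qed.

Lemma innerBl x y z : inner (x - y) z = inner x z - inner y z.
Proof. exact: linearBl. Qed.

Lemma inner0l y : inner 0 y = 0.
Proof. exact: linear0l. Qed.

Lemma inner_suml (I : Type) (r : seq I) (P : pred I) (F : I -> H) y :
  inner (\sum_(i <- r | P i) F i) y = \sum_(i <- r | P i) inner (F i) y.
Proof. exact: linear_sumlz. Qed.

Lemma innerBr x y z : inner x (y - z) = inner x y - inner x z.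
Proof. by rewrite innerC innerBl !(innerC _ x). Qed.

Lemma innerZr (c : R) x y : inner x (c *: y) = c * inner x y.
Proof. by rewrite innerC innerZl innerC. Qed.

Lemma sqr_normB x y : `|x - y| ^+ 2 = `|x| ^+ 2 - 2 * inner x y + `|y| ^+ 2.
Proof.
rewrite -!inner_norm innerBl !innerBr (innerC y x); ring.
Qed.

(** Cauchy-Schwarz for a unit vector, from the norm of the residual of the
    projection on its line. *)
Lemma inner_norm1 x y : `|y| = 1 -> `|inner x y| <= `|x|.
Proof.
move=> y1.
have : 0 <= `|x - inner x y *: y| ^+ 2 by rewrite sqr_ge0.
rewrite sqr_normB innerZr normrZ y1 mulr1 real_normK ?num_real // => h.
rewrite -ler_sqr ?nnegrE // real_normK ?num_real //; nra.
Qed.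

End hilbert.

Section orthonormal.
Context {R : realType} {H : hilbertType R}.
Variables (D : set nat) (e : nat -> H).
Hypothesis onb : orthonormal_basis D e.

Definition fourier_sum (n : nat) (x : H) : H :=
  \sum_(0 <= i < n | i \in D) inner x (e i) *: e i.

Definition coef_energy (n : nat) (x : H) : R :=
  \sum_(0 <= i < n | i \in D) inner x (e i) ^+ 2.

Lemma norm_orthonormal i : D i -> `|e i| = 1.
Proof.
move=> Di; apply/eqP; rewrite -(@eqrXn2 _ 2) // -inner_norm expr1n.
by rewrite (proj1 onb) // eqxx.
Qed.

Lemma inner_basis_sum (c : nat -> R) n j : (j < n)%N -> D j ->
  inner (\sum_(0 <= i < n | i \in D) c i *: e i) (e j) = c j.
Proof.
move=> jn Dj; rewrite inner_suml big_mkord.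
rewrite (bigD1 (Ordinal jn)) /=; last exact: mem_set.
rewrite innerZl (proj1 onb) // eqxx mulr1 big1 ?addr0 // => i.
move=> /andP[/set_mem Di] ne; rewrite innerZl (proj1 onb) //.
have -> : (val i == j) = false; last by rewrite mulr0.
by apply: contraNF ne => /eqP ij; apply/eqP/val_inj.
Qed.

Lemma inner_sum_basis x (c : nat -> R) n :
  inner x (\sum_(0 <= i < n | i \in D) c i *: e i) =
  \sum_(0 <= i < n | i \in D) c i * inner x (e i).
Proof.
rewrite innerC inner_suml; apply: eq_bigr => i _.
by rewrite innerZl innerC.
Qed.

Lemma sqr_norm_basis_sum (c : nat -> R) n :
  `|\sum_(0 <= i < n | i \in D) c i *: e i| ^+ 2 =
  \sum_(0 <= i < n | i \in D) c i ^+ 2.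
Proof.
rewrite -inner_norm inner_sum_basis [LHS]big_seq_cond [RHS]big_seq_cond.
apply: eq_bigr => i; rewrite mem_index_iota /= => /andP[iN /set_mem Di].
by rewrite inner_basis_sum // expr2.
Qed.

Lemma sqr_dist_fourier_sum n x :
  `|x - fourier_sum n x| ^+ 2 = `|x| ^+ 2 - coef_energy n x.
Proof.
rewrite sqr_normB inner_sum_basis sqr_norm_basis_sum /coef_energy.
under eq_bigr do rewrite -expr2.
ring.
Qed.

(** Completing the square: the Fourier sum is the nearest point of the span. *)
Lemma fourier_sum_nearest n x (c : nat -> R) :
  `|x - fourier_sum n x| <= `|x - \sum_(0 <= i < n | i \in D) c i *: e i|.
Proof.
rewrite -ler_sqr ?nnegrE // sqr_dist_fourier_sum sqr_normB inner_sum_basis.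
rewrite sqr_norm_basis_sum -addrA lerD2l -subr_ge0 opprK mulr_sumr -sumrN.
rewrite -!big_split /=; apply: sumr_ge0 => i _.
have := sqr_ge0 (c i - inner x (e i)); nra.
Qed.

(** Density gives some finite combination within [eps]; padding its coefficients
    with zeros compares it with every longer Fourier sum. *)
Lemma fourier_sum_dist_lt x (eps : R) : 0 < eps ->
  exists n0, forall n, (n0 <= n)%N -> `|x - fourier_sum n x| < eps.
Proof.
move=> e0; have := (proj2 onb) (ball x eps).
case.
- by exists x; exact: ballxx.
- exact: ball_open.
- move=> y [bxy [n0 [c yE]]]; exists n0 => n n0n.
  pose c' i := if (i < n0)%N then c i else 0.
  apply: le_lt_trans (fourier_sum_nearest n x c') _.
  suff -> : \sum_(0 <= i < n | i \in D) c' i *: e i = y.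
    by move: bxy; rewrite -ball_normE.
  rewrite yE (big_cat_nat (leq0n n0) n0n) //= [X in _ + X]big_nat_cond [X in _ + X]big1 ?addr0.
    rewrite big_nat_cond [RHS]big_nat_cond; apply: eq_bigr => i.
    by rewrite /c' => /andP[/andP[_ ->]].
  by move=> i /andP[/andP[n0i _] _]; rewrite /c' ltnNge n0i scale0r.
Qed.

(** Parseval's identity. *)
Lemma coef_energy_cvg x : coef_energy ^~ x @ \oo --> `|x| ^+ 2.
Proof.
apply/cvgrPdist_lt => eps e0.
have [] := @fourier_sum_dist_lt x (Num.sqrt eps); first by rewrite sqrtr_gt0.
move=> n0 h; exists n0 => // n /= n0n.
rewrite -sqr_dist_fourier_sum ger0_norm ?sqr_ge0 //.
rewrite -[ltRHS]sqr_sqrtr ?ltW // ltr_sqr ?nnegrE ?sqrtr_ge0 //.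
exact: h.
Qed.

End orthonormal.

(** * Borel measurability in Hilbert spaces *)

Section borel_functions.
Context {R : realType} {X Y : hilbertType R}.

Lemma open_borel (U : set X) : open U -> measurable (U : set (borel X)).
Proof. exact: sub_sigma_algebra. Qed.

Lemma continuous_borel (f : X -> Y) : continuous f ->
  measurable_fun [set: borel X] (f : borel X -> borel Y).
Proof.
move=> cf; apply: (@measurability _ _ (borel X) (borel Y) setT f (@open Y) erefl).
move=> _ [U oU <-]; rewrite setTI; apply: open_borel.
by move/continuousP: cf; apply.
Qed.

Lemma continuous_borel_real (f : X -> R) : continuous f ->
  measurable_fun [set: borel X] (f : borel X -> R).
Proof.
move=> cf; apply: (measurability _ (RGenOpens.measurableE R)).
move=> _ [_ [a [b ->] <-]]; rewrite setTI; apply: open_borel.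
move/continuousP: cf; apply; exact: interval_open.
Qed.

Lemma lipschitz_continuous (f : X -> Y) (L : R) : 0 < L ->
  (forall x x', `|f x - f x'| <= L * `|x - x'|) -> continuous f.
Proof.
move=> L0 fL x; apply/cvgrPdist_lt => eps e0.
near=> y; apply: le_lt_trans (fL _ _) _.
rewrite mulrC -ltr_pdivlMr //.
near: y; apply: cvgr_dist_lt (divr_gt0 e0 L0); exact: cvg_id.
Unshelve. all: by end_near. Qed.

Lemma inner_continuous (y : X) : continuous (inner ^~ y : X -> R).
Proof.
have [->|y0] := eqVneq y 0.
  move=> x; rewrite (_ : inner ^~ 0 = cst 0); first exact: cvg_cst.
  by apply/funext => z; rewrite innerC inner0l.
have n0 : 0 < `|y| by rewrite normr_gt0.
move=> x; apply/cvgrPdist_lt => eps e0.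
near=> z; rewrite -innerBl.
rewrite (_ : y = `|y| *: (`|y|^-1 *: y)); last first.
  by rewrite scalerA mulfV ?scale1r // gt_eqF.
rewrite innerZr normrM normr_id mulrC -ltr_pdivlMr //.
apply: le_lt_trans (inner_norm1 _ _) _.
  by rewrite normrZ normfV normr_id mulVf // gt_eqF.
near: z; apply: cvgr_dist_lt (divr_gt0 e0 n0); exact: cvg_id.
Unshelve. all: by end_near. Qed.

Lemma measurable_inner (y : X) :
  measurable_fun [set: borel X] (inner ^~ y : borel X -> R).
Proof. by apply: continuous_borel_real; exact: inner_continuous. Qed.

End borel_functions.

Section dist_measurable.
Context {R : realType} {Y : hilbertType R} {d} {T : measurableType d}.
Variables (D : set nat) (psi : nat -> Y).
Hypothesis onb : orthonormal_basis D psi.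

(** Continuity of the distance is continuity on the product space, whose Borel
    sets may exceed the product sigma-algebra. By Parseval the distance is a
    limit of functions of real coordinates, to which the product sigma-algebra
    is adapted. *)
Lemma measurable_dist (f g : T -> borel Y) :
  measurable_fun setT f -> measurable_fun setT g ->
  measurable_fun setT (fun x => `|(f x : Y) - g x|).
Proof.
move=> mf mg.
have mfg i : measurable_fun setT (fun x => inner ((f x : Y) - g x) (psi i)).
  under eq_fun do rewrite innerBl.
  by apply: measurable_funB; apply: measurableT_comp (measurable_inner _) _.
have msq : measurable_fun setT (fun x => `|(f x : Y) - g x| ^+ 2).
  apply: (@measurable_fun_cvg _ _ _ _
    (fun n x => coef_energy D psi n ((f x : Y) - g x))).
    move=> n; rewrite /coef_energy.
    under eq_fun do rewrite big_mkcond /=.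
    apply: measurable_sum => i; case: (i \in D); last exact: measurable_cst.
    exact: measurable_funX.
  move=> x _; exact: (coef_energy_cvg onb).
rewrite (_ : (fun x => _) = (fun x => Num.sqrt (`|(f x : Y) - g x| ^+ 2))).
  by apply: measurableT_comp msq; apply: continuous_measurable_fun; exact: sqrt_continuous.
by apply/funext => x; rewrite sqrtr_sqr normr_id.
Qed.

End dist_measurable.

Section nonneg_integral.
Context d (T : measurableType d) (R : realType).
Variable mu : {measure set T -> \bar R}.

(** For nonnegative functions the integral is a supremum over simple
    minorants, so it is monotone on all functions, measurable or not. *)
Lemma integral_mono (f g : T -> \bar R) : (forall x, (0 <= f x)%E) ->
  (forall x, (f x <= g x)%E) -> (\int[mu]_x f x <= \int[mu]_x g x)%E.
Proof.
move=> f0 fg.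
have g0 x : (0 <= g x)%E by exact: le_trans (fg x).
rewrite !ge0_integralTE //; apply: ge_ereal_sup => _ [h hf <-].
by apply: ereal_sup_ubound; exists h => // x; apply: le_trans (hf x) (fg x).
Qed.

End nonneg_integral.

(** * L^p norms on probability spaces *)

Section Lnorm_probability.
Context d (T : measurableType d) (R : realType).
Variable P : probability T R.
Local Open Scope ereal_scope.

Lemma ge0_le_poweR (r : R) (x y : \bar R) : (0 <= r)%R -> 0 <= x -> x <= y ->
  x `^ r <= y `^ r.
Proof.
move=> r0 x0 xy; apply: gt0_ler_poweR => //; rewrite in_itv /= leey andbT //.
exact: le_trans xy.
Qed.

(** Monotonicity holds for all functions, so that an error may be bounded before
    anything is known of its measurability. *)
Lemma Lnorm_mono (p : R) (f g : T -> R) : (0 < p)%R ->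
  (forall x, `|f x| <= g x)%R ->
  'N[P]_p%:E[EFin \o f] <= 'N[P]_p%:E[EFin \o g].
Proof.
move=> p0 fg; rewrite unlock; apply: ge0_le_poweR.
- by rewrite invr_ge0 ltW.
- by apply: integral_ge0 => x _; exact: poweR_ge0.
apply: integral_mono => x; first exact: poweR_ge0.
rewrite /= !lee_fin ge0_ler_powR ?nnegrE ?(ltW p0) //.
by rewrite (le_trans (fg x)) // ler_norm.
Qed.

Lemma Lnorm_cst (p c : R) : (0 < p)%R -> (0 <= c)%R ->
  'N[P]_p%:E[EFin \o cst c] = c%:E.
Proof.
move=> p0 c0; rewrite unlock /=.
rewrite (_ : (fun x : T => _) = cst (c `^ p)%:E); last first.
  by apply/funext => x; rewrite /= ger0_norm.
rewrite integral_cst //= probability_setT mule1 poweR_EFin -powRrM.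
by rewrite mulfV ?gt_eqF // powRr1.
Qed.

Lemma Lnorm1_le (r : R) (f : T -> R) : (1 <= r)%R -> measurable_fun setT f ->
  \int[P]_x `|f x|%:E <= 'N[P]_r%:E[EFin \o f].
Proof.
move=> r1 mf; have r0 : (0 < r)%R by exact: lt_le_trans r1.
move: r1; rewrite le_eqVlt => /predU1P[<-|r1].
  by rewrite Lnorm1.
pose q := (1 - r^-1)^-1%R.
have q0 : (0 < q)%R by rewrite invr_gt0 subr_gt0 invf_lt1.
have := @hoelder _ _ _ P f (cst 1%R) r q mf (measurable_cst _) r0 q0.
rewrite invrK addrC subrK => /(_ erefl).
rewrite Lnorm_cst // mule1 Lnorm1.
by under eq_integral do rewrite /= mulr1.
Qed.

(** Hoelder against the constant 1: on a probability space the norms increase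
    with the exponent. *)
Lemma Lnorm_le (p q : R) (f : T -> R) : (0 < p)%R -> (p <= q)%R ->
  measurable_fun setT f -> 'N[P]_p%:E[EFin \o f] <= 'N[P]_q%:E[EFin \o f].
Proof.
move=> p0 pq mf.
have mfp : measurable_fun setT (fun x => `|f x| `^ p)%R.
  by apply: (measurableT_comp (measurable_powR _)); exact: measurableT_comp.
have qp1 : (1 <= q / p)%R by rewrite ler_pdivlMr // mul1r.
have := Lnorm1_le qp1 mfp; rewrite unlock /= => h.
pose I := \int[P]_x (`|f x| `^ q)%:E.
have hI : \int[P]_x (`|f x| `^ p)%:E <= I `^ (p / q).
  apply: le_trans (le_trans h _).
    apply: integral_mono => x; first by rewrite lee_fin powR_ge0.
    by rewrite lee_fin ler_norm.
  suff -> : \int[P]_x (`| `|f x| `^ p| `^ (q / p))%:E = I by rewrite invf_div.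
  apply: eq_integral => x _.
  by rewrite ger0_norm ?powR_ge0 // -powRrM mulrCA mulfV ?gt_eqF // mulr1.
apply: (@le_trans _ _ ((I `^ (p / q)) `^ p^-1)).
  apply: ge0_le_poweR hI; first by rewrite invr_ge0 ltW.
  by apply: integral_ge0 => x _; rewrite lee_fin powR_ge0.
by rewrite -poweRrM mulrAC mulfV ?gt_eqF // mul1r.
Qed.

Lemma LnormZ_le (q c : R) (f : T -> R) : (0 < q)%R -> (0 <= c)%R ->
  measurable_fun setT f ->
  'N[P]_q%:E[EFin \o (fun x => c * f x)%R] <= c%:E * 'N[P]_q%:E[EFin \o f].
Proof.
move=> q0 c0 mf; rewrite unlock.
have mfq : measurable_fun setT (fun x => (`|f x| `^ q)%:E).
  by apply/measurable_EFinP; apply: (measurableT_comp (measurable_powR _));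
    exact: measurableT_comp.
rewrite (eq_integral (fun x => (c `^ q)%:E * (`|f x| `^ q)%:E)); last first.
  by move=> x _; rewrite /= normrM powRM // (ger0_norm c0) EFinM.
rewrite ge0_integralZl_EFin ?powR_ge0 //.
rewrite poweRM ?lee_fin ?powR_ge0 //; last by apply: integral_ge0 => x _; rewrite lee_fin powR_ge0.
by rewrite poweR_EFin -powRrM mulfV ?gt_eqF // powRr1.
Qed.

Lemma Lnorm_sum_le (q : R) (I : Type) (r : seq I) (f : I -> T -> R) : (1 <= q)%R ->
  (forall i, measurable_fun setT (f i)) ->
  'N[P]_q%:E[EFin \o (fun x => \sum_(i <- r) f i x)%R] <=
  \sum_(i <- r) 'N[P]_q%:E[EFin \o f i].
Proof.
move=> q1 mf; have q0 : (0 < q)%R by exact: lt_le_trans q1.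
elim: r => [|i r ih].
  rewrite big_nil (_ : _ \o _ = EFin \o cst 0%R) ?Lnorm_cst //.
  by apply/funext => x; rewrite /= big_nil.
rewrite big_cons; apply: le_trans (leeD2l _ ih).
have mr : measurable_fun setT (fun x => \sum_(i <- r) f i x)%R.
  exact: measurable_sum.
have := @minkowski_EFin _ _ _ P _ _ q (mf i) mr q1.
by congr (_ <= _); congr Lnorm; apply/funext => x; rewrite /= big_cons.
Qed.

End Lnorm_probability.

(** * Errors in L^p *)

Section Lp_space.
Context {R : realType} {X Y : hilbertType R}.
Variables (D : set nat) (psi : nat -> Y).
Hypothesis onb : orthonormal_basis D psi.
Variables (mu : probability (borel X) R) (p : R).
Hypothesis p1 : 1 <= p.
Local Open Scope ereal_scope.

Let p0 : (0 < p)%R. Proof. exact: lt_le_trans p1. Qed.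

Definition borel_map (F : X -> Y) :=
  measurable_fun [set: borel X] (F : borel X -> borel Y).

Lemma Lp_norm_ge0 (F : X -> Y) : 0 <= Lp_norm mu p F.
Proof. exact: Lnorm_ge0. Qed.

Lemma Lp_norm_bound (F : X -> Y) (g : borel X -> R) : (forall x, `|F x| <= g x)%R ->
  Lp_norm mu p F <= 'N[mu]_p%:E[EFin \o g].
Proof. by move=> Fg; apply: Lnorm_mono p0 _ => x /=; rewrite normr_id. Qed.

Lemma Lp_norm_triangle F G H : borel_map F -> borel_map G -> borel_map H ->
  Lp_norm mu p (F \- H)%R <= Lp_norm mu p (F \- G)%R + Lp_norm mu p (G \- H)%R.
Proof.
move=> mF mG mH.
have mFG := measurable_dist onb mF mG; have mGH := measurable_dist onb mG mH.
apply: (le_trans _ (@minkowski_EFin _ _ _ mu _ _ p mFG mGH p1)).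
apply: Lp_norm_bound => x /=.
exact: ler_distD.
Qed.

(** Open balls of L^p are Lp_open, so the error of an estimator is a measurable
    function of the data. *)
Lemma measurable_error d (T : measurableType d) (Fhat : T -> X -> Y) F :
  Lp mu p F -> estimator mu p T Fhat ->
  measurable_fun setT (fun z => Lp_norm mu p (F \- Fhat z)%R).
Proof.
move=> [mF Ffin] [FhatL FhatU].
apply: (measurability _ (ErealGenInftyO.measurableE R)).
move=> _ [_ [r ->] <-]; rewrite setTI.
rewrite (_ : _ @^-1` _ = Fhat @^-1` [set G | Lp_norm mu p (F \- G)%R < r%:E]);
  last by apply/seteqP; split => z /=; rewrite in_itv.
apply: FhatU => G [mG Gfin] /= Gr.
have Gf : Lp_norm mu p (F \- G)%R \is a fin_num.
  by rewrite ge0_fin_numE ?Lp_norm_ge0 // (lt_trans Gr) ?ltry.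
exists (r - fine (Lp_norm mu p (F \- G)%R))%R.
  by rewrite subr_gt0 -lte_fin fineK.
move=> H [mH Hfin] GH.
apply: le_lt_trans (Lp_norm_triangle mF mG mH) _.
by rewrite -(subrK (fine (Lp_norm mu p (F \- G)%R)) r) EFinD addeC
  -[X in X + _](fineK Gf) lteD2lE // addeC.
Qed.

End Lp_space.

(** * Fooling families of signed bumps *)

Section averaging.
Context d (T : measurableType d) (R : realType) (I : finType).
Variable P : probability T R.
Local Open Scope ereal_scope.

(** The largest of the risks [b] dominates their average over [I], which can be
    bounded below separately at each sample point [z]. *)
Lemma average_lower_bound (g : I -> T -> \bar R) (c : R) (b : \bar R) :
  (0 < #|I|)%N -> (0 <= c)%R ->
  (forall i, measurable_fun setT (g i)) -> (forall i z, 0 <= g i z) ->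
  (forall z, (#|I|%:R * c)%:E <= \sum_(i : I) g i z) ->
  (forall i, \int[P]_z g i z <= b) -> c%:E <= b.
Proof.
move=> I0 c0 mg g0 cg gb.
have bI : (#|I|%:R * c)%:E <= \sum_(i : I) b.
  apply: (@le_trans _ _ (\sum_(i : I) \int[P]_z g i z)); last exact: lee_sum.
  rewrite -ge0_integral_sum //.
  apply: (@le_trans _ _ (\int[P]_z (cst (#|I|%:R * c)%:E) z)).
    by rewrite integral_cst //= probability_setT mule1.
  by apply: integral_mono => z //=; rewrite lee_fin mulr_ge0.
have [->|boo] := eqVneq b +oo; first by rewrite leey.
have : b \is a fin_num.
  have [i _] : exists i : I, i \in I by move/card_gt0P: I0.
  rewrite ge0_fin_numE ?ltey //; apply: le_trans (gb i).
  exact: integral_ge0.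
move: bI; case: b {gb boo} => [b| |] //= + _.
rewrite sumEFin !lee_fin sumr_const -[leRHS]mulr_natl ler_pM2l //.
by rewrite ltr0n.
Qed.

End averaging.

Section fooling.
Context {R : realType} {X Y : hilbertType R} {K : finType}.
Variables (eta : K -> X -> R) (h l : R) (y0 : Y).
Hypothesis eta01 : forall k x, 0 <= eta k x <= 1.
Hypothesis eta_disjoint : forall k k' x,
  eta k x != 0 -> eta k' x != 0 -> k = k'.
Hypothesis eta_lip : forall k x x', `|eta k x - eta k x'| <= l * `|x - x'|.
Hypothesis h0 : 0 <= h.
Hypothesis y01 : `|y0| = 1.

Notation signs := {ffun K -> bool}.

Definition flip (k : K) (eps : signs) : signs :=
  [ffun j => if j == k then ~~ eps j else eps j].

Lemma flipK k : involutive (flip k).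
Proof.
by move=> eps; apply/ffunP => j; rewrite !ffunE; case: eqP => // _; rewrite negbK.
Qed.

Definition signed_bumps (eps : signs) (x : X) : R :=
  \sum_k (-1) ^+ eps k * eta k x.

Definition fooling_map (eps : signs) (x : X) : Y :=
  (h * signed_bumps eps x) *: y0.

Lemma signed_bumps_on eps k x : eta k x != 0 ->
  signed_bumps eps x = (-1) ^+ eps k * eta k x.
Proof.
move=> kx; rewrite /signed_bumps (bigD1 k) //= big1 ?addr0 // => j jk.
case: (eqVneq (eta j x) 0) => [->|jx]; first by rewrite mulr0.
by rewrite (eta_disjoint jx kx) eqxx in jk.
Qed.

Lemma signed_bumps_le1 eps x : `|signed_bumps eps x| <= 1.
Proof.
have [/existsP[k kx]|/existsPn no] := boolP [exists k, eta k x != 0].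
  rewrite (signed_bumps_on _ kx) normrM normrX normrN1 expr1n mul1r.
  by have /andP[? ?] := eta01 k x; rewrite ger0_norm.
rewrite /signed_bumps big1 ?normr0 // => k _.
by have := no k; rewrite negbK => /eqP ->; rewrite mulr0.
Qed.

Lemma card_active x : (#|[set k | eta k x != 0%R]%SET| <= 1)%N.
Proof.
apply/card_le1P => k; rewrite inE => kx j; rewrite !inE.
apply/idP/eqP => [jx|->//]; exact: eta_disjoint jx kx.
Qed.

(** At most one bump is active at each of the two points, whence the factor 2. *)
Lemma signed_bumps_lip eps x x' : 0 <= l ->
  `|signed_bumps eps x - signed_bumps eps x'| <= 2 * l * `|x - x'|.
Proof.
move=> l0; rewrite /signed_bumps -sumrB.
pose A := ([set k | eta k x != 0%R] :|: [set k | eta k x' != 0%R])%SET.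
rewrite (bigID (mem A)) /= [X in _ + X]big1 ?addr0; last first.
  move=> k; rewrite !inE negb_or !negbK => /andP[/eqP -> /eqP ->].
  by rewrite !mulr0 subr0.
apply: le_trans (ler_norm_sum _ _ _) _.
apply: (@le_trans _ _ (\sum_(k in A) l * `|x - x'|)).
  apply: ler_sum => k _.
  by rewrite -mulrBr normrM normrX normrN1 expr1n mul1r.
rewrite sumr_const -[leLHS]mulr_natl -mulrA ler_wpM2r ?mulr_ge0 //.
rewrite ler_nat; apply: leq_trans (leq_card_setU _ _) _.
by rewrite (leq_add (card_active x) (card_active x')).
Qed.

Lemma fooling_map_lip eps x x' : 0 <= l ->
  `|fooling_map eps x - fooling_map eps x'| <= h * (2 * l) * `|x - x'|.
Proof.
move=> l0; rewrite -scalerBl normrZ y01 mulr1 -mulrBr normrM ger0_norm //.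
by rewrite -mulrA ler_wpM2l // signed_bumps_lip.
Qed.

Lemma fooling_map_flip k eps x : eta k x = 0 ->
  fooling_map (flip k eps) x = fooling_map eps x.
Proof.
move=> kx; congr (_ * _ *: _); apply: eq_bigr => j _; rewrite ffunE.
by case: eqP => [->|//]; rewrite kx !mulr0.
Qed.

Lemma fooling_map_gap k eps x : 2^-1 <= eta k x ->
  h <= `|fooling_map (flip k eps) x - fooling_map eps x|.
Proof.
move=> kx; have kx0 : eta k x != 0 by rewrite gt_eqF // (lt_le_trans _ kx).
rewrite -scalerBl normrZ y01 mulr1 -mulrBr normrM ger0_norm //.
rewrite !(signed_bumps_on _ kx0) ffunE eqxx.
rewrite -[leLHS]mulr1 ler_wpM2l //.
case: (eps k); rewrite /= expr0 expr1 ler_normr; apply/orP; [left|right]; lra.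
Qed.

(** Pair [eps] with [flip k eps]: the two maps are [h] apart at [x] and share
    their answer, so by the triangle inequality their errors add up to [h]. *)
Lemma pointwise_confusion (G : signs -> X -> Y) k x :
  (forall eps, G (flip k eps) = G eps) -> 2^-1 <= eta k x ->
  #|signs|%:R * (h / 2) <= \sum_eps `|fooling_map eps x - G eps x|.
Proof.
move=> Gk kx.
have E : \sum_eps `|fooling_map eps x - G eps x| =
    \sum_eps `|fooling_map (flip k eps) x - G eps x|.
  rewrite (reindex_inj (inv_inj (flipK k))) /=.
  by under eq_bigr do rewrite Gk.
suff : #|signs|%:R * h <= \sum_eps `|fooling_map eps x - G eps x| +
    \sum_eps `|fooling_map eps x - G eps x| by lra.
rewrite {2}E -big_split /= mulr_natl -sumr_const; apply: ler_sum => eps _.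
apply: le_trans (fooling_map_gap eps kx) _.
rewrite -(subrKA (G eps x)) -[X in _ <= X + _]normrN opprB addrC.
exact: ler_normD.
Qed.

End fooling.

Section process_measurability.
Context {R : realType} {Y : Type} {d} {T : measurableType d}.

Lemma measurable_process (f : T -> process R Y) :
  (forall y, measurable_fun setT (fun t => f t y)) -> measurable_fun setT f.
Proof.
move=> mf; apply: (@measurability _ _ T (process R Y) setT f (@cylinders R Y) erefl).
move=> _ [_ [y [A [mA ->]]] <-]; rewrite setTI.
by have := mf y measurableT A mA; rewrite setTI.
Qed.

Lemma measurable_process_eval (y : Y) :
  measurable_fun setT (fun z : process R Y => z y).
Proof.
move=> _ A mA; rewrite setTI; apply: sub_sigma_algebra.
by exists y, A; split.
Qed.

End process_measurability.

Section observations.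
Context {R : realType} {X Y : hilbertType R} {d : measure_display}
  {Omega : measurableType d}.
Variables (P : probability Omega R) (E : nat -> {RV P >-> process R Y}).
Variables (sigma : R) (m : nat).

Lemma measurable_observations d' (T : measurableType d') (F : X -> Y)
    (xs : T -> m.-tuple (borel X)) (om : T -> Omega) :
  borel_map F -> measurable_fun setT xs -> measurable_fun setT om ->
  measurable_fun setT (fun t => observations E sigma F (xs t) (om t)).
Proof.
move=> mF mxs mom; apply/measurable_fun_tnthP => i.
apply: measurable_process => y.
rewrite (_ : (fun t => _) = (fun t =>
    inner (F (tnth (xs t) i)) y + sigma * E i (om t) y)); last first.
  by apply/funext => t; rewrite /= tnth_mktuple.
apply: measurable_funD.
  apply: (measurableT_comp (measurable_inner y)).
  apply: (measurableT_comp mF); exact: measurableT_comp (measurable_tnth i) mxs.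
apply: measurable_funM => //.
have mE : measurable_fun setT (E i \o om) by exact: measurableT_comp mom.
exact: measurableT_comp (measurable_process_eval y) mE.
Qed.

Lemma eq_observations (F F' : X -> Y) x omega :
  (forall i : 'I_m, F (tnth x i) = F' (tnth x i)) ->
  observations E sigma F x omega = observations E sigma F' x omega.
Proof.
move=> FF'; apply: eq_from_tnth => i; rewrite !tnth_mktuple.
by apply/funext => y; rewrite FF'.
Qed.

End observations.

Section confusion.
Context {R : realType} {X Y : hilbertType R} {K : finType}.
Variables (D : set nat) (psi : nat -> Y).
Hypothesis onb : orthonormal_basis D psi.
Variables (mu : probability (borel X) R) (p : R).
Hypothesis p1 : 1 <= p.
Variables (eta : K -> X -> R) (h l : R) (y0 : Y).
Hypothesis eta01 : forall k x, 0 <= eta k x <= 1.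
Hypothesis eta_disjoint : forall k k' x,
  eta k x != 0 -> eta k' x != 0 -> k = k'.
Hypothesis eta_lip : forall k x x', `|eta k x - eta k x'| <= l * `|x - x'|.
Hypotheses (h0 : 0 < h) (l0 : 0 < l).
Hypothesis y01 : `|y0| = 1.
Variables (Q : K -> set (borel X)) (v : R).
Hypothesis mQ : forall k, measurable (Q k).
Hypothesis Qeta : forall k x, Q k x -> 2^-1 <= eta k x.
Hypothesis Qv : forall k, (v%:E <= mu (Q k))%E.

Notation signs := {ffun K -> bool}.
Let Feps := fooling_map eta h y0.

Lemma borel_fooling_map eps : borel_map (Feps eps).
Proof.
apply: continuous_borel; apply: (@lipschitz_continuous _ _ _ _ (h * (2 * l))).
  by rewrite !mulr_gt0.
by move=> x x'; apply: fooling_map_lip => //; exact: ltW.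
Qed.

Lemma fooling_map_Lp eps : Lp mu p (Feps eps).
Proof.
split; first exact: borel_fooling_map.
apply: le_lt_trans (@Lp_norm_bound _ _ _ mu p p1 _ (cst h) _) _.
  move=> x; rewrite /Feps /fooling_map normrZ y01 mulr1 normrM (ger0_norm (ltW h0)).
  by rewrite /= -[leRHS]mulr1 ler_pM2l // signed_bumps_le1.
by rewrite (Lnorm_cst _ (lt_le_trans ltr01 p1) (ltW h0)) ltry.
Qed.

(** Integrating the pointwise bound over the disjoint sets [Q k], [k] in [A]. *)
Lemma confusion (G : signs -> X -> Y) (A : {set K}) :
  (forall eps, borel_map (G eps)) ->
  (forall k eps, k \in A -> G (flip k eps) = G eps) ->
  ((#|{: signs}|%:R * (h / 2 * (#|A|%:R * v)))%:E <=
    \sum_(eps : signs) Lp_norm mu p (Feps eps \- G eps)%R)%E.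
Proof.
move=> mG GA; pose c : R := #|{: signs}|%:R * (h / 2).
have c0 : 0 <= c by rewrite mulr_ge0 // divr_ge0 // ltW.
have md eps : measurable_fun setT (fun x : borel X => `|Feps eps x - G eps x|).
  by have := measurable_dist onb (borel_fooling_map eps) (mG eps).
apply: (@le_trans _ _ (\sum_(eps : signs)
    \int[mu]_x (`|Feps eps x - G eps x|)%:E)%E); last first.
  apply: lee_sum => eps _; apply: le_trans (Lnorm1_le mu p1 (md eps)).
  by apply: integral_mono => x; rewrite lee_fin // normr_id.
rewrite -ge0_integral_sum //; last by move=> eps; exact/measurable_EFinP.
apply: (@le_trans _ _ (\int[mu]_x \sum_(k <- enum A) (c * \1_(Q k) x)%:E)%E).
  rewrite ge0_integral_sum // ?big_enum /=; last 2 first.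
  - by move=> k; apply/measurable_EFinP; apply: measurable_funM.
  - by move=> k x _; rewrite lee_fin mulr_ge0.
  apply: (@le_trans _ _ (\sum_(k in A) (c * v)%:E)%E).
    rewrite sumEFin lee_fin sumr_const -[leRHS]mulr_natl /c.
    by rewrite le_eqVlt; apply/orP; left; apply/eqP; ring.
  apply: lee_sum => k _.
  under eq_integral do rewrite EFinM.
  rewrite ge0_integralZl_EFin //; last exact/measurable_EFinP.
  rewrite integral_indic // setIT EFinM; exact: lee_wpmul2l (Qv k).
apply: integral_mono => x.
  by apply: sume_ge0 => k _; rewrite lee_fin mulr_ge0.
rewrite big_enum /= !sumEFin lee_fin.
have [/existsP[k /andP[kA /asboolP Qk]]|/existsPn no] :=
    boolP [exists k, (k \in A) && `[< Q k x >]].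
  rewrite (bigD1 k) //= big1 ?addr0; last first.
    move=> j /andP[_ jk]; rewrite indicE memNset ?mulr0 // => Qj.
    have pos i : Q i x -> eta i x != 0.
      by move=> Qi; rewrite gt_eqF // (lt_le_trans _ (Qeta Qi)).
    by move: jk; rewrite (eta_disjoint (pos j Qj) (pos k Qk)) eqxx.
  rewrite indicE mem_set // mulr1.
  by apply: (@pointwise_confusion _ _ _ _ eta h y0 eta_disjoint (ltW h0) y01 G k)
    => [eps|]; [exact: GA|exact: Qeta].
rewrite big1; first exact: sumr_ge0.
move=> k kA; have := no k; rewrite kA /= => /asboolPn nQ.
by rewrite indicE memNset ?mulr0.
Qed.

End confusion.

(** * Risk bounds from bumps that the design misses *)

Section fooling_risk.
Context {R : realType} {X Y : hilbertType R} {K : finType}.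
Variables (D : set nat) (psi : nat -> Y).
Hypothesis onb : orthonormal_basis D psi.
Variables (mu : probability (borel X) R) (p : R).
Hypothesis p1 : 1 <= p.
Context {d : measure_display} {Omega : measurableType d}.
Variables (P : probability Omega R) (E : nat -> {RV P >-> process R Y}).
Variables (sigma : R) (m : nat) (cF : set (X -> Y)).
Variables (eta : K -> X -> R) (h l : R) (y0 : Y).
Hypothesis eta01 : forall k x, 0 <= eta k x <= 1.
Hypothesis eta_disjoint : forall k k' x,
  eta k x != 0 -> eta k' x != 0 -> k = k'.
Hypothesis eta_lip : forall k x x', `|eta k x - eta k x'| <= l * `|x - x'|.
Hypotheses (h0 : 0 < h) (l0 : 0 < l).
Hypothesis y01 : `|y0| = 1.
Variables (Q : K -> set (borel X)) (v : R).
Hypothesis mQ : forall k, measurable (Q k).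
Hypothesis Qeta : forall k x, Q k x -> 2^-1 <= eta k x.
Hypothesis v0 : 0 <= v.
Hypothesis Qv : forall k, (v%:E <= mu (Q k))%E.
Hypothesis cK : (2 * m <= #|K|)%N.
Hypothesis cF_fool : forall eps, cF (fooling_map eta h y0 eps).

Let Feps := fooling_map eta h y0.

Definition idle (x : m.-tuple (borel X)) : {set K} :=
  [set k | [forall i, eta k (tnth x i) == 0%R]]%SET.

(** A design point activates at most one bump, so at most [m <= #|K| / 2] bumps
    are active. *)
Lemma card_idle x : #|K|%:R / 2 <= #|idle x|%:R :> R.
Proof.
suff h1 : (#|~: idle x| <= m)%N.
  have := cardsC (idle x) => /(congr1 (fun n => n%:R : R)).
  rewrite natrD => E1.
  have : (#|~: idle x|%:R <= m%:R :> R) by rewrite ler_nat.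
  have : ((2 * m)%:R <= #|K|%:R :> R) by rewrite ler_nat.
  rewrite natrM; lra.
rewrite -sum1_card.
apply: (@leq_trans (\sum_k \sum_(i < m) (eta k (tnth x i) != 0%R))).
  rewrite [leqLHS]big_mkcond /=; apply: leq_sum => k _.
  rewrite !inE; case: ifP => //; rewrite negb_forall => /existsP[i ki].
  by rewrite (bigD1 i) //= ki.
rewrite exchange_big /= -[leqRHS]card_ord -sum1_card; apply: leq_sum => i _.
apply: leq_trans (card_active eta_disjoint (tnth x i)).
by rewrite -sum1_card [leqRHS]big_mkcond /=; apply: leq_sum => k _; rewrite inE; case: eqP.
Qed.

(** The observations only involve the values at the design points, so the
    signs of idle bumps never reach the estimator. The sample space [T] is that
    of the noise for a fixed design and of design and noise for a random one. *)
Lemma fooling_risk d' (T : measurableType d') (P' : probability T R)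
    (xs : T -> m.-tuple (borel X)) (om : T -> Omega)
    (est : m.-tuple (borel X) -> m.-tuple (process R Y) -> X -> Y) (b : \bar R) :
  (forall F, borel_map F -> estimator mu p T
     (fun z => est (xs z) (observations E sigma F (xs z) (om z)))) ->
  (forall F, cF F -> (\int[P']_z Lp_norm mu p
     (F \- est (xs z) (observations E sigma F (xs z) (om z)))%R <= b)%E) ->
  ((#|K|%:R * h * v / 4)%:E <= b)%E.
Proof.
move=> mest hb.
have mF eps : borel_map (Feps eps).
  exact: (borel_fooling_map eta_disjoint eta_lip h0 l0 y01).
apply: (@average_lower_bound _ _ _ {ffun K -> bool} P' (fun eps z => Lp_norm mu p
   (Feps eps \- est (xs z) (observations E sigma (Feps eps) (xs z) (om z)))%R)).
- by rewrite card_ffun card_bool expn_gt0.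
- by rewrite divr_ge0 // !mulr_ge0 // ltW.
- move=> eps; apply: (measurable_error onb p1); last exact: mest.
  exact: (fooling_map_Lp mu p1 eta01 eta_disjoint eta_lip h0 l0 y01).
- by move=> eps z; exact: Lp_norm_ge0.
- move=> z; pose A := idle (xs z).
  apply: (@le_trans _ _
    (#|{: {ffun K -> bool}}|%:R * (h / 2 * (#|A|%:R * v)))%:E); last first.
    apply: (confusion onb p1 eta_disjoint eta_lip h0 l0 y01 mQ Qeta Qv).
      by move=> eps; have [/(_ z)[]] := mest _ (mF eps).
    move=> k eps; rewrite inE => /forallP kA; congr (est _ _).
    by apply: eq_observations => i; apply: fooling_map_flip; exact/eqP.
  rewrite lee_fin ler_wpM2l //.
  have -> : #|K|%:R * h * v / 4 = h / 2 * (#|K|%:R / 2 * v) by field.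
  by rewrite ler_wpM2l ?divr_ge0 ?(ltW h0) // ler_wpM2r // card_idle.
- by move=> eps; exact: hb.
Qed.

Lemma estimator_comp d1 d2 (T1 : measurableType d1) (T2 : measurableType d2)
    (Fhat : T2 -> X -> Y) (f : T1 -> T2) : measurable_fun setT f ->
  estimator mu p T2 Fhat -> estimator mu p T1 (fun z => Fhat (f z)).
Proof.
move=> mf [FL FU]; split=> [z|U oU]; first exact: FL.
by have := mf measurableT _ (FU _ oU); rewrite setTI.
Qed.

Lemma fixed_risk_ge :
  ((#|K|%:R * h * v / 4)%:E <= fixed_minimax_risk E sigma m cF mu p)%E.
Proof.
apply: le_ereal_inf_tmp => _ [x _ <-]; apply: le_ereal_inf_tmp => _ [Fhat FhatE <-].
apply: (@fooling_risk _ _ P (cst x) id (fun _ => Fhat)).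
  move=> F mF; apply: estimator_comp FhatE.
  exact: measurable_observations.
by move=> F cFF; apply: ereal_sup_ubound; exists F.
Qed.

Lemma random_risk_ge :
  ((#|K|%:R * h * v / 4)%:E <= random_minimax_risk E sigma m cF mu p)%E.
Proof.
apply: le_ereal_inf_tmp => _ [nu _ <-]; apply: le_ereal_inf_tmp => _ [Fhat FhatE <-].
apply: (@fooling_risk _ _ (iid_law nu m \x P)%E fst snd (fun x y => Fhat (x, y))).
  move=> F mF; apply: (@estimator_comp _ _ _ _ Fhat (fun z =>
    (z.1, observations E sigma F z.1 z.2))) FhatE.
  apply: measurable_fun_pair; first exact: measurable_fst.
  exact: measurable_observations.
by move=> F cFF; apply: ereal_sup_ubound; exists F.
Qed.

End fooling_risk.

(** * Bumps on cubes of whitened coordinates *)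

Section tents.
Context {R : realType}.
Implicit Types r c s : R.

Definition tent r c s : R := Num.max 0 (1 - `|s - c| / r).

Lemma tent01 r c s : 0 < r -> 0 <= tent r c s <= 1.
Proof.
move=> r0; rewrite /tent le_max lexx /= ge_max ler01 /=.
by rewrite lerBlDr lerDl divr_ge0 // ltW.
Qed.

Lemma tent_lip r c s s' : 0 < r -> `|tent r c s - tent r c s'| <= `|s - s'| / r.
Proof.
move=> r0; rewrite /tent.
have h1 : `| `|s - c| / r - `|s' - c| / r| <= `|s - s'| / r.
  rewrite -mulrBl normrM [X in _ * X]gtr0_norm ?invr_gt0 //.
  rewrite ler_wpM2r ?invr_ge0 ?(ltW r0) //.
  by apply: le_trans (ler_dist_dist _ _) _; rewrite opprB addrA subrK.
move: h1; set u := `|s - c| / r; set u' := `|s' - c| / r; set w := _ / r.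
rewrite /Num.max; move=> /ler_normlP[h1 h2].
by case: ltP => A; case: ltP => B; apply/ler_normlP; split; lra.
Qed.

Lemma tent_neq0 r c s : 0 < r -> tent r c s != 0 -> `|s - c| < r.
Proof.
move=> r0; rewrite /tent /Num.max; case: ltP => [h _|_]; last by rewrite eqxx.
by move: h; rewrite subr_gt0 ltr_pdivrMr // mul1r.
Qed.

Lemma tent_ge_half r c s : 0 < r -> `|s - c| <= r / 2 -> 2^-1 <= tent r c s.
Proof.
move=> r0 h; rewrite /tent le_max; apply/orP; right.
have : `|s - c| / r <= 2^-1 by rewrite ler_pdivrMr // mulrC.
lra.
Qed.

Lemma bigmin_lip (I : finType) (f g : I -> R) (delta : R) : 0 <= delta ->
  (forall i, `|f i - g i| <= delta) ->
  `|\big[Num.min/1]_i f i - \big[Num.min/1]_i g i| <= delta.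
Proof.
move=> d0 fg; elim/big_rec2: _ => [|i u u' _ ih]; first by rewrite subrr normr0.
have /ler_normlP[h1 h2] := fg i; move/ler_normlP: ih => [h3 h4].
by rewrite /Num.min; case: ltP => A; case: ltP => B; apply/ler_normlP; split; lra.
Qed.

Lemma bigmin_neq0 (I : finType) (f : I -> R) : (forall i, 0 <= f i) ->
  \big[Num.min/1]_i f i != 0 -> forall i, f i != 0.
Proof.
move=> f0 nz i; apply: contra nz => /eqP fi.
rewrite eq_le; apply/andP; split; first by rewrite -fi bigmin_le_cond.
by apply/bigmin_geP; split => // j _.
Qed.

(** The [N] subintervals of [[-a, a]] have centres [center a N j] and half
    length [a / N]. *)
Definition center (a : R) (N j : nat) : R := - a + (2 * j%:R + 1) * (a / N%:R).

Lemma center_inj a N (i j : nat) s : 0 < a -> (0 < N)%N ->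
  `|s - center a N i| < a / N%:R -> `|s - center a N j| < a / N%:R -> i = j.
Proof.
move=> a0 N0; rewrite /center; set r := a / N%:R => hi hj.
have r0 : 0 < r by rewrite divr_gt0 // ltr0n.
have : `|(i%:R - j%:R) * (2 * r)| < 1 * (2 * r).
  have -> : (i%:R - j%:R) * (2 * r) =
      (s - (- a + (2 * j%:R + 1) * r)) - (s - (- a + (2 * i%:R + 1) * r)) by ring.
  apply: le_lt_trans (ler_normB _ _) _; lra.
have r20 : 0 < 2 * r by rewrite mulr_gt0.
rewrite normrM (gtr0_norm r20) ltr_pM2r // => h.
apply/eqP; rewrite eqn_leq; apply/andP; split; rewrite leqNgt; apply/negP => ij.
- have : (j.+1%:R <= i%:R :> R) by rewrite ler_nat.
  rewrite -natr1; move: h => /ltr_normlP[]; lra.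
- have : (i.+1%:R <= j%:R :> R) by rewrite ler_nat.
  rewrite -natr1; move: h => /ltr_normlP[]; lra.
Qed.

Lemma center_in (a : R) (N j : nat) s : 0 < a -> (j < N)%N ->
  `|s - center a N j| <= a / N%:R / 2 -> `|s| <= a.
Proof.
move=> a0 jN; rewrite /center; set r := a / N%:R => h.
have N0 : (0 < N)%N by exact: leq_ltn_trans jN.
have aE : a = N%:R * r by rewrite /r mulrCA mulfV ?mulr1 // pnatr_eq0 -lt0n.
have jN1 : (j%:R + 1 <= N%:R :> R) by rewrite natr1 ler_nat.
have j0 : (0 <= j%:R :> R) by [].
move/ler_normlP : h => [h1 h2]; apply/ler_normlP; split; nra.
Qed.

End tents.

Section cubes.
Context {R : realType} {X : hilbertType R}.
Variables (mu : probability (borel X) R) (lambda : nat -> R) (phi : nat -> X).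
Hypothesis lambda0 : forall i, 0 < lambda i.
Hypothesis lambda_noninc : forall i j, (i <= j)%N -> lambda j <= lambda i.
Hypothesis phi1 : forall i, `|phi i| = 1.

Lemma xi_lip i (x x' : X) :
  `|xi lambda phi i x - xi lambda phi i x'| <= `|x - x'| / Num.sqrt (lambda i).
Proof.
have s0 : 0 < Num.sqrt (lambda i) by rewrite sqrtr_gt0.
rewrite /xi -mulrBl -innerBl normrM [X in _ * X]gtr0_norm ?invr_gt0 //.
by rewrite ler_wpM2r ?invr_ge0 ?(ltW s0) // inner_norm1.
Qed.

Lemma measurable_xi i : measurable_fun setT (xi lambda phi i).
Proof. by apply: measurable_funM => //; exact: measurable_inner. Qed.

Lemma density_lower_bound (Z : borel X -> R) (nu : R -> R) (b s r : R) :
  density_of mu Z nu -> 0 <= b -> 0 < r ->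
  (forall x, `|x - s| <= r -> b <= nu x) ->
  ((b * (2 * r))%:E <= mu (Z @^-1` [set x | (`|x - s| <= r)%R]))%E.
Proof.
move=> [mnu nu0 nuE] b0 r0 hb.
have AE : [set x | (`|x - s| <= r)%R] = `[s - r, s + r]%classic.
  by apply/seteqP; split => x /=; rewrite in_itv /= ler_norml => /andP[h1 h2];
    apply/andP; split; lra.
have mA : measurable [set x | (`|x - s| <= r)%R] by rewrite AE.
rewrite nuE //; apply: (@le_trans _ _
  (\int[lebesgue_measure]_(x in [set x | (`|x - s| <= r)%R]) (b%:E)%E)%E).
  rewrite integral_cst //= AE lebesgue_measure_itv /= lte_fin ifT; last by lra.
  by rewrite -EFinD -EFinM lee_fin ler_wpM2l //; lra.
apply: ge0_le_integral => //.
by apply/measurable_EFinP; exact: measurable_funTS.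
Qed.

Lemma prode_ge_expn (I : eqType) (s : seq I) (v : R) (f : I -> \bar R) : 0 <= v ->
  (forall i, i \in s -> (v%:E <= f i)%E) ->
  ((v ^+ size s)%:E <= \prod_(i <- s) f i)%E.
Proof.
move=> v0; elim: s => [_|i s ih hs]; first by rewrite big_nil expr0.
rewrite big_cons /= exprS EFinM; apply: lee_pmul.
- by rewrite lee_fin.
- by rewrite lee_fin exprn_ge0.
- by apply: hs; rewrite mem_head.
- by apply: ih => j js; apply: hs; rewrite inE js orbT.
Qed.

Section cube.
Variables (n N : nat) (a : R).
Hypotheses (a0 : 0 < a) (N0 : (0 < N)%N).
Let r := a / N%:R.
Let r0 : 0 < r. Proof. by rewrite divr_gt0 // ltr0n. Qed.

Notation cubes := {ffun 'I_n -> 'I_N}.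

Definition bump (k : cubes) (x : X) : R :=
  \big[Num.min/1]_(i < n) tent r (center a N (k i)) (xi lambda phi i x).

(** The constraint on coordinate [i], as a set indexed by all of [nat] and void
    from [n] on, which is the form in which independence is stated. *)
Definition slab (k : cubes) (i : nat) : set R :=
  [set s | forall j : 'I_n, val j = i -> (`|s - center a N (k j)| <= r / 2)%R].

Definition half_cube (k : cubes) : set (borel X) :=
  \bigcap_(i in [set` [fset val i | i : 'I_n]%fset])
     (xi lambda phi i @^-1` slab k i).

Lemma bump01 k x : 0 <= bump k x <= 1.
Proof.
rewrite /bump; apply/andP; split.
  by apply/bigmin_geP; split => // i _; have /andP[] := tent01 (center a N (k i)) (xi lambda phi i x) r0.
exact: bigmin_le_id.
Qed.

Lemma bump_disjoint k k' x : bump k x != 0 -> bump k' x != 0 -> k = k'.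
Proof.
have t0 (c s : R) : 0 <= tent r c s by have /andP[] := tent01 c s r0.
move=> /(bigmin_neq0 (fun i => t0 _ _)) hk /(bigmin_neq0 (fun i => t0 _ _)) hk'.
apply/ffunP => i; apply/val_inj => /=.
by apply: (center_inj a0 N0 (tent_neq0 r0 (hk i)) (tent_neq0 r0 (hk' i))).
Qed.

(** The smallest of the [n] eigenvalues governs the slope. *)
Lemma bump_lip k x x' :
  `|bump k x - bump k x'| <= (r * Num.sqrt (lambda n.-1))^-1 * `|x - x'|.
Proof.
apply: bigmin_lip => [|i].
  by rewrite mulr_ge0 // invr_ge0 mulr_ge0 // ltW.
apply: le_trans (tent_lip _ _ _ r0) _.
rewrite [(r * _)^-1]invfM -[leRHS]mulrA mulrC ler_wpM2l ?invr_ge0 ?(ltW r0) //.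
apply: le_trans (xi_lip _ _ _) _.
rewrite mulrC ler_wpM2r // lef_pV2 ?posrE ?sqrtr_gt0 // ler_wsqrtr //.
by apply: lambda_noninc; rewrite -ltnS prednK // (leq_ltn_trans _ (ltn_ord i)).
Qed.

Lemma bump_ge_half k x : half_cube k x -> 2^-1 <= bump k x.
Proof.
move=> kx; apply/bigmin_geP; split => [|i _]; first by rewrite invf_le1 // ler1n.
apply: tent_ge_half => //; apply: (kx (val i)) => //=.
by apply/imfsetP; exists i.
Qed.

Let measurable_slab k i : measurable (slab k i).
Proof.
have [ni|ni] := leqP n i.
  rewrite (_ : slab k i = setT) //; apply/seteqP; split => // s _ j ji.
  by move: (ltn_ord j); rewrite -[X in (X < _)%N]/(val j) ji ltnNge ni.
rewrite (_ : slab k i = [set s | (`|s - center a N (k (Ordinal ni))| <= r / 2)%R]).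
  rewrite (_ : mkset _ = `[center a N (k (Ordinal ni)) - r / 2,
     center a N (k (Ordinal ni)) + r / 2]%classic) //.
  by apply/seteqP; split => x /=; rewrite in_itv /= ler_norml => /andP[h1 h2];
    apply/andP; split; lra.
apply/seteqP; split => s /=; first exact.
by move=> h j ji; rewrite (_ : j = Ordinal ni) //; exact: val_inj.
Qed.

Lemma measurable_half_cube k : measurable (half_cube k).
Proof.
apply: fin_bigcap_measurable; first exact: finite_fset.
move=> i _; have := measurable_xi i measurableT (measurable_slab k i).
by rewrite setTI.
Qed.

(** Independence turns the mass of a cube into a product of one-dimensional
    masses, each at least [b] times its length. *)
Lemma half_cube_mass k b :
  independent_family mu (xi lambda phi) -> 0 < b ->
  densities_bounded_below mu lambda phi a b ->
  (((b * r) ^+ n)%:E <= mu (half_cube k))%E.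
Proof.
move=> ind b0 [nu [nuD nub]].
rewrite /half_cube ind; last exact: measurable_slab.
set J := [fset val i | i : 'I_n]%fset.
have sJ : size J = n.
  by rewrite -[LHS]/(#|` J|) card_imfset; [rewrite -cardE card_ord|exact: val_inj].
rewrite -[X in _ ^+ X]sJ; apply: prode_ge_expn.
  by rewrite mulr_ge0 // ltW.
move=> i /imfsetP[j _ ->] /=.
rewrite (_ : slab k (val j) = [set s | (`|s - center a N (k j)| <= r / 2)%R]); last first.
  apply/seteqP; split => s /=; first by apply.
  by move=> h j' jj'; rewrite (_ : j' = j) //; exact: val_inj.
have r20 : 0 < r / 2 by rewrite divr_gt0.
have := @density_lower_bound _ _ _ (center a N (k j)) _ (nuD (val j)) (ltW b0) r20.
rewrite (_ : 2 * (r / 2) = r); last by field.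
apply => x h.
by apply: nub; exact: (center_in a0 (ltn_ord (k j)) h).
Qed.

End cube.
End cubes.

(** * The lower bound on the minimax risk *)

Section class_membership.
Context {R : realType} {X Y : hilbertType R}.
Variables (D : set nat) (psi : nat -> Y).
Hypothesis onb : orthonormal_basis D psi.

(** Otherwise [D] is empty, and the span of the basis is zero. *)
Lemma initial_segment0 : initial_segment D -> (exists y : Y, y != 0) -> D 0%N.
Proof.
move=> Dini [y y0]; apply: contrapT => nD0.
have D0 i : (i \in D) = false.
  by apply: memNset => Di; apply: nD0; exact: (Dini 0%N i).
have := (proj2 onb) (ball y `|y|).
case.
- by exists y; apply: ballxx; rewrite normr_gt0.
- exact: ball_open.
- move=> z [+ [n [c zE]]]; rewrite -ball_normE /= zE big1 ?subr0 ?ltxx //.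
  by move=> i; rewrite D0.
Qed.

(** Along [psi 0], whose weight is 1, the norm of [Y^t] is that of [Y]. *)
Lemma line_class (w : nat -> R) (t B L : R) (c : X -> R) :
  w 0%N = 1 -> D 0%N -> 0 <= B ->
  (forall x, `|c x| <= B) -> (forall x x', `|c x - c x'| <= L * `|x - x'|) ->
  lipschitz_class w D psi t B L (fun x => c x *: psi 0%N).
Proof.
move=> w0 D0 B0 cB cL; split=> [x|x x']; last first.
  by rewrite -scalerBl normrZ (norm_orthonormal onb D0) mulr1.
rewrite /Yt_norm (esumID [set 0%N]); last first.
  by move=> i _; rewrite lee_fin mulr_ge0 ?powR_ge0 // sqr_ge0.
rewrite (_ : D `&` [set 0%N] = [set 0%N]); last first.
  by apply/seteqP; split => i /= => [[]//|->].
rewrite esum_set1; last by rewrite lee_fin mulr_ge0 ?powR_ge0 // sqr_ge0.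
rewrite esum1 ?adde0.
  rewrite innerZl (proj1 onb) // eqxx mulr1 w0 powR1 mul1r poweR_EFin lee_fin.
  by rewrite powR12_sqrt ?sqr_ge0 // sqrtr_sqr normr_id.
move=> i [Di /= /eqP i0]; rewrite innerZl (proj1 onb) //.
by rewrite eq_sym (negbTE i0) mulr0 normr0 expr0n /= mulr0.
Qed.

End class_membership.

Section minimax_lower_bound.
Context {R : realType} {X Y : hilbertType R}.
Variables (D : set nat) (psi : nat -> Y).
Hypothesis onb : orthonormal_basis D psi.
Hypothesis D0 : D 0%N.
Variables (mu : probability (borel X) R) (lambda : nat -> R) (phi : nat -> X).
Hypothesis eig : covariance_eigenbasis mu lambda phi.
Hypothesis ind : independent_family mu (xi lambda phi).
Variables (a b : R).
Hypotheses (a0 : 0 < a) (b0 : 0 < b).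
Hypothesis dens : densities_bounded_below mu lambda phi a b.
Context {d : measure_display} {Omega : measurableType d}.
Variables (P : probability Omega R) (E : nat -> {RV P >-> process R Y}).
Variables (w : nat -> R) (t p B L sigma : R).
Hypotheses (w0 : w 0%N = 1) (p1 : 1 <= p) (B0 : 0 < B) (L0 : 0 < L).

(** The height of the bumps is the largest that the bound [B] and the slope [L]
    allow. The [N ^ n] half cubes have mass at least [(a b / N) ^ n] each, so [N]
    only enters through the height. *)
Lemma minimax_risk_ge (m n N : nat) (k : design) : (0 < N)%N -> (2 * m <= N ^ n)%N ->
  ((Num.min B (L * (a / N%:R) * Num.sqrt (lambda n.-1) / 2) *
     (a * b) ^+ n / 4)%:E <=
   minimax_risk E sigma m (lipschitz_class (X := X) w D psi t B L) mu p k)%E.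
Proof.
move=> N0 mN.
set s := Num.sqrt (lambda n.-1); set r := a / N%:R.
have lam0 := eigenbasis_gt0 eig.
have lami := eigenbasis_nonincreasing eig.
have phi1 i : `|phi i| = 1.
  by apply: (norm_orthonormal (eigenbasis_orthonormal eig)).
have N0R : 0 < N%:R :> R by rewrite ltr0n.
have s0 : 0 < s by rewrite sqrtr_gt0.
have r0 : 0 < r by rewrite divr_gt0.
have rE : r = a / N%:R by [].
have sE : s = Num.sqrt (lambda n.-1) by [].
clearbody r s.
set h := Num.min B _.
have h0 : 0 < h by rewrite lt_min B0 /= divr_gt0 // !mulr_gt0.
have l0 : 0 < (r * s)^-1 by rewrite invr_gt0 mulr_gt0.
have cK : #|{: {ffun 'I_n -> 'I_N}}| = (N ^ n)%N.
  by rewrite card_ffun !card_ord.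
have y01 := norm_orthonormal onb D0.
have hl : h * (2 * (r * s)^-1) <= L.
  have hle : h <= L * r * s / 2 by rewrite ge_min lexx orbT.
  apply: le_trans (_ : L * r * s / 2 * (2 * (r * s)^-1) <= _).
    by rewrite ler_wpM2r // mulr_ge0 // ltW.
  rewrite le_eqVlt; apply/orP; left; apply/eqP; field.
  by rewrite !gt_eqF.
pose eta := bump lambda phi a (n := n) (N := N).
have eta01 k' x : 0 <= eta k' x <= 1 by exact: bump01.
have etaD k' k2 x : eta k' x != 0 -> eta k2 x != 0 -> k' = k2.
  exact: bump_disjoint.
have etaL k' x x' : `|eta k' x - eta k' x'| <= (r * s)^-1 * `|x - x'|.
  by rewrite rE sE; exact: bump_lip.
have cls eps : lipschitz_class (X := X) w D psi t B L
    (fooling_map eta h (psi 0%N) eps).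
  apply: (line_class onb _ w0 D0 (ltW B0)) => [x|x x'].
    rewrite normrM gtr0_norm //; apply: le_trans (_ : h * 1 <= _).
      by rewrite ler_wpM2l ?(ltW h0) //; exact: signed_bumps_le1.
    by rewrite mulr1 ge_min lexx.
  rewrite -mulrBr normrM gtr0_norm //.
  apply: le_trans (_ : h * (2 * (r * s)^-1 * `|x - x'|) <= _).
    by rewrite ler_wpM2l ?(ltW h0) //; apply: signed_bumps_lip => //; exact: ltW.
  by rewrite mulrA ler_wpM2r.
have -> : h * (a * b) ^+ n / 4 =
    #|{: {ffun 'I_n -> 'I_N}}|%:R * h * (b * r) ^+ n / 4.
  rewrite cK natrX rE; congr (_ / 4); rewrite mulrC mulrAC -exprMn mulrC.
  by rewrite mulrC; congr (_ ^+ _ * _); field; rewrite gt_eqF.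
have cK' : (2 * m <= #|{: {ffun 'I_n -> 'I_N}}|)%N by rewrite cK.
have v0 : 0 <= (b * r) ^+ n by rewrite exprn_ge0 // mulr_ge0 // ltW.
have mQ (k' : {ffun 'I_n -> 'I_N}) : measurable (half_cube lambda phi a k') by exact: measurable_half_cube.
have Qeta (k' : {ffun 'I_n -> 'I_N}) x : half_cube lambda phi a k' x -> 2^-1 <= eta k' x.
  exact: bump_ge_half.
have Qv (k' : {ffun 'I_n -> 'I_N}) : (((b * r) ^+ n)%:E <= mu (half_cube lambda phi a k'))%E.
  by rewrite rE; exact: (half_cube_mass a0 N0 k' ind b0 dens).
case: k => /=.
- exact: (fixed_risk_ge onb p1 E sigma eta01 etaD etaL h0 l0 y01 mQ Qeta v0 Qv cK' cls).
- exact: (random_risk_ge onb p1 E sigma eta01 etaD etaL h0 l0 y01 mQ Qeta v0 Qv cK' cls).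
Qed.

End minimax_lower_bound.

(** * Choosing the cubes *)

Section exponents.
Context {R : realType}.
Implicit Types x y z u : R.

Lemma powR_expR x y : 0 < x -> x `^ y = expR (y * ln x).
Proof. by move=> x0; rewrite /powR gt_eqF. Qed.

Lemma expR_ln x : 0 < x -> expR (ln x) = x.
Proof. by move=> x0; rewrite lnK // posrE. Qed.

Lemma ln_le_sqrt x : 0 < x -> ln x <= 2 * Num.sqrt x.
Proof.
move=> x0; have s0 : 0 < Num.sqrt x by rewrite sqrtr_gt0.
rewrite -{1}(sqr_sqrtr (ltW x0)) lnXn // -[leLHS]mulr_natl ler_wpM2l //.
exact/ltW/ln_sublinear.
Qed.

Lemma log_sample_size_large (sigma A : R) : 0 < sigma ->
  exists m0, forall m, (m0 <= m)%N -> (0 < m)%N /\ A <= ln (m%:R / sigma ^+ 2).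
Proof.
move=> s0; have s20 : 0 < sigma ^+ 2 by rewrite exprn_gt0.
pose z := expR A * sigma ^+ 2.
exists (Num.truncn z).+1 => m hm.
have zm : z <= m%:R.
  by apply: le_trans (ltW (truncnS_gt z)) _; rewrite ler_nat.
have m0 : (0 < m)%N by exact: leq_trans hm.
split => //; rewrite -(expRK A) ler_ln ?posrE ?expR_gt0 ?divr_gt0 ?ltr0n //.
by rewrite ler_pdivlMr.
Qed.

(** In the exponent, [N] costs [2 * u + 1], the eigenvalue at most [u], and the
    mass [`|ln q| * (u + 1)]; the constants are at most [u]. *)
Lemma cube_bound_exp (B L a q tau u : R) (n N : nat) :
  0 < B -> 0 < L -> 0 < a -> 0 < q -> 0 < tau ->
  u < n.+1%:R <= u + 1 -> (0 < N)%N -> N%:R <= expR (2 * u + 1) ->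
  tau ^+ 2 + 1 <= u -> `|ln q| + 1 - ln (L * a / 8) <= u ->
  `|ln q| - ln (B / 4) <= u ->
  expR (- ((`|ln q| + 6) * u)) <=
  Num.min B (L * (a / N%:R) * Num.sqrt (n.+1%:R `^ (- tau)) / 2) * q ^+ n.+1 / 4.
Proof.
move=> B0 L0 a0 q0 tau0 /andP[nu un] N0 Nu u1 u2 u3.
have u0 : 0 <= u by apply: le_trans u1; rewrite addr_ge0 ?sqr_ge0.
have n0 : 0 < n.+1%:R :> R by [].
have qn : expR (- (`|ln q| * (u + 1))) <= q ^+ n.+1.
  rewrite -[q in leRHS](expR_ln q0) -expRM_natl ler_expR.
  have h1 : - `|ln q| <= ln q by rewrite lerNl -normrN ler_norm.
  have h2 := normr_ge0 (ln q).
  apply: le_trans (_ : n.+1%:R * - `|ln q| <= _); last by rewrite ler_wpM2l.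
  nra.
have ns : expR (- u) <= Num.sqrt (n.+1%:R `^ (- tau)).
  rewrite -powR12_sqrt ?powR_ge0 // -powRrM powR_expR // ler_expR.
  have := ln_le_sqrt n0; set v := Num.sqrt _ => hv.
  have v0 : 0 <= v by rewrite sqrtr_ge0.
  have v2 : v ^+ 2 <= u + 1 by rewrite sqr_sqrtr // ler0n.
  have tv : tau * v <= u.
    rewrite -ler_sqr ?nnegrE // ?mulr_ge0 // ?(ltW tau0) // exprMn.
    apply: le_trans (_ : tau ^+ 2 * (u + 1) <= _); first by rewrite ler_wpM2l ?sqr_ge0.
    have := sqr_ge0 tau; nra.
  nra.
have iN : expR (- (2 * u + 1)) <= N%:R^-1.
  by rewrite expRN lef_pV2 ?posrE ?expR_gt0 ?ltr0n.
rewrite -mulrA minr_pMl; last by rewrite divr_ge0 // exprn_ge0 // ltW.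
rewrite le_min; apply/andP; split.
  rewrite (_ : B * _ = B / 4 * q ^+ n.+1); last by field.
  apply: le_trans (_ : B / 4 * expR (- (`|ln q| * (u + 1))) <= _); last first.
    by rewrite ler_wpM2l // divr_ge0 // ltW.
  have B40 : 0 < B / 4 by rewrite divr_gt0.
  rewrite -{1}(expR_ln B40) -expRD ler_expR.
  have := normr_ge0 (ln q); nra.
rewrite (_ : _ * (_ / 4) = L * a / 8 *
   (N%:R^-1 * Num.sqrt (n.+1%:R `^ (- tau)) * q ^+ n.+1)); last first.
  by field; rewrite pnatr_eq0 -lt0n.
apply: le_trans (_ : L * a / 8 * (expR (- (2 * u + 1)) * expR (- u) *
    expR (- (`|ln q| * (u + 1)))) <= _); last first.
  rewrite ler_wpM2l ?divr_ge0 ?mulr_ge0 ?(ltW L0) ?(ltW a0) //.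
  by rewrite !ler_pM ?mulr_ge0 ?expR_ge0.
have La0 : 0 < L * a / 8 by rewrite divr_gt0 // mulr_gt0.
rewrite -{1}(expR_ln La0) -!expRD ler_expR.
have := normr_ge0 (ln q); nra.
Qed.

Lemma expR_half_le : 2 <= expR 1 :> R.
Proof. by have := expR_ge1Dx (1 : R); rewrite -[1 + 1]/(2%:R). Qed.

(** [N ^ n.+1] exceeds [exp (2 u ^ 2)], the square of [m / sigma ^ 2], because
    [u] is the square root of its logarithm. *)
Lemma exists_cubes (B L a q tau sigma : R) :
  0 < B -> 0 < L -> 0 < a -> 0 < q -> 0 < tau -> 0 < sigma ->
  exists m0, forall m, (m0 <= m)%N -> exists n N : nat,
  [/\ (0 < N)%N, (2 * m <= N ^ n.+1)%N &
   expR (- ((`|ln q| + 6) * Num.sqrt (ln (m%:R / sigma ^+ 2)))) <=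
   Num.min B (L * (a / N%:R) * Num.sqrt (n.+1%:R `^ (- tau)) / 2) * q ^+ n.+1 / 4].
Proof.
move=> B0 L0 a0 q0 tau0 s0.
(* [U] gathers the thresholds that [u] has to exceed. *)
pose U := 1 + (tau ^+ 2 + 1) + `| `|ln q| + 1 - ln (L * a / 8) | + `| `|ln q| - ln (B / 4) |
  + `|ln (2 * sigma ^+ 2)|.
have [m0 hm0] := @log_sample_size_large sigma (U ^+ 2) s0.
exists m0 => m /hm0[mpos]; set ell := ln _ => Uell.
have tau2 := sqr_ge0 tau.
have e1 := normr_ge0 (`|ln q| + 1 - ln (L * a / 8)).
have e2 := normr_ge0 (`|ln q| - ln (B / 4)).
have e3 := normr_ge0 (ln (2 * sigma ^+ 2)).
have U1 : 1 <= U by rewrite /U; lra.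
set u := Num.sqrt ell.
have ell0 : 0 <= ell by apply: le_trans Uell; rewrite sqr_ge0.
have Uu : U <= u.
  by rewrite -ler_sqr ?nnegrE ?sqrtr_ge0 ?(le_trans _ U1) // sqr_sqrtr.
have u1 : 1 <= u by exact: le_trans U1 Uu.
have u0 : 0 <= u by exact: le_trans u1.
exists (Num.truncn u), (Num.truncn (expR (2 * u))).+1.
have hN := truncnS_gt (expR (2 * u)).
have s20 : 0 < sigma ^+ 2 by rewrite exprn_gt0.
split => //.
- rewrite -(@ler_nat R) natrX natrM.
  apply: le_trans (_ : expR (2 * u) ^+ (Num.truncn u).+1 <= _); last first.
    by rewrite lerXn2r ?nnegrE ?expR_ge0 // ltW.
  rewrite -expRM_natl.
  have : 2 * ell <= (Num.truncn u).+1%:R * (2 * u).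
    have := truncnS_gt u; have : u ^+ 2 = ell by rewrite sqr_sqrtr.
    nra.
  rewrite -ler_expR; apply: le_trans.
  have mE : m%:R = expR ell * sigma ^+ 2.
    by rewrite expR_ln ?divr_gt0 ?ltr0n // mulfVK // gt_eqF.
  have s220 : 0 < 2 * sigma ^+ 2 by rewrite mulr_gt0.
  rewrite mE mulrCA mulrC -{1}(expR_ln s220) -expRD ler_expR.
  have : ln (2 * sigma ^+ 2) <= U.
    have := ler_norm (ln (2 * sigma ^+ 2)); rewrite /U; lra.
  by nra.
- apply: cube_bound_exp => //.
  + by rewrite truncnS_gt -natr1 lerD2r truncn_le u0.
  + rewrite -natr1; apply: le_trans (_ : expR (2 * u) + 1 <= _).
      by rewrite lerD2r truncn_le expR_ge0.
    rewrite expRD; have := expR_half_le; have := expR_ge1Dx (2 * u); nra.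
  + by rewrite /U in Uu; lra.
  + have := ler_norm (`|ln q| + 1 - ln (L * a / 8)); rewrite /U in Uu; lra.
  + have := ler_norm (`|ln q| - ln (B / 4)); rewrite /U in Uu; lra.
Qed.

End exponents.

Section log_risk.
Context {R : realType} {X Y : hilbertType R} {d : measure_display}
  {Omega : measurableType d}.
Variables (P : probability Omega R) (E : nat -> {RV P >-> process R Y}).
Variables (sigma : R) (m : nat) (cF : set (X -> Y)).
Variables (mu : probability (borel X) R) (p : R) (k : design).

Lemma log_minimax_risk_le (e : R) :
  ((expR (- e))%:E <= minimax_risk E sigma m cF mu p k)%E ->
  (log_minimax_risk E sigma m cF mu p k <= e%:E)%E.
Proof.
move=> h; rewrite /log_minimax_risk leeNl.
have r0 : (0 <= minimax_risk E sigma m cF mu p k)%E.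
  by apply: le_trans h; rewrite lee_fin expR_ge0.
rewrite -EFinN -[X in (X%:E <= _)%E](expRK (- e)) -lne_EFin ?expR_gt0 //.
by rewrite lee_lne // in_itv /= leey ?lee_fin ?expR_ge0 ?r0.
Qed.

Lemma log_minimax_risk_ge (e : R) :
  (minimax_risk E sigma m cF mu p k <= (expR (- e))%:E)%E ->
  (e%:E <= log_minimax_risk E sigma m cF mu p k)%E.
Proof.
move=> h; rewrite /log_minimax_risk leeNr -EFinN.
have [r0|/ltW r0] := leP (minimax_risk E sigma m cF mu p k) 0%E.
  by rewrite le0_lneNy // leNye.
rewrite -[X in (_ <= X%:E)%E](expRK (- e)) -lne_EFin ?expR_gt0 //.
by rewrite lee_lne // in_itv /= leey ?lee_fin ?expR_ge0 ?r0.
Qed.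

End log_risk.

Section log_upper.
Context {R : realType} {X Y : hilbertType R}.
Variables (D : set nat) (psi : nat -> Y).
Hypothesis onb : orthonormal_basis D psi.
Hypothesis D0 : D 0%N.
Variables (mu : probability (borel X) R) (lambda : nat -> R) (phi : nat -> X).
Hypothesis eig : covariance_eigenbasis mu lambda phi.
Hypothesis ind : independent_family mu (xi lambda phi).
Variables (a b tau : R).
Hypotheses (a0 : 0 < a) (b0 : 0 < b) (tau0 : 0 < tau).
Hypothesis dens : densities_bounded_below mu lambda phi a b.
Hypothesis lambdaE : forall i, lambda i = i.+1%:R `^ (- tau).
Context {d : measure_display} {Omega : measurableType d}.
Variables (P : probability Omega R) (E : nat -> {RV P >-> process R Y}).
Variables (w : nat -> R) (t p B L sigma : R).
Hypotheses (w0 : w 0%N = 1) (p1 : 1 <= p) (B0 : 0 < B) (L0 : 0 < L).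
Hypothesis sigma0 : 0 < sigma.

Lemma log_minimax_risk_upper (k : design) :
  exists m0, forall m, (m0 <= m)%N ->
  (log_minimax_risk E sigma m (lipschitz_class (X := X) w D psi t B L) mu p k <=
   ((`|ln (a * b)| + 6) * Num.sqrt (ln (m%:R / sigma ^+ 2)))%:E)%E.
Proof.
have [m0 hm0] := exists_cubes B0 L0 a0 (mulr_gt0 a0 b0) tau0 sigma0.
exists m0 => m /hm0[n [N [N0 mN h]]].
apply: log_minimax_risk_le.
have := minimax_risk_ge onb D0 eig ind a0 b0 dens E t sigma w0 p1 B0 L0 k N0 mN.
by apply: le_trans; rewrite lee_fin [lambda _]lambdaE.
Qed.

End log_upper.

(** * Averages of white noise *)

Section uncorrelated.
Context d (T : measurableType d) (R : realType).
Variable P : probability T R.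
Variables U V : {RV P >-> R}.
Hypothesis indUV : forall A B, measurable A -> measurable B ->
  P (U @^-1` A `&` V @^-1` B) = (P (U @^-1` A) * P (V @^-1` B))%E.
Hypotheses (U2 : (U : T -> R) \in Lfun P 2%:E) (V2 : (V : T -> R) \in Lfun P 2%:E).
Hypothesis EU0 : ('E_P[U] = 0)%E.

Let UV (w : T) : R * R := (U w, V w).

Let measurable_UV : measurable_fun [set: T] UV.
Proof. exact: measurable_fun_pair. Qed.

HB.instance Definition _ := isMeasurableFun.Build _ _ _ _ UV measurable_UV.

Let joint_law (A : set (R * R)) : measurable A ->
  (distribution P U \x distribution P V)%E A = distribution P UV A.
Proof.
by move=> mA; apply: product_measure_unique.
Qed.

Let f (z : R * R) : \bar R := (z.1 * z.2)%:E.

Let mf : measurable_fun setT f.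
Proof.
apply/measurable_EFinP; apply: measurable_funM; [exact: measurable_fst|exact: measurable_snd].
Qed.

Let integrable_f : (distribution P U \x distribution P V)%E.-integrable setT f.
Proof.
apply/integrableP; split => //.
rewrite (@eq_measure_integral _ _ _ _ (distribution P UV)); last first.
  by move=> A mA _; exact: joint_law.
rewrite ge0_integral_distribution //; last exact: measurableT_comp.
by have /Lfun1_integrable/integrableP[] := Lfun2_mul_Lfun1 U2 V2.
Qed.

(** Fubini on the joint law, which independence makes a product. *)
Lemma expectation_indep_mul0 : ('E_P[(U \* V)%R] = 0)%E.
Proof.
have -> : ('E_P[(U \* V)%R] = \int[distribution P UV]_z f z)%E.
  rewrite unlock integral_distribution //.
  exact/Lfun1_integrable/Lfun2_mul_Lfun1.
rewrite (@eq_measure_integral _ _ _ _ (distribution P U \x distribution P V)%E); last first.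
  by move=> A mA _; apply/esym; exact: joint_law.
rewrite -integral21_prod_meas1 //.
apply: integral0_eq => y _; rewrite /fubini_G /f.
have U1 : (U : T -> R) \in Lfun P 1 by apply: Lfun_subset12 => //; exact: fin_num_measure.
have yU1 : (y \o* (U : T -> R)) \in Lfun P 1 by exact: Lfun_scale.
rewrite integral_distribution.
- by have := expectationZl y U1; rewrite EU0 mule0 unlock.
- apply/measurable_EFinP.
  by apply: measurable_funM => /=.
- by move/Lfun1_integrable : yU1.
Qed.

End uncorrelated.

Section orthonormal_family.
Context d (T : measurableType d) (R : realType).
Variable P : probability T R.
Variables (I : finType) (U : I -> T -> R).
Hypothesis U2 : forall i, U i \in Lfun P 2%:E.
Hypothesis EUU : forall i j, ('E_P[(U i \* U j)%R] = (i == j)%:R%:E)%E.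

Lemma expectation_sqr_sum (A : {set I}) :
  ('E_P[(fun w => (\sum_(i in A) U i w) ^+ 2)%R] = #|A|%:R%:E)%E.
Proof.
pose X := [seq (U i \* U j)%R | i <- enum A, j <- enum A].
have -> : (fun w => (\sum_(i in A) U i w) ^+ 2) = \sum_(x <- X) x.
  apply/funext => w; rewrite fct_sumE /X big_allpairs_dep /= expr2 mulr_suml.
  rewrite big_enum /=; apply: eq_bigr => i _.
  by rewrite mulr_sumr big_enum.
rewrite expectation_sum; last first.
  by move=> x /allpairsP[[i j] [_ _ ->]]; exact: Lfun2_mul_Lfun1.
rewrite /X big_allpairs_dep /= big_enum /= -sum1_card natr_sum -sumEFin.
apply: eq_bigr => i iA; rewrite big_enum /= (bigD1 i) //= EUU eqxx big1 ?adde0 //.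
by move=> j /andP[_ ji]; rewrite EUU eq_sym (negbTE ji).
Qed.

(** Integrate [2 |s| <= q + s ^ 2 / q]. *)
Lemma integral_abs_sum_le (A : {set I}) (q : R) : 0 < q -> #|A|%:R <= q ^+ 2 ->
  (\int[P]_w `|\sum_(i in A) U i w|%:E <= q%:E)%E.
Proof.
move=> q0 Aq.
have mU i : measurable_fun setT (U i).
  by have := U2 i; rewrite inE => /andP[]; rewrite inE.
have mS : measurable_fun setT (fun w => (\sum_(i in A) U i w) ^+ 2).
  apply: measurable_funX; under eq_fun do rewrite -big_enum.
  exact: measurable_sum.
apply: (@le_trans _ _ (\int[P]_w ((q / 2)%:E +
    (2 * q)^-1%:E * ((\sum_(i in A) U i w) ^+ 2)%:E))%E).
  apply: integral_mono => w; first by rewrite lee_fin.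
  rewrite -EFinM -EFinD lee_fin; set s := \sum_(_ in _) _.
  rewrite -[s ^+ 2]real_normK ?num_real //.
  rewrite (_ : _ + _ = `|s| + (q - `|s|) ^+ 2 / (2 * q)); last first.
    by field; rewrite gt_eqF.
  by rewrite lerDl divr_ge0 ?sqr_ge0 // mulr_ge0 // ltW.
have c0 : 0 <= (2 * q)^-1 by rewrite invr_ge0 mulr_ge0 // ltW.
have q20 : 0 <= q / 2 by rewrite divr_ge0 // ltW.
have mS' : measurable_fun setT (fun w => ((\sum_(i in A) U i w) ^+ 2)%:E).
  exact/measurable_EFinP.
have S0 w : (0 <= ((\sum_(i in A) U i w) ^+ 2)%:E)%E by rewrite lee_fin sqr_ge0.
rewrite ge0_integralD //; last 2 first.
- by move=> w _; apply: mule_ge0.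
- by apply: measurable_funeM.
rewrite integral_cst //= probability_setT mule1.
rewrite ge0_integralZl_EFin //.
have := expectation_sqr_sum A; rewrite unlock => ->.
rewrite -EFinM -EFinD lee_fin invfM.
apply: le_trans (_ : q / 2 + 2^-1 * q^-1 * q ^+ 2 <= _).
  by rewrite lerD2l ler_wpM2l // mulr_ge0 // invr_ge0 // ltW.
by rewrite le_eqVlt; apply/orP; left; apply/eqP; field; rewrite gt_eqF.
Qed.

End orthonormal_family.

Section noise.
Context {R : realType} {Y : hilbertType R} {d : measure_display}
  {Omega : measurableType d}.
Variables (P : probability Omega R) (E : nat -> {RV P >-> process R Y}).
Hypothesis noiseE : iid_white_noise E.
Variable y : Y.
Hypothesis y1 : `|y| = 1.

Definition coord (i : nat) (omega : Omega) : R := E i omega y.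

Let measurable_coord i : measurable_fun [set: Omega] (coord i).
Proof.
by have := measurableT_comp (measurable_process_eval y) (@measurable_funPT _ _ _ _ (E i)).
Qed.

HB.instance Definition _ i :=
  isMeasurableFun.Build _ _ _ _ (coord i) (measurable_coord i).

Let coord_sqr i : ('E_P[(coord i \* coord i)%R] = 1)%E.
Proof.
by have := white_noise_covariance (proj1 noiseE i) y y; rewrite inner_norm y1 expr1n.
Qed.

Lemma coord_L2 i : coord i \in Lfun P 2%:E.
Proof.
rewrite inE; apply/andP; split; rewrite inE //=.
rewrite /finite_norm unlock; apply: poweR_lty.
rewrite (_ : (\int[P]_x _)%E = 1%:E) ?ltry //.
rewrite -(coord_sqr i) unlock; apply: eq_integral => w _ /=.
by rewrite powR_mulrn // real_normK ?num_real // expr2.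
Qed.

Let coord_indep i j (A B : set R) : i != j -> measurable A -> measurable B ->
  (P (coord i @^-1` A `&` coord j @^-1` B) =
   P (coord i @^-1` A) * P (coord j @^-1` B))%E.
Proof.
move=> ij mA mB.
pose C k : set (process R Y) :=
  if k == i then [set z | A (z y)] else [set z | B (z y)].
have mC k : measurable (C k).
  by rewrite /C; case: ifP => _; apply: sub_sigma_algebra;
    [exists y, A | exists y, B].
have := (proj2 noiseE) [fset i; j]%fset C mC.
rewrite big_fsetU1 ?inE //= big_seq_fset1 {2 3}/C eqxx eq_sym (negbTE ij).
have -> : \bigcap_(k in [set` [fset i; j]%fset]) (E k @^-1` C k) =
    coord i @^-1` A `&` coord j @^-1` B.
  apply/seteqP; split => w /=.
    move=> h; split.
      by have := h i; rewrite /C /= eqxx; apply; rewrite !inE eqxx.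
    by have := h j; rewrite /C /= eq_sym (negbTE ij); apply; rewrite !inE eqxx orbT.
  move=> [hA hB] k /=; rewrite !inE /C => /orP[] /eqP ->; first by rewrite eqxx.
  by rewrite eq_sym (negbTE ij).
exact.
Qed.

Lemma coord_orthonormal i j : ('E_P[(coord i \* coord j)%R] = (i == j)%:R%:E)%E.
Proof.
have [<-|ij] := eqVneq i j; first exact: coord_sqr.
apply: expectation_indep_mul0; [|exact: coord_L2|exact: coord_L2|].
  by move=> A B mA mB; exact: coord_indep.
exact: white_noise_centered (proj1 noiseE i) y.
Qed.

Lemma noise_sum_le m (A : {set 'I_m}) (q : R) : 0 < q -> m%:R <= q ^+ 2 ->
  (\int[P]_w `|\sum_(i in A) coord i w|%:E <= q%:E)%E.
Proof.
move=> q0 mq.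
apply: (@integral_abs_sum_le _ _ _ P _ (fun (i : 'I_m) => coord i)) => //.
- by move=> i; exact: coord_L2.
- by move=> i j; exact: coord_orthonormal.
by apply: le_trans mq; rewrite ler_nat -[leqRHS]card_ord max_card.
Qed.

End noise.

(** * Designs on finitely many points *)

Section counts.
Context {R : realType} {d} {T : measurableType d}.
Variables (g : T -> bool).
Hypothesis mg : measurable [set x | g x].

Definition count (m : nat) (x : m.-tuple T) : R := \sum_(i < m) (g (tnth x i))%:R.

Lemma indic_test x : \1_[set x | g x] x = (g x)%:R :> R.
Proof.
by rewrite indicE; case gx: (g x); [rewrite mem_set|rewrite memNset //= gx].
Qed.

Lemma measurable_test : measurable_fun setT (fun x => (g x)%:R : R).
Proof.
rewrite (_ : (fun x => _) = \1_[set x | g x]) //.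
by apply/funext => x; rewrite indic_test.
Qed.

Lemma measurable_count m : measurable_fun setT (@count m).
Proof.
apply: measurable_sum => i; exact: measurableT_comp measurable_test (measurable_tnth i).
Qed.

Lemma count_ge0 m (x : m.-tuple T) : 0 <= count x.
Proof. by apply: sumr_ge0. Qed.

Lemma count_cons m (z : T * m.-tuple T) :
  count (cons_pair z) = (g z.1)%:R + count z.2.
Proof.
rewrite /count big_ord_recl /= ; congr (_ + _).
by apply: eq_bigr => i _; rewrite /cons_pair; congr ((g _)%:R); rewrite tnthS.
Qed.

Variables (nu : probability T R) (q : R).
Hypothesis nug : nu [set x | g x] = q%:E.

Let int_test : (\int[nu]_x (g x)%:R%:E = q%:E)%E.
Proof.
rewrite -nug -[in RHS](setIT [set x | g x]) -integral_indic //.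
by apply: eq_integral => x _; rewrite indic_test.
Qed.

(** The recursion behind the moments of counts: one draw is split off. *)
Lemma integral_iid_lawS m (f : m.+1.-tuple T -> \bar R) :
  measurable_fun setT f -> (forall x, 0 <= f x)%E ->
  (\int[iid_law nu m.+1]_x f x =
   \int[nu]_t \int[iid_law nu m]_x f (cons_pair (t, x)))%E.
Proof.
move=> mf f0; rewrite ge0_integral_distribution //.
rewrite fubini_tonelli1 //=; exact: measurableT_comp.
Qed.

Lemma count_mean m : (\int[iid_law nu m]_x (count x)%:E = (m%:R * q)%:E)%E.
Proof.
elim: m => [|m ih].
  by rewrite mul0r; apply: integral0_eq => x _; rewrite /count big_ord0.
rewrite integral_iid_lawS; last 2 first.
- by apply/measurable_EFinP; exact: measurable_count.
- by move=> x; rewrite lee_fin count_ge0.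
rewrite (eq_integral (fun t => ((g t)%:R%:E + (m%:R * q)%:E)%E)); last first.
  move=> t _; rewrite (eq_integral (fun x => ((g t)%:R%:E + (count x)%:E)%E)).
    rewrite ge0_integralD //; last 2 first.
    - by move=> x _; rewrite lee_fin count_ge0.
    - by apply/measurable_EFinP; exact: measurable_count.
    by rewrite integral_cst //= probability_setT mule1 ih.
  by move=> x _; rewrite count_cons.
rewrite ge0_integralD //; last 2 first.
- by apply/measurable_EFinP; exact: measurable_test.
- by move=> x _; rewrite -ih integral_ge0 // => y _; rewrite lee_fin count_ge0.
rewrite int_test integral_cst //= probability_setT mule1.
by rewrite -EFinD -natr1 mulrDl mul1r addrC.
Qed.

Let q01 : 0 <= q.
Proof. by rewrite -lee_fin -nug. Qed.

Lemma count_sqr_mean m :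
  (\int[iid_law nu m]_x (count x ^+ 2)%:E =
   (m%:R * q + m%:R * (m%:R - 1) * q ^+ 2)%:E)%E.
Proof.
have mc n : measurable_fun setT (fun x : n.-tuple T => (count x)%:E).
  by apply/measurable_EFinP; exact: measurable_count.
have mc2 n : measurable_fun setT (fun x : n.-tuple T => (count x ^+ 2)%:E).
  by apply/measurable_EFinP; apply: measurable_funX; exact: measurable_count.
elim: m => [|m ih].
  rewrite !mul0r addr0; apply: integral0_eq => x _.
  by rewrite /count big_ord0 expr0n.
have mcm := mc m; have mc2m := mc2 m.
rewrite integral_iid_lawS //; last by move=> x; rewrite lee_fin sqr_ge0.
pose c := 1 + 2 * (m%:R * q).
have c0 : 0 <= c by rewrite addr_ge0 // !mulr_ge0.
pose e := m%:R * q + m%:R * (m%:R - 1) * q ^+ 2.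
have e0 : (0 <= e%:E)%E.
  by rewrite /e -ih integral_ge0 // => x _; rewrite lee_fin sqr_ge0.
rewrite (eq_integral (fun t => (c%:E * (g t)%:R%:E + e%:E)%E)); last first.
  move=> t _; rewrite (eq_integral (fun x => ((g t)%:R%:E +
     ((2 * (g t)%:R)%:E * (count x)%:E + (count x ^+ 2)%:E))%E)).
    have h0 x : (0 <= (2 * (g t)%:R)%:E * (count x : R)%:E)%E.
      by move=> *; rewrite -EFinM lee_fin !mulr_ge0 // count_ge0.
    have h2 n (x : n.-tuple T) : (0 <= (count x ^+ 2)%:E)%E by rewrite lee_fin sqr_ge0.
    have m1 : measurable_fun setT
        (fun x : m.-tuple T => ((2 * (g t)%:R)%:E * (count x)%:E)%E).
      exact: measurable_funeM.
    rewrite ge0_integralD //; last 2 first.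
    - by move=> x _; apply: adde_ge0.
    - exact: emeasurable_funD.
    rewrite ge0_integralD //.
    rewrite ge0_integralZl_EFin //; last by move=> x _; rewrite lee_fin count_ge0.
    rewrite integral_cst //= probability_setT mule1 ih count_mean.
    by rewrite -!EFinM -!EFinD /c /e; congr (_%:E); ring.
  move=> x _; rewrite count_cons -EFinM -!EFinD; congr (_%:E) => /=.
  by case: (g t) => /=; ring.
have mt : measurable_fun setT (fun t => ((g t)%:R : R)%:E).
  by apply/measurable_EFinP; exact: measurable_test.
rewrite ge0_integralD //; last 2 first.
- by move=> x _; rewrite -EFinM lee_fin mulr_ge0.
- exact: measurable_funeM.
rewrite ge0_integralZl_EFin // int_test integral_cst //= probability_setT mule1.
rewrite -EFinM -EFinD; congr (_%:E); rewrite /c /e -natr1; ring.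
Qed.

(** The normalized count has mean 1 and variance at most [al]; integrate
    [2 |u| <= eta + u ^ 2 / eta]. *)
Lemma count_deviation m (al eta : R) : 0 < eta -> al * (m%:R * q) = 1 ->
  (\int[iid_law nu m]_x `|1 - al * count x|%:E <=
   (eta / 2 + al / (2 * eta))%:E)%E.
Proof.
move=> eta0 almq.
have mcm := @measurable_count m.
have al0 : 0 <= al.
  rewrite leNgt; apply/negP => al0; have : al * (m%:R * q) <= 0.
    by rewrite nmulr_rle0 // mulr_ge0.
  by rewrite almq ler10.
pose u (x : m.-tuple T) : R := 1 - al * count x.
have mu2 : measurable_fun setT (fun x => (u x ^+ 2)%:E).
  apply/measurable_EFinP; apply: measurable_funX; apply: measurable_funB => //.
  exact: measurable_funM.
have u20 x : (0 <= (u x ^+ 2)%:E)%E by rewrite lee_fin sqr_ge0.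
have c0 (x : m.-tuple T) : (0 <= (count x)%:E)%E by rewrite lee_fin count_ge0.
have mcE : measurable_fun setT (fun x : m.-tuple T => (count x)%:E).
  exact/measurable_EFinP.
have c20 (x : m.-tuple T) : (0 <= (count x ^+ 2)%:E)%E by rewrite lee_fin sqr_ge0.
have mc2E : measurable_fun setT (fun x : m.-tuple T => (count x ^+ 2)%:E).
  by apply/measurable_EFinP; exact: measurable_funX.
have al20 : 0 <= 2 * al by rewrite mulr_ge0.
have V : (\int[iid_law nu m]_x (u x ^+ 2)%:E = (al - al * q)%:E)%E.
  have E1 : (\int[iid_law nu m]_x ((u x ^+ 2)%:E + (2 * al)%:E * (count x)%:E) =
      \int[iid_law nu m]_x (1%:E + (al ^+ 2)%:E * (count x ^+ 2)%:E))%E.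
    apply: eq_integral => x _; rewrite -!EFinM -!EFinD; congr (_%:E).
    by rewrite /u; ring.
  have mE1 : measurable_fun setT (fun x : m.-tuple T => ((2 * al)%:E * (count x)%:E)%E).
    exact: measurable_funeM.
  have mE2 : measurable_fun setT (fun x : m.-tuple T => ((al ^+ 2)%:E * (count x ^+ 2)%:E)%E).
    exact: measurable_funeM.
  have p1 (x : m.-tuple T) : (0 <= (2 * al)%:E * (count x)%:E)%E by exact: mule_ge0.
  have p2 (x : m.-tuple T) : (0 <= (al ^+ 2)%:E * (count x ^+ 2)%:E)%E.
    by apply: mule_ge0 => //; rewrite lee_fin sqr_ge0.
  move: E1; rewrite ge0_integralD // [in RHS]ge0_integralD //.
  rewrite !ge0_integralZl_EFin // ?sqr_ge0 // integral_cst //= probability_setT mule1.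
  rewrite count_mean count_sqr_mean -!EFinM -EFinD => E1.
  have fI : (\int[iid_law nu m]_x (u x ^+ 2)%:E)%E \is a fin_num.
    by move: E1; case: (\int[_]_x _)%E.
  move: E1; rewrite -(fineK fI) -EFinD => -[E1]; congr (_%:E).
  have : al ^+ 2 * (m%:R * (m%:R - 1) * q ^+ 2) = 1 - al * q.
    have -> : al ^+ 2 * (m%:R * (m%:R - 1) * q ^+ 2) =
      (al * (m%:R * q)) ^+ 2 - (al * (m%:R * q)) * (al * q) by ring.
    by rewrite almq; ring.
  have : al ^+ 2 * (m%:R * q) = al by rewrite expr2 -mulrA almq mulr1.
  have : 2 * al * (m%:R * q) = 2 by rewrite -mulrA almq mulr1.
  move: E1; rewrite mulrDr; lra.
apply: (@le_trans _ _ (\int[iid_law nu m]_x ((eta / 2)%:E +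
    (2 * eta)^-1%:E * (u x ^+ 2)%:E))%E).
  apply: integral_mono => x; first by rewrite lee_fin.
  rewrite -EFinM -EFinD lee_fin -/(u x) -[u x ^+ 2]real_normK ?num_real //.
  rewrite (_ : _ + _ = `|u x| + (eta - `|u x|) ^+ 2 / (2 * eta)); last first.
    by field; rewrite gt_eqF.
  by rewrite lerDl divr_ge0 ?sqr_ge0 // mulr_ge0 // ltW.
have e0 : 0 <= eta / 2 by rewrite divr_ge0 // ltW.
have ie0 : 0 <= (2 * eta)^-1 by rewrite invr_ge0 mulr_ge0 // ltW.
rewrite ge0_integralD //; last 2 first.
- by move=> x _; apply: mule_ge0.
- exact: measurable_funeM.
rewrite integral_cst //= probability_setT mule1 ge0_integralZl_EFin // V.
rewrite -EFinM -EFinD lee_fin lerD2l [leRHS]mulrC ler_wpM2l //.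
by rewrite gerBl mulr_ge0.
Qed.

End counts.

Section designs.
Context {R : realType} {X : hilbertType R} {K : finType}.
Variable z : K -> X.
Hypothesis z_inj : injective z.
Hypothesis K0 : (0 < #|K|)%N.

Lemma measurable_point (x : X) : measurable [set y : borel X | (y : X) == x].
Proof.
rewrite (_ : mkset _ = [set x]); last by apply/seteqP; split => y /= /eqP.
rewrite -[X in measurable X]setCK; apply: measurableC; apply: open_borel.
apply: closed_openC; exact: (accessible_closed_set1 (hausdorff_accessible (@norm_hausdorff _ _))).
Qed.

Lemma count_residues (M r m : nat) : (r < M)%N ->
  (\sum_(i < m) (i %% M == r) = (m + (M.-1 - r)) %/ M)%N.
Proof.
move=> rM; have M0 : (0 < M)%N by exact: leq_ltn_trans rM.
elim: m => [|m ih].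
  rewrite big_ord0 add0n divn_small //; lia.
rewrite big_ord_recr /= ih addSn divnS // addnC; congr (_ + _)%N.
have -> : (m + (M.-1 - r)).+1 = (m + (M - r))%N by lia.
congr (nat_of_bool _); rewrite -{1}(modn_small rM).
by rewrite -(eqn_modDr (M - r)) subnKC ?(ltnW rM) // modnn.
Qed.

(** Visiting the points in turn reaches each of them [m / #|K|] times, up to one
    visit. *)
Lemma grid_design_count (m : nat) : (0 < m)%N ->
  exists x : m.-tuple (borel X), forall k,
  `|1 - #|K|%:R / m%:R * count (fun y : borel X => (y : X) == z k) x| <=
    #|K|%:R / m%:R :> R.
Proof.
move=> m0; pose M := #|K|.
have mod_lt i : (i %% M < M)%N by rewrite ltn_pmod.
pose pt (i : nat) : X := z (enum_val (Ordinal (mod_lt i))).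
exists [tuple pt i | i < m] => k.
have -> : count (fun y : borel X => (y : X) == z k) [tuple pt i | i < m] =
    ((m + (M.-1 - enum_rank k)) %/ M)%N%:R :> R.
  rewrite -(count_residues m (ltn_ord (enum_rank k))) natr_sum.
  apply: eq_bigr => i _; rewrite tnth_mktuple /pt; congr ((nat_of_bool _)%:R).
  rewrite (inj_eq z_inj) -(inj_eq enum_rank_inj) enum_valK.
  by [].
set c := (_ %/ M)%N.
have m0R : 0 < m%:R :> R by rewrite ltr0n.
have c1 : (c * M <= m + M)%N.
  apply: leq_trans (leq_trunc_div _ _) _; rewrite leq_add2l.
  by apply: leq_trans (leq_subr _ _) (leq_pred _).
have c2 : (m <= c * M + M)%N.
  have := ltn_ceil (m + (M.-1 - enum_rank k)) K0; rewrite -/M -/c mulSn; lia.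
have c1R : c%:R * M%:R <= m%:R + M%:R :> R by rewrite -natrM -natrD ler_nat.
have c2R : m%:R <= c%:R * M%:R + M%:R :> R by rewrite -natrM -natrD ler_nat.
rewrite (_ : 1 - _ = (m%:R - c%:R * M%:R) / m%:R); last first.
  by rewrite /M; field; rewrite gt_eqF.
rewrite normrM [X in _ * X]gtr0_norm ?invr_gt0 // ler_wpM2r ?invr_ge0 ?ler0n //.
by apply/ler_normlP; split; lra.
Qed.

Lemma uniform_law : exists nu : probability (borel X) R,
  forall k, nu [set y : borel X | (y : X) == z k] = (#|K|%:R^-1)%:E.
Proof.
pose pt (i : nat) : borel X := nth (0 : X) [seq z k | k <- enum K] i.
pose S := msum (fun i => \d_(pt i) : {measure set (borel X) -> \bar R}) #|K|.
pose nu : probability (borel X) R := mnormalize S (\d_(pt 0%N) : probability (borel X) R).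
have ST : S setT = #|K|%:R%:E.
  rewrite /S /msum /=; under eq_bigr do rewrite diracT.
  by rewrite sumEFin sumr_const card_ord.
have cond : ((S setT == 0) || (S setT == +oo))%E = false.
  by rewrite [S setT]ST orbF eqe pnatr_eq0 eqn0Ngt K0.
have nuE A : nu A = (S A * ((fine (S setT))^-1)%:E)%E.
  transitivity (mnormalize S (\d_(pt 0%N) : probability (borel X) R) A); first by [].
  by rewrite /mnormalize cond.
exists nu => k; rewrite nuE ST.
have ptE (i : 'I_#|K|) : pt i = z (enum_val i).
  by rewrite /pt (nth_map k) -?cardE // (enum_val_nth k).
have -> : S [set y : borel X | (y : X) == z k] = 1%E.
  rewrite /S /msum /= (bigD1 (enum_rank k)) //= big1 ?adde0.
    by rewrite ptE enum_rankK diracE mem_set //= eqxx.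
  move=> i ik; rewrite ptE diracE memNset //=.
  by apply/negP; rewrite (inj_eq z_inj); apply: contra ik => /eqP <-; rewrite enum_valK.
by rewrite mul1e.
Qed.

End designs.

(** * The grid estimator *)

Section countable_estimator.
Context {R : realType} {X Y : hilbertType R}.
Variables (mu : probability (borel X) R) (p : R).

(** A map with countably many values is measurable as soon as its fibres are.
    This is why the estimated coefficients are rounded. *)
Lemma countable_estimator d (T : measurableType d) (Q : countType)
    (c : T -> Q) (G : Q -> X -> Y) :
  (forall a, measurable [set t | c t = a]) -> (forall a, Lp mu p (G a)) ->
  estimator mu p T (fun t => G (c t)).
Proof.
move=> mc GL; split=> [t|U _]; first exact: GL.
rewrite (_ : _ @^-1` U = \bigcup_a [set t | c t = a /\ U (G a)]); last first.
  by apply/seteqP; split => t /= => [Ut|[a _ [ctE Ua]]]; [by exists (c t)|by rewrite ctE].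
apply: countable_bigcupT_measurable; first exact: countableP.
move=> a; have [Ua|nU] := pselect (U (G a)).
  by rewrite (_ : mkset _ = [set t | c t = a]) //; apply/seteqP; split => t /= => [[]|].
by rewrite (_ : mkset _ = set0) //; apply/seteqP; split => t /= => [[]|].
Qed.

End countable_estimator.

Section step_maps.
Context {R : realType} {X Y : hilbertType R} {K : finType}.
Variables (mu : probability (borel X) R) (p : R).
Hypothesis p1 : 1 <= p.
Variable C : K -> set (borel X).
Hypothesis mC : forall k, measurable (C k).
Hypothesis C_disjoint : forall k k' x, C k x -> C k' x -> k = k'.

Definition cell (x : X) : option K := [pick k | `[< C k x >]].

Definition step (v : K -> Y) (x : X) : Y := oapp v 0 (cell x).

Lemma cell_some k x : C k x -> cell x = Some k.
Proof.
move=> Ck; rewrite /cell; case: pickP => [k' /asboolP Ck'|/(_ k)/asboolP//].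
by rewrite (C_disjoint Ck Ck').
Qed.

Lemma cellP x k : cell x = Some k -> C k x.
Proof. by rewrite /cell; case: pickP => [k' /asboolP Ck' [<-]|]. Qed.

Let measurable_cell (u : option K) : measurable [set x : borel X | cell x = u].
Proof.
case: u => [k|].
  rewrite (_ : mkset _ = C k) //.
  by apply/seteqP; split => x; [exact: cellP|exact: cell_some].
rewrite (_ : mkset _ = \bigcap_(k in [set: K]) ~` C k).
  apply: fin_bigcap_measurable => [|k _]; first exact: finite_finset.
  exact: measurableC.
apply/seteqP; split => x /= h; first by move=> k _ /cell_some; rewrite h.
by case E: (cell x) => [k|//]; have := h k Logic.I (cellP E).
Qed.

Lemma borel_step (v : K -> Y) : borel_map (step v).
Proof.
move=> _ A mA; rewrite setTI.
rewrite (_ : _ @^-1` A =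
  \bigcup_(u in [set u | A (oapp v 0 u)]) [set x : borel X | cell x = u]).
  by apply: fin_bigcup_measurable => //; exact: finite_finset.
by apply/seteqP; split => x /= => [Ax|[u Au uE]]; [by exists (cell x)|by rewrite /step uE].
Qed.

Lemma step_Lp (v : K -> Y) : Lp mu p (step v).
Proof.
split; first exact: borel_step.
have h0 : 0 <= \sum_k `|v k| by apply: sumr_ge0.
apply: le_lt_trans (@Lp_norm_bound _ _ _ mu p p1 _ (cst (\sum_k `|v k|)) _) _.
  move=> x /=; rewrite /step; case: (cell x) => [k|] /=; last by rewrite normr0.
  by rewrite (bigD1 k) //= lerDl sumr_ge0.
by rewrite (Lnorm_cst _ (lt_le_trans ltr01 p1) h0) ltry.
Qed.

End step_maps.

Section sobolev.
Context {R : realType} {Y : hilbertType R}.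
Variables (D : set nat) (psi : nat -> Y) (w : nat -> R) (t B : R).
Hypothesis onb : orthonormal_basis D psi.
Hypothesis wE : forall i, w i = i.+1%:R.
Hypotheses (t0 : 0 < t) (B0 : 0 < B).

Lemma Yt_partial_sum y n : (Yt_norm w D psi t y <= B%:E)%E ->
  \sum_(0 <= i < n | i \in D) w i `^ (2 * t) * inner y (psi i) ^+ 2 <= B ^+ 2.
Proof.
pose u i := (w i `^ (2 * t) * `|inner y (psi i)| ^+ 2)%:E.
have u0 i : (0 <= u i)%E by rewrite lee_fin mulr_ge0 ?powR_ge0 ?sqr_ge0.
rewrite /Yt_norm; set S := (\esum_(i in D) _)%E => SB.
have S0 : (0 <= S)%E by apply: esum_ge0 => i _; exact: u0.
have {}SB : (S <= (B ^+ 2)%:E)%E.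
  have : ((S `^ 2^-1) `^ 2 <= B%:E `^ 2)%E.
    by apply: ge0_le_poweR => //; exact: poweR_ge0.
  by rewrite -poweRrM mulVf // poweRe1 // poweR_EFin powR_mulrn // ltW.
rewrite -lee_fin; apply: le_trans SB.
rewrite /S esum_mkcond -nneseries_esumT; last by move=> i; case: ifP => _ //; exact: u0.
apply: (@le_trans _ _ (\sum_(0 <= i < n) if i \in D then u i else 0)%E).
  rewrite -big_mkcond /= -sumEFin le_eqVlt; apply/orP; left; apply/eqP.
  by apply: eq_bigr => i _; rewrite /u real_normK ?num_real.
by apply: nneseries_lim_ge => i _ _; case: ifP => _ //; exact: u0.
Qed.

(** The weights increase, so from [J] on a squared coordinate is at most
    [J.+1 `^ (- 2 * t)] times its weighted counterpart. *)
Lemma sobolev_tail y J : (Yt_norm w D psi t y <= B%:E)%E ->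
  `|y - fourier_sum D psi J y| <= B * J.+1%:R `^ (- t).
Proof.
move=> yB; have J0 : 0 < J.+1%:R :> R by [].
rewrite -ler_sqr ?nnegrE ?mulr_ge0 ?(ltW B0) // (sqr_dist_fourier_sum onb).
rewrite exprMn.
have cv := coef_energy_cvg onb (x := y).
suff : `|y| ^+ 2 <= coef_energy D psi J y + B ^+ 2 * J.+1%:R `^ (- t) ^+ 2 by lra.
rewrite -(cvg_lim _ cv) //; apply: limr_le; first exact: cvgP cv.
exists J => // n /= Jn.
rewrite /coef_energy (big_cat_nat (leq0n J) Jn) /= lerD2l.
have e2 : J.+1%:R `^ (- t) ^+ 2 = (J.+1%:R `^ (2 * t))^-1 :> R.
  by rewrite -powR_mulrn // -powRrM -powRN; congr (_ `^ _); ring.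
rewrite e2 ler_pdivlMr ?powR_gt0 // mulrC mulr_sumr.
apply: le_trans (Yt_partial_sum n yB).
rewrite [leRHS](big_cat_nat (leq0n J) Jn) /=.
rewrite -[leLHS]add0r lerD //.
  by apply: sumr_ge0 => i _; rewrite mulr_ge0 ?powR_ge0 ?sqr_ge0.
rewrite big_nat_cond [leRHS]big_nat_cond; apply: ler_sum => i /andP[/andP[Ji _] _].
rewrite ler_wpM2r ?sqr_ge0 // ge0_ler_powR ?nnegrE ?mulr_ge0 ?(ltW t0) //.
- by rewrite wE.
- by rewrite wE ler_nat ltnS.
Qed.

Lemma Yt_norm_le y : (Yt_norm w D psi t y <= B%:E)%E -> `|y| <= B.
Proof.
move=> /(sobolev_tail 0); rewrite /fourier_sum big_geq // subr0 powR1 mulr1.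
exact.
Qed.

End sobolev.

Section data_estimator.
Context {R : realType} {X Y : hilbertType R} {K : finType}.
Variables (D : set nat) (psi : nat -> Y).
Hypothesis onb : orthonormal_basis D psi.
Variables (mu : probability (borel X) R) (p : R).
Hypothesis p1 : 1 <= p.
Context {d : measure_display} {Omega : measurableType d}.
Variables (P : probability Omega R) (E : nat -> {RV P >-> process R Y}).
Hypothesis noiseE : iid_white_noise E.
Variables (w : nat -> R) (t B L sigma : R).
Hypothesis wE : forall i, w i = i.+1%:R.
Hypotheses (t0 : 0 < t) (B0 : 0 < B) (L0 : 0 < L) (sigma0 : 0 < sigma).
Variable C : K -> set (borel X).
Hypothesis mC : forall k, measurable (C k).
Hypothesis C_disjoint : forall k k' x, C k x -> C k' x -> k = k'.
Variable z : K -> X.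
Variables (m J : nat) (delta : R).
Hypothesis delta0 : 0 < delta.

Let al : R := #|K|%:R / m%:R.

Definition at_point (k : K) (y : borel X) : bool := (y : X) == z k.

(** Every visit of [z k] is weighted by [al], the inverse of the number of visits
    to be expected. *)
Definition theta (k : K) (j : nat) (x : m.-tuple (borel X))
    (y : m.-tuple (process R Y)) : R :=
  al * \sum_(i < m) (at_point k (tnth x i))%:R * tnth y i (psi j).

Definition code (x : m.-tuple (borel X)) (y : m.-tuple (process R Y)) :
    {ffun K * 'I_J -> int} :=
  [ffun kj => Num.floor (theta kj.1 (val kj.2) x y / delta)].

Definition decode (c : {ffun K * 'I_J -> int}) (k : K) : Y :=
  \sum_(j < J | val j \in D) (delta * (c (k, j))%:~R) *: psi j.

Definition grid_estimator (x : m.-tuple (borel X)) (y : m.-tuple (process R Y)) :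
    X -> Y := step C (decode (code x y)).

Lemma measurable_theta d' (T : measurableType d') k j
    (xs : T -> m.-tuple (borel X)) (ys : T -> m.-tuple (process R Y)) :
  measurable_fun setT xs -> measurable_fun setT ys ->
  measurable_fun setT (fun t => theta k j (xs t) (ys t)).
Proof.
move=> mxs mys; apply: measurable_funM => //; apply: measurable_sum => i.
apply: measurable_funM.
  have mt : measurable_fun setT (fun x : borel X => (at_point k x)%:R : R).
    by apply: measurable_test; exact: measurable_point.
  exact: measurableT_comp mt (measurableT_comp (measurable_tnth i) mxs).
have mi := measurableT_comp (measurable_tnth i) mys.
exact: measurableT_comp (measurable_process_eval (psi j)) mi.
Qed.

Lemma grid_estimatorP d' (T : measurableType d')
    (xs : T -> m.-tuple (borel X)) (ys : T -> m.-tuple (process R Y)) :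
  measurable_fun setT xs -> measurable_fun setT ys ->
  estimator mu p T (fun t => grid_estimator (xs t) (ys t)).
Proof.
move=> mxs mys.
apply: (@countable_estimator _ _ _ mu p _ _ {ffun K * 'I_J -> int}
  (fun t => code (xs t) (ys t)) (fun c => step C (decode c))); last first.
  by move=> c; exact: step_Lp.
move=> c.
rewrite (_ : mkset _ = \bigcap_(kj in [set: K * 'I_J])
    ((fun t => theta kj.1 (val kj.2) (xs t) (ys t)) @^-1`
      `[delta * (c kj)%:~R, delta * (c kj + 1)%:~R[%classic)).
  apply: fin_bigcap_measurable => [|kj _]; first exact: finite_finset.
  have := measurable_theta kj.1 (val kj.2) mxs mys measurableT.
  by move=> /(_ `[delta * (c kj)%:~R, delta * (c kj + 1)%:~R[%classic); rewrite setTI; apply.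
have fl (s : R) (q : int) : (Num.floor (s / delta) == q) =
    (s \in `[delta * q%:~R, delta * (q + 1)%:~R[).
  rewrite floor_eq in_itv /= ler_pdivlMr // ltr_pdivrMr //.
  by rewrite !(mulrC delta).
apply/seteqP; split => x /=.
  by move=> <- kj _ /=; rewrite ffunE -fl.
by move=> h; apply/ffunP => kj; rewrite ffunE; apply/eqP; rewrite fl; exact: h.
Qed.

Definition noise_sum (k : K) (j : nat) (x : m.-tuple (borel X)) (omega : Omega) : R :=
  \sum_(i in [set i : 'I_m | at_point k (tnth x i)]%SET) E i omega (psi j).

Lemma theta_observations F k j x omega :
  theta k j x (observations E sigma F x omega) =
  al * count (at_point k) x * inner (F (z k)) (psi j) +
  al * sigma * noise_sum k j x omega.
Proof.
rewrite /theta; move: al => c; rewrite -!mulrA -mulrDr; congr (c * _).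
have -> : noise_sum k j x omega =
    \sum_(i < m) (at_point k (tnth x i))%:R * E i omega (psi j).
  rewrite /noise_sum big_mkcond /=; apply: eq_bigr => i _; rewrite inE.
  by case: ifP => _; rewrite ?mul1r ?mul0r.
rewrite /count mulr_suml mulr_sumr -big_split /=; apply: eq_bigr => i _.
rewrite tnth_mktuple; case: (boolP (at_point k (tnth x i))) => [/eqP -> /=|_].
  by rewrite !mul1r.
by rewrite !mul0r mulr0 addr0.
Qed.

Lemma noise_sum_mean k j x (q : R) : D j -> 0 < q -> m%:R <= q ^+ 2 ->
  (\int[P]_omega `|noise_sum k j x omega|%:E <= q%:E)%E.
Proof.
by move=> Dj q0 mq; apply: (noise_sum_le noiseE (norm_orthonormal onb Dj)).
Qed.

Lemma measurable_noise_sum k j x : measurable_fun setT (noise_sum k j x).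
Proof.
rewrite /noise_sum; under eq_fun do rewrite -big_enum.
apply: measurable_sum => i.
by have := measurableT_comp (measurable_process_eval (psi j))
  (@measurable_funPT _ _ _ _ (E i)).
Qed.

(** The summands stand for rounding, for the fluctuation of the number of visits,
    and for the averaged noise. *)
Definition coef_error k (j : 'I_J) x omega : R :=
  if val j \in D then
    delta + B * `|1 - al * count (at_point k) x| +
    al * sigma * `|noise_sum k (val j) x omega|
  else 0.

Lemma coef_error_ge0 k j x omega : 0 <= coef_error k j x omega.
Proof.
by rewrite /coef_error; case: ifP => // _;
  rewrite !addr_ge0 // ?mulr_ge0 // ?(ltW delta0) ?(ltW B0) ?(ltW sigma0).
Qed.

Variable F : X -> Y.
Hypothesis FC : lipschitz_class w D psi t B L F.

Let FB x : `|F x| <= B.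
Proof. exact: (Yt_norm_le onb wE t0 B0 (proj1 FC x)). Qed.

Lemma decode_error k x omega :
  `|fourier_sum D psi J (F (z k)) -
      decode (code x (observations E sigma F x omega)) k| <=
  \sum_(j < J) coef_error k j x omega.
Proof.
rewrite /fourier_sum big_mkord /decode -sumrB.
apply: le_trans (ler_norm_sum _ _ _) _; rewrite big_mkcond /=.
apply: ler_sum => j _; rewrite /coef_error; case: ifP => // /set_mem Dj.
rewrite -scalerBl normrZ (norm_orthonormal onb Dj) mulr1 ffunE /=.
set th := theta _ _ _ _; set f := inner _ _.
have rnd : `|th - delta * (Num.floor (th / delta))%:~R| <= delta.
  have := floor_itv (th / delta) => /andP[h1 h2].
  rewrite ger0_norm; last by rewrite subr_ge0 mulrC -ler_pdivlMr.
  move: h2; rewrite ltr_pdivrMr // intrD mulrDl mul1r => h2.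
  by rewrite lerBlDr addrC mulrC ltW.
have thE : f - th = f * (1 - al * count (at_point k) x) -
    al * sigma * noise_sum k (val j) x omega.
  by rewrite /th theta_observations -/f; ring.
have al0 : 0 <= al * sigma by rewrite mulr_ge0 // ?divr_ge0 // ltW.
have fB : `|f| <= B.
  apply: le_trans (FB (z k)); by apply: inner_norm1; rewrite (norm_orthonormal onb Dj).
apply: le_trans (ler_distD th _ _) _; rewrite addrC -addrA.
apply: lerD => //; rewrite thE; apply: le_trans (ler_normB _ _) _.
by rewrite (normrM f) (normrM (al * sigma)) (ger0_norm al0) lerD2r ler_wpM2r.
Qed.

Variables (rho : X -> R).
Hypothesis rho0 : forall x, 0 <= rho x.
Hypothesis rhoC : forall k x, C k x -> `|x - z k| <= rho x.

(** Outside the cells the estimator is 0 and the error is at most [B]; in cell [k]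
    the error passes through [F (z k)] and its truncation to [J] coordinates.
    Summing the coefficient errors over all nodes, not only over [k], makes the
    bound uniform in [pt]. *)
Lemma pointwise_error x omega pt :
  `|F pt - grid_estimator x (observations E sigma F x omega) pt| <=
  (B * \1_(~` \bigcup_k C k) pt + L * rho pt) +
  (B * J.+1%:R `^ (- t) + \sum_k \sum_(j < J) coef_error k j x omega).
Proof.
have e0 : 0 <= \sum_k \sum_(j < J) coef_error k j x omega.
  by apply: sumr_ge0 => k _; apply: sumr_ge0 => j _; exact: coef_error_ge0.
have b0 : 0 <= B * J.+1%:R `^ (- t) by rewrite mulr_ge0 ?powR_ge0 // ltW.
have r0 : 0 <= L * rho pt by rewrite mulr_ge0 // ltW.
have i0 : 0 <= B * \1_(~` \bigcup_k C k) pt by rewrite mulr_ge0 // ltW.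
rewrite /grid_estimator /step; case E1: (cell C pt) => [k|] /=; last first.
  rewrite subr0; apply: le_trans (FB pt) _.
  rewrite indicE mem_set ?mulr1; first by rewrite -!addrA lerDl !addr_ge0.
  by move=> [k _ /(cell_some C_disjoint)]; rewrite E1.
apply: le_trans (ler_distD (F (z k)) _ _) _.
apply: lerD.
  apply: le_trans (proj2 FC _ _) _; apply: le_trans (_ : L * rho pt <= _).
    by rewrite ler_wpM2l ?(ltW L0) // rhoC //; exact: cellP E1.
  by rewrite lerDr.
apply: le_trans (ler_distD (fourier_sum D psi J (F (z k))) _ _) _.
apply: lerD; first exact: (sobolev_tail onb wE t0 B0 J (proj1 FC _)).
apply: le_trans (decode_error k x omega) _.
rewrite (bigD1 k) //= lerDl; apply: sumr_ge0 => k' _; apply: sumr_ge0 => j _.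
exact: coef_error_ge0.
Qed.

End data_estimator.

(** * The upper bound on the minimax risk *)

Section risk_upper_bound.
Context {R : realType} {X Y : hilbertType R} {K : finType}.
Variables (D : set nat) (psi : nat -> Y).
Hypothesis onb : orthonormal_basis D psi.
Variables (mu : probability (borel X) R) (p : R).
Hypothesis p1 : 1 <= p.
Context {d : measure_display} {Omega : measurableType d}.
Variables (P : probability Omega R) (E : nat -> {RV P >-> process R Y}).
Hypothesis noiseE : iid_white_noise E.
Variables (w : nat -> R) (t B L sigma : R).
Hypothesis wE : forall i, w i = i.+1%:R.
Hypotheses (t0 : 0 < t) (B0 : 0 < B) (L0 : 0 < L) (sigma0 : 0 < sigma).
Variable C : K -> set (borel X).
Hypothesis mC : forall k, measurable (C k).
Hypothesis C_disjoint : forall k k' x, C k x -> C k' x -> k = k'.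
Variable z : K -> X.
Hypothesis K0 : (0 < #|K|)%N.
Variables (m J : nat).
Hypothesis m0 : (0 < m)%N.
Variables (rho : X -> R).
Hypothesis rho0 : forall x, 0 <= rho x.
Hypothesis rhoC : forall k x, C k x -> `|x - z k| <= rho x.
Hypothesis mrho : measurable_fun [set: borel X] (rho : borel X -> R).
Variable G : R.

Let g (x : borel X) : R := B * \1_(~` \bigcup_k C k) x + L * rho x.

Hypothesis gG : ('N[mu]_p%:E[EFin \o g] <= G%:E)%E.

Let al : R := #|K|%:R / m%:R.
Let s : R := Num.sqrt m%:R.

Let s0 : 0 < s. Proof. by rewrite sqrtr_gt0 ltr0n. Qed.
Let s2 : s ^+ 2 = m%:R. Proof. by rewrite sqr_sqrtr. Qed.
Let al0 : 0 < al. Proof. by rewrite divr_gt0 ?ltr0n. Qed.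

Let delta := s^-1.
Let delta0 : 0 < delta. Proof. by rewrite invr_gt0. Qed.

Let beta := B * J.+1%:R `^ (- t).

Let est := @grid_estimator R X Y K D psi C z m J delta.

Let cerr := @coef_error R X Y K D psi d Omega P E B sigma z m J delta.

Let cnt (k : K) (x : m.-tuple (borel X)) : R := count (at_point z k) x.

Let measurable_cerr k j x : measurable_fun setT (cerr k j x).
Proof.
rewrite /cerr /coef_error; case: (val j \in D) => //.
apply: measurable_funD => //; apply: measurable_funM => //.
by apply: measurableT_comp => //; exact: measurable_noise_sum.
Qed.

Let cerr0 k j x omega : 0 <= cerr k j x omega.
Proof. exact: coef_error_ge0. Qed.

Let cerr_mean k j x :
  (\int[P]_omega (cerr k j x omega)%:E <=
   (delta + al * sigma * s + B * `|1 - al * cnt k x|)%:E)%E.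
Proof.
have als0 : 0 <= al * sigma by rewrite mulr_ge0 // ltW.
have u0 : 0 <= delta + B * `|1 - al * cnt k x|.
  by rewrite addr_ge0 ?mulr_ge0 ?(ltW delta0) ?(ltW B0).
have tot0 : 0 <= delta + al * sigma * s + B * `|1 - al * cnt k x|.
  by rewrite addrAC addr_ge0 // mulr_ge0 // ltW.
rewrite /cerr /coef_error; case: (boolP (val j \in D)) => [/set_mem Dj|_]; last first.
  by rewrite integral0 lee_fin.
have mn : measurable_fun setT (fun omega => `|noise_sum psi E z k (val j) x omega|%:E).
  by apply/measurable_EFinP; apply: measurableT_comp => //; exact: measurable_noise_sum.
rewrite (eq_integral (fun omega => ((delta + B * `|1 - al * cnt k x|)%:E +
   (al * sigma)%:E * `|noise_sum psi E z k (val j) x omega|%:E)%E)) //.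
rewrite ge0_integralD //; last 2 first.
- by move=> x' _; apply: mule_ge0; rewrite lee_fin.
- exact: measurable_funeM.
rewrite integral_cst //= probability_setT mule1 ge0_integralZl_EFin //.
have -> : (delta + al * sigma * s + B * `|1 - al * cnt k x|)%:E =
    ((delta + B * `|1 - al * cnt k x|)%:E + (al * sigma)%:E * s%:E)%E.
  by rewrite -EFinM -EFinD addrAC.
apply: leeD2l; apply: lee_wpmul2l; first by rewrite lee_fin.
by apply: (noise_sum_mean onb noiseE) => //; rewrite s2.
Qed.

Variable F : X -> Y.
Hypothesis FC : lipschitz_class w D psi t B L F.

Lemma class_borel : borel_map F.
Proof. apply: continuous_borel; exact: (lipschitz_continuous L0 (proj2 FC)). Qed.

Let mg : measurable_fun [set: borel X] g.
Proof.
apply: measurable_funD; apply: measurable_funM => //.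
apply: measurable_indic; apply: measurableC.
by apply: fin_bigcup_measurable => //; exact: finite_finset.
Qed.

Let g0 x : 0 <= g x.
Proof. by rewrite /g addr_ge0 ?mulr_ge0 ?(ltW B0) ?(ltW L0). Qed.

Lemma expected_error x :
  (\int[P]_omega Lp_norm mu p (F \- est x (observations E sigma F x omega))%R <=
   (G + beta)%:E +
   \sum_k (J%:R * (delta + al * sigma * s + B * `|1 - al * cnt k x|))%:E)%E.
Proof.
pose S omega := \sum_k \sum_(j < J) cerr k j x omega.
have S0 omega : 0 <= S omega.
  by apply: sumr_ge0 => k _; apply: sumr_ge0 => j _; exact: cerr0.
have b0 : 0 <= beta by rewrite mulr_ge0 ?powR_ge0 // ltW.
have G0 : 0 <= G by rewrite -lee_fin (le_trans _ gG) // Lnorm_ge0.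
have pt0 : 0 < p by exact: lt_le_trans p1.
have mS : measurable_fun setT (fun omega => (S omega)%:E).
  by apply/measurable_EFinP; apply: measurable_sum => k; apply: measurable_sum => j.
apply: (@le_trans _ _ (\int[P]_omega ((G + beta)%:E + (S omega)%:E))%E).
  apply: integral_mono => omega; first exact: Lp_norm_ge0.
  have c0 : 0 <= beta + S omega by rewrite addr_ge0.
  apply: (@le_trans _ _ ('N[mu]_p%:E[EFin \o (g \+ cst (beta + S omega))%R])%E).
    by apply: Lp_norm_bound => // pt /=; apply: pointwise_error.
  have mc : measurable_fun setT (cst (beta + S omega) : borel X -> R) by [].
  have := @minkowski_EFin _ _ _ mu _ _ p mg mc p1; move/le_trans; apply.
  by rewrite Lnorm_cst // -EFinD -addrA [in leRHS]EFinD; apply: leeD2r.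
have Gb0 : 0 <= G + beta by rewrite addr_ge0.
rewrite ge0_integralD //; last by move=> omega _; rewrite lee_fin.
rewrite integral_cst //= probability_setT mule1 leeD2l //.
rewrite (eq_integral (fun omega => (\sum_k (\sum_(j < J) cerr k j x omega)%:E)%E)); last first.
  by move=> omega _; rewrite sumEFin.
rewrite ge0_integral_sum //; last 2 first.
- by move=> k; apply/measurable_EFinP; apply: measurable_sum => j.
- by move=> k omega _; rewrite lee_fin; apply: sumr_ge0 => j _; exact: cerr0.
apply: lee_sum => k _.
rewrite (eq_integral (fun omega => (\sum_(j < J) (cerr k j x omega)%:E)%E)); last first.
  by move=> omega _; rewrite sumEFin.
rewrite ge0_integral_sum //; last 2 first.
- by move=> j; apply/measurable_EFinP.
- by move=> j omega _; rewrite lee_fin.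
apply: le_trans (lee_sum _ (fun j _ => cerr_mean k j x)) _.
by rewrite sumEFin lee_fin sumr_const card_ord -[leLHS]mulr_natl.
Qed.

Hypothesis F_Lp : Lp mu p F.

Let M : R := #|K|%:R.

(** The [#|K| * J] coefficients have mean errors of order [#|K| / sqrt m] each. *)
Definition stochastic_error : R := J%:R * M ^+ 2 * (1 + sigma + B) / s.

Let M1 : 1 <= M. Proof. by rewrite ler1n. Qed.

Let s1 : 1 <= s.
Proof. by rewrite -sqrtr1 ler_wsqrtr // ler1n. Qed.

Let alE : al = M / s ^+ 2. Proof. by rewrite s2. Qed.

Let node_error (v : R) : 0 <= v -> v <= M / s ->
  J%:R * (delta + al * sigma * s + B * v) <= J%:R * (M * (1 + sigma + B) / s).
Proof.
move=> v0 vs; rewrite ler_wpM2l //.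
have -> : al * sigma * s = sigma * (M / s).
  by rewrite alE; field; rewrite gt_eqF.
have -> : M * (1 + sigma + B) / s = M / s + sigma * (M / s) + B * (M / s) by ring.
rewrite !lerD //; last by rewrite ler_wpM2l // ltW.
by rewrite /delta -[leLHS]mul1r ler_wpM2r // invr_ge0 ltW.
Qed.

Let node_total :
  \sum_(k : K) J%:R * (M * (1 + sigma + B) / s) = stochastic_error.
Proof. by rewrite sumr_const -[LHS]mulr_natl /stochastic_error -/M; ring. Qed.

Lemma fixed_expected_error (x : m.-tuple (borel X)) :
  (forall k, `|1 - al * cnt k x| <= al) ->
  (\int[P]_omega Lp_norm mu p (F \- est x (observations E sigma F x omega))%R <=
   (G + beta + stochastic_error)%:E)%E.
Proof.
move=> hx; apply: le_trans (expected_error x) _.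
rewrite sumEFin -EFinD lee_fin lerD2l -node_total; apply: ler_sum => k _.
apply: node_error => //; apply: le_trans (hx k) _.
rewrite alE ler_wpM2l // ?(le_trans _ M1) // lef_pV2 ?posrE ?exprn_gt0 //.
by rewrite expr2 ler_peMr // ltW.
Qed.

Lemma random_expected_error (nu : probability (borel X) R) :
  (forall k, nu [set y | at_point z k y] = (M^-1)%:E) ->
  (\int[iid_law nu m \x P]_v
     Lp_norm mu p (F \- est v.1 (observations E sigma F v.1 v.2))%R <=
   (G + beta + stochastic_error)%:E)%E.
Proof.
move=> nuk.
have merr : measurable_fun setT (fun v : m.-tuple (borel X) * Omega =>
    Lp_norm mu p (F \- est v.1 (observations E sigma F v.1 v.2))%R).
  apply: (measurable_error onb p1 F_Lp).
  apply: (@grid_estimatorP _ _ _ _ D psi mu p p1 C mC C_disjoint z m J delta delta0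
    _ _ fst (fun v => observations E sigma F v.1 v.2)); first exact: measurable_fst.
  by apply: measurable_observations; first exact: class_borel.
rewrite fubini_tonelli1 //; last by move=> v; exact: Lp_norm_ge0.
have b0 : 0 <= beta by rewrite mulr_ge0 ?powR_ge0 // ltW.
have G0 : 0 <= G by rewrite -lee_fin (le_trans _ gG) // Lnorm_ge0.
have als0 : 0 <= al * sigma by rewrite mulr_ge0 // ltW.
have mc k : measurable_fun setT (fun x => `|1 - al * cnt k x|%:E).
  apply/measurable_EFinP; apply: measurableT_comp => //.
  apply: measurable_funB => //; apply: measurable_funM => //.
  by apply: measurable_count; exact: measurable_point.
have mJ k : measurable_fun setT (fun x =>
    (J%:R * (delta + al * sigma * s + B * `|1 - al * cnt k x|))%:E).
  apply/measurable_EFinP; apply: measurable_funM => //; apply: measurable_funD => //.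
  by apply: measurable_funM => //; apply/measurable_EFinP; exact: mc.
have c0 : 0 <= delta + al * sigma * s.
  by rewrite addr_ge0 ?(ltW delta0) // mulr_ge0 // ltW.
have J0 k x : (0 <= (J%:R * (delta + al * sigma * s + B * `|1 - al * cnt k x|))%:E)%E.
  by rewrite lee_fin mulr_ge0 // addr_ge0 // mulr_ge0 // ltW.
apply: (@le_trans _ _ (\int[iid_law nu m]_x ((G + beta)%:E +
   \sum_k (J%:R * (delta + al * sigma * s + B * `|1 - al * cnt k x|))%:E))%E).
  apply: integral_mono => x; last exact: expected_error.
  by apply: integral_ge0 => omega _; exact: Lp_norm_ge0.
have Gb0 : 0 <= G + beta by rewrite addr_ge0.
rewrite ge0_integralD //; last 2 first.
- by move=> x _; apply: sume_ge0 => k _.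
- by apply: emeasurable_sum.
rewrite integral_cst //= probability_setT mule1 [in leRHS]EFinD; apply: leeD2l.
rewrite ge0_integral_sum // -node_total -sumEFin; apply: lee_sum => k _.
rewrite (eq_integral (fun x => (J%:R%:E * ((delta + al * sigma * s)%:E +
   B%:E * `|1 - al * cnt k x|%:E))%E)) //.
have mB : measurable_fun setT (fun x => (B%:E * `|1 - al * cnt k x|%:E)%E).
  exact: measurable_funeM.
have B0' x : (0 <= B%:E * `|1 - al * cnt k x|%:E)%E.
  by rewrite -EFinM lee_fin mulr_ge0 // ltW.
rewrite ge0_integralZl_EFin //; last 2 first.
- by move=> x _; apply: adde_ge0; [rewrite lee_fin|exact: B0'].
- by apply: emeasurable_funD.
rewrite ge0_integralD // integral_cst //= probability_setT mule1.
rewrite ge0_integralZl_EFin // ?(ltW B0) //.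
have Ms0 : 0 < M / s by rewrite divr_gt0 // (lt_le_trans _ M1).
have M0 : M != 0 by rewrite gt_eqF // (lt_le_trans _ M1).
have al1 : al * (m%:R * M^-1) = 1.
  by rewrite /al -/M; field; rewrite M0 /= pnatr_eq0 -lt0n.
have dev := count_deviation (measurable_point (z k)) (nuk k) Ms0 al1.
have vM : M / s / 2 + al / (2 * (M / s)) <= M / s.
  have -> : al / (2 * (M / s)) = s^-1 / 2 by rewrite alE; field; rewrite M0 gt_eqF.
  have : s^-1 <= M / s by rewrite -[leLHS]mul1r ler_wpM2r // invr_ge0 ltW.
  lra.
apply: (@le_trans _ _ (J%:R%:E * ((delta + al * sigma * s)%:E + B%:E * (M / s)%:E))%E).
  apply: lee_wpmul2l; first by rewrite lee_fin.
  apply: leeD2l; apply: lee_wpmul2l; first by rewrite lee_fin ltW.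
  by apply: le_trans dev _; rewrite lee_fin.
rewrite [leLHS](_ : _ = (J%:R * (delta + al * sigma * s + B * (M / s)))%:E) //.
rewrite lee_fin.
by apply: node_error => //; exact: ltW.
Qed.

End risk_upper_bound.

Section minimax_upper_bound.
Context {R : realType} {X Y : hilbertType R} {K : finType}.
Variables (D : set nat) (psi : nat -> Y).
Hypothesis onb : orthonormal_basis D psi.
Variables (mu : probability (borel X) R) (p : R).
Hypothesis p1 : 1 <= p.
Context {d : measure_display} {Omega : measurableType d}.
Variables (P : probability Omega R) (E : nat -> {RV P >-> process R Y}).
Hypothesis noiseE : iid_white_noise E.
Variables (w : nat -> R) (t B L sigma : R).
Hypothesis wE : forall i, w i = i.+1%:R.
Hypotheses (t0 : 0 < t) (B0 : 0 < B) (L0 : 0 < L) (sigma0 : 0 < sigma).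

Lemma class_Lp (F : X -> Y) : lipschitz_class w D psi t B L F -> Lp mu p F.
Proof.
move=> FC; split; first exact: class_borel FC.
apply: le_lt_trans (@Lp_norm_bound _ _ _ mu p p1 _ (cst B) _) _.
  by move=> x; exact: (Yt_norm_le onb wE t0 B0 (proj1 FC x)).
by rewrite (Lnorm_cst _ (lt_le_trans ltr01 p1) (ltW B0)) ltry.
Qed.

Variable C : K -> set (borel X).
Hypothesis mC : forall k, measurable (C k).
Hypothesis C_disjoint : forall k k' x, C k x -> C k' x -> k = k'.
Variable z : K -> X.
Hypothesis z_inj : injective z.
Hypothesis K0 : (0 < #|K|)%N.
Variables (m J : nat).
Hypothesis m0 : (0 < m)%N.
Variables (rho : X -> R).
Hypothesis rho0 : forall x, 0 <= rho x.
Hypothesis rhoC : forall k x, C k x -> `|x - z k| <= rho x.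
Hypothesis mrho : measurable_fun [set: borel X] (rho : borel X -> R).
Variable G : R.
Hypothesis gG : ('N[mu]_p%:E[EFin \o (fun x : borel X =>
  B * \1_(~` \bigcup_k C k) x + L * rho x)%R] <= G%:E)%E.

(** The same estimator serves both designs: the nodes are visited in turn, or
    drawn uniformly. *)
Lemma minimax_risk_le (k : design) :
  (minimax_risk E sigma m (lipschitz_class w D psi t B L) mu p k <=
   (G + B * J.+1%:R `^ (- t) +
    J%:R * #|K|%:R ^+ 2 * (1 + sigma + B) / Num.sqrt m%:R)%:E)%E.
Proof.
have s0 : 0 < (Num.sqrt m%:R : R)^-1 by rewrite invr_gt0 sqrtr_gt0 ltr0n.
case: k => /=.
- have [x hx] := grid_design_count (R := R) z_inj K0 m0.
  apply: ge_ereal_inf; eexists; first by exists x.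
  pose est := grid_estimator D psi C z J (Num.sqrt m%:R)^-1 x.
  have estE : estimator mu p (m.-tuple (process R Y)) est.
    by apply: (@grid_estimatorP _ _ _ _ D psi mu p p1 C mC C_disjoint z m J _ s0
      _ _ (cst x) id).
  apply: ge_ereal_inf; eexists; first by exists est.
  apply: ge_ereal_sup => _ [F FC <-].
  exact: (fixed_expected_error onb p1 noiseE wE t0 B0 L0 sigma0 mC C_disjoint K0 J m0
    rho0 rhoC mrho gG FC hx).
- have [nu nuk] := uniform_law (R := R) z_inj K0.
  apply: ge_ereal_inf; eexists; first by exists nu.
  pose est (v : m.-tuple (borel X) * m.-tuple (process R Y)) :=
    grid_estimator D psi C z J (Num.sqrt m%:R)^-1 v.1 v.2.
  have estE : estimator mu p (m.-tuple (borel X) * m.-tuple (process R Y))%type est.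
    by apply: (@grid_estimatorP _ _ _ _ D psi mu p p1 C mC C_disjoint z m J _ s0
      _ _ fst snd).
  apply: ge_ereal_inf; eexists; first by exists est.
  apply: ge_ereal_sup => _ [F FC <-].
  exact: (random_expected_error onb p1 noiseE wE t0 B0 L0 sigma0 mC C_disjoint K0 J m0
    rho0 rhoC mrho gG FC (class_Lp FC) nuk).
Qed.

End minimax_upper_bound.

(** * Tails of the expansion in the eigenbasis *)

Section projection_tail.
Context {R : realType} {X : hilbertType R}.
Variables (mu : probability (borel X) R) (lambda : nat -> R) (phi : nat -> X).
Hypothesis eig : covariance_eigenbasis mu lambda phi.
Local Open Scope ereal_scope.

Let lam0 i : (0 < lambda i)%R. Proof. exact: eigenbasis_gt0 eig i. Qed.
Let onb := eigenbasis_orthonormal eig.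

Lemma xi_scale i (x : X) : (inner x (phi i) = Num.sqrt (lambda i) * xi lambda phi i x)%R.
Proof. by rewrite /xi mulrC divfK // gt_eqF // sqrtr_gt0. Qed.

Lemma xi_sqr i (x : X) : (inner x (phi i) ^+ 2 = lambda i * xi lambda phi i x ^+ 2)%R.
Proof. by rewrite xi_scale exprMn sqr_sqrtr // ltW. Qed.

(** The covariance operator has eigenvalue [lambda i] at [phi i]. *)
Lemma xi_second_moment i : \int[mu]_x (xi lambda phi i x ^+ 2)%:E = 1.
Proof.
have [C covC CE] := eigenbasis_eigenvector eig.
have mxi2 : measurable_fun setT (fun x : borel X => (xi lambda phi i x ^+ 2)%:E).
  by apply/measurable_EFinP; apply: measurable_funX; exact: measurable_xi.
have := covC (phi i) (phi i).
rewrite CE innerZl (proj1 onb) // eqxx mulr1.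
rewrite (eq_integral (fun x => (lambda i)%:E * (xi lambda phi i x ^+ 2)%:E)); last first.
  by move=> x _; rewrite -!EFinM -xi_sqr expr2.
rewrite ge0_integralZl_EFin ?(ltW (lam0 i)) //; last by move=> x _; rewrite lee_fin sqr_ge0.
set I := \int[mu]_x _ => E1.
have Ifin : I \is a fin_num.
  move: E1; case: I => [r| |] //=; first by rewrite gt0_muley ?lte_fin.
  by rewrite gt0_muleNy ?lte_fin.
move: E1; rewrite -(fineK Ifin) -EFinM => -[] /esym E1; congr (_%:E).
by apply: (mulfI (lt0r_neq0 (lam0 i))); rewrite E1 mulr1.
Qed.

Lemma measurable_xi_ge i (A : R) :
  measurable [set x : borel X | (A <= `|xi lambda phi i x|)%R].
Proof.
have mn : measurable_fun setT (fun x : borel X => `|xi lambda phi i x|%R).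
  by apply: measurableT_comp => //; exact: measurable_xi.
have := mn measurableT `[A, +oo[%classic (measurable_itv _).
rewrite setTI; congr measurable; apply/seteqP; split => x /=; rewrite in_itv /= andbT //.
Qed.

Lemma xi_chebyshev i (A : R) : (0 < A)%R ->
  mu [set x : borel X | (A <= `|xi lambda phi i x|)%R] <= (A ^- 2)%:E.
Proof.
move=> A0; have A20 : (0 < A ^+ 2)%R by rewrite exprn_gt0.
have mS := measurable_xi_ge i A.
rewrite -[X in mu X <= _]setIT -integral_indic //.
have mxi2 : measurable_fun setT (fun x : borel X => (xi lambda phi i x ^+ 2)%:E).
  by apply/measurable_EFinP; apply: measurable_funX; exact: measurable_xi.
rewrite -[leRHS]mule1 -(xi_second_moment i) -ge0_integralZl_EFin //; last 2 first.
- by move=> x _; rewrite lee_fin sqr_ge0.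
- by rewrite invr_ge0 ltW.
apply: integral_mono => x; first by rewrite lee_fin.
rewrite -EFinM lee_fin indicE; case: (boolP (x \in _)) => [/set_mem /= h|_].
  rewrite mulrC ler_pdivlMr // mul1r -[leRHS]real_normK ?num_real //.
  by rewrite ler_sqr ?nnegrE // ltW.
by rewrite mulr_ge0 ?sqr_ge0 // invr_ge0 ltW.
Qed.

Variables (pp K : R).
Hypothesis pp2 : (2 <= pp)%R.
Hypothesis K0 : (0 <= K)%R.
Hypothesis xiK : forall i, 'N[mu]_pp%:E[EFin \o xi lambda phi i] <= K%:E.

Let q := (pp / 2)%R.
Let q1 : (1 <= q)%R. Proof. by rewrite /q ler_pdivlMr // mul1r. Qed.
Let q0 : (0 < q)%R. Proof. exact: lt_le_trans q1. Qed.
Let pp0 : (0 < pp)%R. Proof. exact: lt_le_trans pp2. Qed.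
Let ppE : (pp = 2 * q)%R. Proof. by rewrite /q; field. Qed.

Let mxi2 i : measurable_fun setT (fun x : borel X => xi lambda phi i x ^+ 2)%R.
Proof. by apply: measurable_funX; exact: measurable_xi. Qed.

Let xi_sqr_norm i : 'N[mu]_q%:E[EFin \o (fun x => xi lambda phi i x ^+ 2)%R] <= (K ^+ 2)%:E.
Proof.
have h : \int[mu]_x (`|xi lambda phi i x| `^ pp)%:E <= (K `^ pp)%:E.
  rewrite -poweR_EFin; apply: le_trans (ge0_le_poweR (ltW pp0) (Lnorm_ge0 _ _ _) (xiK i)).
  by rewrite powR_Lnorm ?gt_eqF.
rewrite unlock.
have -> : (K ^+ 2)%:E = (K `^ pp)%:E `^ q^-1.
  by rewrite poweR_EFin -powRrM ppE mulfK ?gt_eqF // powR_mulrn.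
apply: ge0_le_poweR; first by rewrite invr_ge0 ltW.
  by apply: integral_ge0 => x _; exact: poweR_ge0.
rewrite (eq_integral (fun x => (`|xi lambda phi i x| `^ pp)%:E)) // => x _ /=.
by rewrite ppE powRrM powR_mulrn // normrX.
Qed.

Variables (n : nat) (Lam : R).
Hypothesis Lam_tail : forall N, (\sum_(n <= i < N) lambda i <= Lam)%R.
Hypothesis Lam0 : (0 <= Lam)%R.

Let tail_energy (N : nat) (x : borel X) : R :=
  (\sum_(n <= i < N) lambda i * xi lambda phi i x ^+ 2)%R.

Let mtail N : measurable_fun setT (tail_energy N).
Proof. by apply: measurable_sum => i; apply: measurable_funM. Qed.

Let tail_energy0 N x : (0 <= tail_energy N x)%R.
Proof. by apply: sumr_ge0 => i _; rewrite mulr_ge0 ?sqr_ge0 // ltW. Qed.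

Let tail_energy_norm N : 'N[mu]_q%:E[EFin \o tail_energy N] <= (Lam * K ^+ 2)%:E.
Proof.
apply: le_trans (@Lnorm_sum_le _ _ _ mu q _ _ (fun i x => lambda i * xi lambda phi i x ^+ 2)%R q1 _) _.
  by move=> i; apply: measurable_funM.
apply: (@le_trans _ _ (\sum_(n <= i < N) (lambda i * K ^+ 2)%:E)).
  apply: lee_sum => i _; apply: le_trans (LnormZ_le mu q0 (ltW (lam0 i)) (mxi2 i)) _.
  by rewrite EFinM; apply: lee_wpmul2l (xi_sqr_norm i); rewrite lee_fin ltW.
by rewrite sumEFin lee_fin -mulr_suml ler_wpM2r ?sqr_ge0.
Qed.

Definition projection_residual (x : borel X) : R :=
  (`|(x : X) - fourier_sum [set: nat] phi n x|)%R.

Lemma projection_residualE x : (projection_residual x =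
  Num.sqrt (`|x : X| ^+ 2 - coef_energy [set: nat] phi n x))%R.
Proof. by rewrite -(sqr_dist_fourier_sum onb) sqrtr_sqr normr_id. Qed.

Lemma measurable_projection_residual : measurable_fun setT projection_residual.
Proof.
rewrite (_ : projection_residual = fun x =>
  (Num.sqrt (`|x : X| ^+ 2 - coef_energy [set: nat] phi n x))%R); last first.
  by apply/funext => x; rewrite projection_residualE.
apply: measurableT_comp.
  by apply: continuous_measurable_fun; exact: sqrt_continuous.
apply: measurable_funB.
  by apply: measurable_funX; apply: continuous_borel_real; exact: norm_continuous.
rewrite /coef_energy; under eq_fun do rewrite big_mkcond /=.
apply: measurable_sum => i; case: (i \in [set: nat]); last exact: measurable_cst.
by apply: measurable_funX; exact: measurable_inner.
Qed.

Let tail_energyE N x : (n <= N)%N ->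
  (tail_energy N x = coef_energy [set: nat] phi N x - coef_energy [set: nat] phi n x)%R.
Proof.
move=> nN; rewrite /coef_energy (big_cat_nat (leq0n n) nN) /=.
rewrite [RHS]addrAC subrr add0r; apply: eq_big => [i|i _]; first by rewrite in_setT.
by rewrite xi_sqr.
Qed.

Let tail_energy_cvg x : tail_energy ^~ x @ \oo --> (projection_residual x ^+ 2)%R.
Proof.
rewrite /projection_residual (sqr_dist_fourier_sum onb).
have h : (coef_energy [set: nat] phi N x - coef_energy [set: nat] phi n x)%R
    @[N --> \oo] --> (`|x : X| ^+ 2 - coef_energy [set: nat] phi n x)%R.
  by apply: cvgB; [exact: (coef_energy_cvg onb (x := x))|exact: cvg_cst].
have e : \forall N \near \oo, (coef_energy [set: nat] phi N x -
    coef_energy [set: nat] phi n x)%R = tail_energy N x.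
  by exists n => // N /= nN; rewrite tail_energyE.
exact: cvg_trans (near_eq_cvg e) h.
Qed.

Let tail_energy_nd x : nondecreasing_seq (tail_energy ^~ x).
Proof.
move=> N N' NN'; rewrite /tail_energy.
have [nN|Nn] := leqP n N.
  rewrite [leRHS](big_cat_nat nN NN') /= lerDl; apply: sumr_ge0 => i _.
  by rewrite mulr_ge0 ?sqr_ge0 // ltW.
by rewrite big_geq ?(ltnW Nn) //; exact: tail_energy0.
Qed.

Let residual_q_integral :
  \int[mu]_x ((projection_residual x ^+ 2) `^ q)%:E <= (Lam * K ^+ 2)%:E `^ q.
Proof.
pose u N (x : borel X) := (tail_energy N x `^ q)%:E.
have u0 N x : 0 <= u N x by rewrite lee_fin powR_ge0.
have mu' N : measurable_fun setT (u N).
  apply/measurable_EFinP; exact: (measurableT_comp (measurable_powR _)).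
have und x : {homo u ^~ x : N N' / (N <= N')%N >-> N <= N'}.
  move=> N N' NN'; rewrite lee_fin ge0_ler_powR ?nnegrE ?(ltW q0) //.
  exact: tail_energy_nd.
have uN N : \int[mu]_x u N x <= (Lam * K ^+ 2)%:E `^ q.
  apply: le_trans (ge0_le_poweR (ltW q0) (Lnorm_ge0 _ _ _) (tail_energy_norm N)).
  rewrite powR_Lnorm ?gt_eqF //; apply: integral_mono => x //=.
  by rewrite lee_fin ger0_norm.
have ulim x : limn (u ^~ x) = ((projection_residual x ^+ 2) `^ q)%:E.
  apply/cvg_lim => //; apply: cvg_EFin; first exact: nearW.
  have cvx := @tail_energy_cvg x.
  have [v0|v0] := eqVneq (projection_residual x ^+ 2)%R 0%R.
    have z0 N : tail_energy N x = 0%R.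
      apply/eqP; rewrite eq_le tail_energy0 andbT -v0 -(cvg_lim _ cvx) //.
      by apply: nondecreasing_cvgn_le (@tail_energy_nd x) _ N; exact: cvgP cvx.
    by rewrite v0 powR0 ?gt_eqF // (_ : fine \o _ = cst 0%R) //;
      [exact: cvg_cst|apply/funext => N; rewrite /= z0 powR0 // gt_eqF].
  have vp : (0 < projection_residual x ^+ 2)%R by rewrite lt0r v0 sqr_ge0.
  have hc : {for (projection_residual x ^+ 2)%R, continuous (fun v : R => v `^ q)%R}.
    apply: differentiable_continuous; apply/derivable1_diffP.
    by apply: derivable_powR; rewrite in_itv /= vp.
  exact: (continuous_cvg _ hc cvx).
have cv := @cvg_monotone_convergence _ _ _ mu setT measurableT u mu'
  (fun N x _ => u0 N x) (fun x _ => und x).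
rewrite (eq_integral (fun x => limn (u ^~ x))); last by move=> x _; rewrite ulim.
rewrite -(cvg_lim _ cv) //; apply: lime_le; first exact: cvgP cv.
exact: nearW.
Qed.

(** Minkowski's inequality in L^q, applied to the squares of the coordinates
    [n <= i < N], bounds their energy by [Lam * K ^ 2], and monotone convergence
    lets [N] grow. *)
Lemma projection_residual_norm :
  'N[mu]_pp%:E[EFin \o projection_residual] <= (K * Num.sqrt Lam)%:E.
Proof.
rewrite unlock.
rewrite (eq_integral (fun x => ((projection_residual x ^+ 2) `^ q)%:E)); last first.
  by move=> x _; rewrite /= ppE powRrM powR_mulrn // real_normK ?num_real.
have -> : (K * Num.sqrt Lam)%:E = ((Lam * K ^+ 2)%:E `^ q) `^ pp^-1.
  have -> : ((Lam * K ^+ 2)%:E `^ q) `^ pp^-1 = ((Lam * K ^+ 2) `^ 2^-1)%R%:E.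
    rewrite -poweRrM poweR_EFin; congr ((_ `^ _)%R%:E).
    by rewrite /q; field; rewrite gt_eqF.
  rewrite powR12_sqrt ?mulr_ge0 ?sqr_ge0 // sqrtrM // sqrtr_sqr ger0_norm //.
  by rewrite mulrC.
apply: ge0_le_poweR; first by rewrite invr_ge0 ltW.
  by apply: integral_ge0 => x _; rewrite lee_fin powR_ge0.
exact: residual_q_integral.
Qed.

End projection_tail.

Section eigenvalue_tail.
Context {R : realType}.

(** Comparison with the telescoping differences of [i^(1 - tau)]. *)
Lemma eigenvalue_tail (tau : R) (n N : nat) : 1 < tau -> (0 < n)%N ->
  \sum_(n <= i < N) i.+1%:R `^ (- tau) <= n%:R `^ (- (tau - 1)) / (tau - 1).
Proof.
move=> tau1 n0; pose s := tau - 1; have s0 : 0 < s by rewrite subr_gt0.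
rewrite -/s ler_pdivlMr //.
have step1 i : (0 < i)%N ->
    i.+1%:R `^ (- tau) * s <= i%:R `^ (- s) - i.+1%:R `^ (- s) :> R.
  move=> i0; have iR : 0 < i%:R :> R by rewrite ltr0n.
  have ratio : i.+1%:R^-1 <= ln i.+1%:R - ln i%:R :> R.
    have h : ln (1 + - i.+1%:R^-1) <= - i.+1%:R^-1 :> R.
      apply: le_ln1Dx; rewrite ltrN2 invf_lt1 // ltr1n ltnS //.
    have e : 1 + - i.+1%:R^-1 = i%:R / i.+1%:R :> R.
      by rewrite -natr1; field; rewrite natr1 gt_eqF.
    by move: h; rewrite e ln_div ?posrE // => h; rewrite -lerN2 opprB.
  have tauE : - tau = - s + -1 by rewrite /s; ring.
  have -> : i.+1%:R `^ (- tau) = i.+1%:R `^ (- s) * i.+1%:R^-1 :> R.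
    rewrite tauE powRD; first by rewrite powR_inv1.
    by rewrite pnatr_eq0 implybT.
  have -> : i%:R `^ (- s) = i.+1%:R `^ (- s) * expR (s * (ln i.+1%:R - ln i%:R)) :> R.
    by rewrite !powR_expR // -expRD; congr expR; ring.
  have p0 : 0 < i.+1%:R `^ (- s) :> R by rewrite powR_gt0.
  have := expR_ge1Dx (s * (ln i.+1%:R - ln i%:R)).
  set e := expR _ => he.
  have : s * i.+1%:R^-1 <= s * (ln i.+1%:R - ln i%:R) by rewrite ler_pM2l.
  set q := _ `^ _ in p0 *; set v := _^-1 => hv.
  have : v * s <= e - 1 by lra.
  move=> h; have : q * (v * s) <= q * (e - 1) by rewrite ler_pM2l.
  lra.
suff : (\sum_(n <= i < N) i.+1%:R `^ (- tau)) * s <=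
    n%:R `^ (- s) - (maxn n N)%:R `^ (- s).
  by move=> h; apply: le_trans h _; rewrite gerBl powR_ge0.
elim: N => [|N ih]; first by rewrite big_geq // mul0r maxn0 subrr.
have [nN|Nn] := leqP n N; last first.
  by rewrite big_geq // mul0r (maxn_idPl _) // subrr.
rewrite big_nat_recr //= mulrDl.
have := step1 N (leq_trans n0 nN).
move: ih; rewrite (maxn_idPr nN) (maxn_idPr (leqW nN)); lra.
Qed.

End eigenvalue_tail.

(** * The grid of the leading coordinates *)

Section grid.
Context {R : realType} {X : hilbertType R}.
Variables (mu : probability (borel X) R) (lambda : nat -> R) (phi : nat -> X).
Hypothesis eig : covariance_eigenbasis mu lambda phi.
Hypothesis lam1 : forall i, lambda i <= 1.
Variables (n c : nat).
Hypothesis c0 : (0 < c)%N.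

Let cR : 0 < c%:R :> R. Proof. by rewrite ltr0n. Qed.
Let lam0 i : 0 < lambda i. Proof. exact: eigenbasis_gt0 eig i. Qed.
Let onb := eigenbasis_orthonormal eig.

Notation nodes := {ffun 'I_n -> 'I_(2 * c ^ 2)}.

(** The mesh is [c^-1] and the indices [j <= 2 * c ^ 2] cover [[-c, c]]. *)
Definition node_coord (j : nat) : R := - c%:R + j%:R / c%:R.

Definition grid_cell (k : nodes) : set (borel X) :=
  [set x | forall i : 'I_n,
     node_coord (k i) <= xi lambda phi i x < node_coord (k i).+1].

Definition node (k : nodes) : X :=
  \sum_(i < n) (Num.sqrt (lambda i) * node_coord (k i)) *: phi i.

Lemma card_nodes : #|{: nodes}| = ((2 * c ^ 2) ^ n)%N.
Proof. by rewrite card_ffun !card_ord. Qed.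

Lemma measurable_grid_cell k : measurable (grid_cell k).
Proof.
rewrite (_ : grid_cell k = \bigcap_(i in [set: 'I_n])
  (xi lambda phi i @^-1` `[node_coord (k i), node_coord (k i).+1[%classic)).
  apply: fin_bigcap_measurable => [|i _]; first exact: finite_finset.
  have := @measurable_xi _ _ lambda phi i measurableT.
  by move=> /(_ `[node_coord (k i), node_coord (k i).+1[%classic (measurable_itv _)); rewrite setTI.
apply/seteqP; split => x /= h i; last by have := h i Logic.I; rewrite /= in_itv.
by move=> _ /=; rewrite in_itv /=; exact: h.
Qed.

Lemma grid_cell_disjoint k k' x : grid_cell k x -> grid_cell k' x -> k = k'.
Proof.
move=> h h'; apply/ffunP => i; apply/val_inj => /=.
have /andP[a1 a2] := h i; have /andP[b1 b2] := h' i.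
have e1 : (k i)%:R < (k' i).+1%:R :> R.
  have : node_coord (k i) < node_coord (k' i).+1 by exact: le_lt_trans b2.
  by rewrite /node_coord ltrD2l ltr_pM2r ?invr_gt0.
have e2 : (k' i)%:R < (k i).+1%:R :> R.
  have : node_coord (k' i) < node_coord (k i).+1 by exact: le_lt_trans a2.
  by rewrite /node_coord ltrD2l ltr_pM2r ?invr_gt0.
by move: e1 e2; rewrite !ltr_nat !ltnS => e1 e2; apply/eqP; rewrite eqn_leq e1 e2.
Qed.

Lemma node_inj : injective node.
Proof.
move=> k k' kk'; apply/ffunP => i; apply/val_inj => /=.
have coordE (k0 : nodes) : inner (node k0) (phi i) = Num.sqrt (lambda i) * node_coord (k0 i).
  rewrite /node inner_suml (bigD1 i) //= innerZl (proj1 onb) // eqxx mulr1.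
  rewrite big1 ?addr0 // => j ji; rewrite innerZl (proj1 onb) //.
  by rewrite (_ : (val j == val i) = false) ?mulr0 //; apply: negbTE.
have s0 : Num.sqrt (lambda i) != 0 by rewrite gt_eqF // sqrtr_gt0.
have := coordE k; rewrite kk' coordE => /esym /(mulfI s0); rewrite /node_coord.
move=> /addrI /(mulIf (invr_neq0 (lt0r_neq0 cR)))/eqP; rewrite eqr_nat => /eqP //.
Qed.

(** A cell has radius at most [n / c] in the span of the first [n] eigenvectors,
    since the eigenvalues are at most 1. *)
Definition grid_radius (x : X) : R := n%:R / c%:R + projection_residual phi n x.

Lemma grid_radius_ge0 x : 0 <= grid_radius x.
Proof. by rewrite addr_ge0 ?divr_ge0 //; exact: normr_ge0. Qed.

Lemma measurable_grid_radius : measurable_fun setT (grid_radius : borel X -> R).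
Proof.
by apply: measurable_funD => //; exact: (measurable_projection_residual eig).
Qed.

Lemma grid_radiusP k x : grid_cell k x -> `|x - node k| <= grid_radius x.
Proof.
move=> kx; apply: le_trans (ler_distD (fourier_sum [set: nat] phi n x) _ _) _.
rewrite addrC lerD //.
have -> : fourier_sum [set: nat] phi n x = \sum_(i < n) inner x (phi i) *: phi i.
  by rewrite /fourier_sum big_mkord; apply: eq_bigl => i; rewrite in_setT.
rewrite /node -sumrB; apply: le_trans (ler_norm_sum _ _ _) _.
apply: (@le_trans _ _ (\sum_(i < n) c%:R^-1)); last first.
  by rewrite sumr_const card_ord -[leLHS]mulr_natl.
apply: ler_sum => i _.
rewrite -scalerBl normrZ (norm_orthonormal onb) // mulr1 (xi_scale eig) -mulrBr normrM.
rewrite ger0_norm ?sqrtr_ge0 // -[leRHS]mul1r; apply: ler_pM => //; first by rewrite -sqrtr1 ler_wsqrtr.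
have /andP[h1 h2] := kx i.
rewrite ger0_norm ?subr_ge0 // lerBlDr addrC; apply: le_trans (ltW h2) _.
by rewrite /node_coord -natr1 mulrDl mul1r addrA.
Qed.

Lemma outside_grid x : (~` \bigcup_k grid_cell k) x ->
  exists i : 'I_n, c%:R <= `|xi lambda phi i x|.
Proof.
move=> nx; apply: contrapT => no; apply: nx.
have lt_c (i : 'I_n) : `|xi lambda phi i x| < c%:R.
  by rewrite ltNge; apply/negP => ge; apply: no; exists i.
pose u (i : 'I_n) := (xi lambda phi i x + c%:R) * c%:R.
have u0 i : 0 <= u i.
  by rewrite mulr_ge0 // -lerBlDr sub0r; have /ltr_normlP[] := lt_c i; lra.
have uN i : (Num.truncn (u i) < 2 * c ^ 2)%N.
  rewrite truncn_lt_nat // /u natrM natrX expr2 mulrA ltr_pM2r //.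
  by have /ltr_normlP[] := lt_c i; lra.
exists [ffun i => Ordinal (uN i)] => // i; rewrite ffunE /=.
have /andP[h1 h2] := truncn_itv (u0 i).
rewrite /node_coord -lerBrDl opprK ler_pdivrMr // h1 /=.
by rewrite -ltrBlDl opprK ltr_pdivlMr.
Qed.

Lemma measurable_outside_grid : measurable (~` \bigcup_k grid_cell k).
Proof.
apply: measurableC; apply: fin_bigcup_measurable => [|k _]; first exact: finite_finset.
exact: measurable_grid_cell.
Qed.

(** Chebyshev's inequality in each of the [n] coordinates. *)
Lemma outside_grid_mass :
  (mu (~` \bigcup_k grid_cell k) <= (n%:R / c%:R ^+ 2)%:E)%E.
Proof.
pose S (i : 'I_n) := [set x : borel X | (c%:R <= `|xi lambda phi i x|)%R].
have mS i : measurable (S i) by exact: measurable_xi_ge.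
have mO := measurable_outside_grid.
rewrite -[X in mu X]setIT -integral_indic //.
apply: (@le_trans _ _ (\int[mu]_x \sum_(i < n) (\1_(S i) x)%:E)%E).
  apply: integral_mono => x; first by rewrite lee_fin.
  rewrite indicE; case: (boolP (x \in _)) => [/set_mem /outside_grid [i ix]|_].
    rewrite sumEFin lee_fin (bigD1 i) //= indicE mem_set // lerDl.
    exact: sumr_ge0.
  by apply: sume_ge0 => i _; rewrite lee_fin.
rewrite ge0_integral_sum //; last by move=> i; exact/measurable_EFinP.
apply: (@le_trans _ _ (\sum_(i < n) (c%:R ^- 2)%:E)%E).
  apply: lee_sum => i _; rewrite integral_indic // setIT.
  exact: (xi_chebyshev eig i cR).
by rewrite sumEFin lee_fin sumr_const card_ord -[leLHS]mulr_natl.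
Qed.

Variables (p B L K Lam : R).
Hypotheses (p1 : 1 <= p) (B0 : 0 < B) (L0 : 0 < L) (K0 : 0 <= K) (Lam0 : 0 <= Lam).
Hypothesis xiK : forall i, ('N[mu]_(Num.max p 2)%:E[EFin \o xi lambda phi i] <= K%:E)%E.
Hypothesis Lam_tail : forall N, \sum_(n <= i < N) lambda i <= Lam.

Lemma grid_error_norm :
  ('N[mu]_p%:E[EFin \o (fun x : borel X =>
     B * \1_(~` \bigcup_k grid_cell k) x + L * grid_radius x)%R] <=
   (B * (n%:R / c%:R ^+ 2) `^ p^-1 + (L * (n%:R / c%:R) +
    L * (K * Num.sqrt Lam)))%:E)%E.
Proof.
have pt0 : 0 < p by exact: lt_le_trans p1.
have mO := measurable_outside_grid.
have mI : measurable_fun setT (\1_(~` \bigcup_k grid_cell k) : borel X -> R).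
  exact: measurable_indic.
have mpr := measurable_projection_residual eig n.
have m1 : measurable_fun setT (fun x : borel X => B * \1_(~` \bigcup_k grid_cell k) x).
  exact: measurable_funM.
have m2 : measurable_fun setT (fun x : borel X => L * projection_residual phi n x).
  exact: measurable_funM.
have m3 : measurable_fun setT (cst (L * (n%:R / c%:R)) : borel X -> R) by [].
have m4 := measurable_funD m3 m2.
have Lnc : 0 <= L * (n%:R / c%:R) by rewrite mulr_ge0 ?divr_ge0 // ltW.
rewrite (_ : EFin \o _ = EFin \o ((fun x : borel X => B * \1_(~` \bigcup_k grid_cell k) x) \+
   (cst (L * (n%:R / c%:R)) \+ (fun x => L * projection_residual phi n x)))%R); last first.
  by apply/funext => x; rewrite /= /grid_radius mulrDr.
apply: (le_trans (@minkowski_EFin _ _ _ mu _ _ p m1 m4 p1)).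
rewrite EFinD; apply: leeD.
  apply: (le_trans (LnormZ_le mu pt0 (ltW B0) mI)).
  rewrite EFinM; apply: lee_wpmul2l; first by rewrite lee_fin ltW.
  rewrite unlock -poweR_EFin; apply: ge0_le_poweR; first by rewrite invr_ge0 ltW.
    by apply: integral_ge0 => x _; exact: poweR_ge0.
  apply: le_trans outside_grid_mass.
  rewrite -[X in (_ <= mu X)%E]setIT -integral_indic //.
  apply: integral_mono => x; first exact: poweR_ge0.
  rewrite /= lee_fin indicE; case: (x \in _); first by rewrite normr1 powR1.
  by rewrite normr0 powR0 // gt_eqF.
apply: (le_trans (@minkowski_EFin _ _ _ mu _ _ p m3 m2 p1)).
rewrite EFinD; apply: leeD; first by rewrite Lnorm_cst.
apply: (le_trans (LnormZ_le mu pt0 (ltW L0) mpr)).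
rewrite EFinM; apply: lee_wpmul2l; first by rewrite lee_fin ltW.
have pp : p <= Num.max p 2 by rewrite le_max lexx.
apply: (le_trans (@Lnorm_le _ _ _ mu _ _ _ pt0 pp mpr)).
apply: (projection_residual_norm eig _ K0 xiK Lam_tail Lam0).
by rewrite le_max lexx orbT.
Qed.

End grid.

(** * Choosing the dimension *)

Section rate.
Context {R : realType}.
Implicit Types s p t B L K sigma : R.

(** The half width of the box, the inverse mesh and the number of output
    coordinates are all [n ^ grid_exponent]; the summands make the escape
    probability, the mesh and the output truncation cost at most [n `^ - s]. *)
Definition grid_exponent s p t : nat := (Num.truncn (1 + s + s * p + s / t)).+1.

Lemma grid_exponent_ge s p t : 0 < s -> 1 <= p -> 0 < t ->
  [/\ 1 + s <= (grid_exponent s p t)%:R, 1 + s * p <= 2 * (grid_exponent s p t)%:R &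
      s <= t * (grid_exponent s p t)%:R].
Proof.
move=> s0 p1 t0; have p0 : 0 < p by exact: lt_le_trans p1.
have h := ltW (truncnS_gt (1 + s + s * p + s / t)); rewrite -/(grid_exponent s p t) in h.
have sp : 0 <= s * p by rewrite mulr_ge0 // ltW.
have st : 0 <= s / t by rewrite divr_ge0 // ltW.
split; [lra|lra|].
by rewrite mulrC -ler_pdivrMr //; lra.
Qed.

Lemma deterministic_rate s p t B L K (n : nat) :
  0 < s -> 1 <= p -> 0 < t -> 0 < B -> 0 < L -> 0 <= K -> (0 < n)%N ->
  let c := (n ^ grid_exponent s p t)%N in
  B * (n%:R / c%:R ^+ 2) `^ p^-1 + (L * (n%:R / c%:R) +
    L * (K * Num.sqrt (n%:R `^ (- (2 * s)) / (2 * s)))) + B * c.+1%:R `^ (- t) <=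
  (2 * B + L + L * K / Num.sqrt (2 * s)) * n%:R `^ (- s).
Proof.
move=> s0 p1 t0 B0 L0 K0 n0 /=; set k := grid_exponent s p t.
have [k1 k2 k3] := grid_exponent_ge s0 p1 t0; rewrite -/k in k1 k2 k3.
have nR : 0 < n%:R :> R by rewrite ltr0n.
have n1 : 1 <= n%:R :> R by rewrite ler1n.
rewrite natrX -!powR_mulrn ?powR_ge0 ?(ltW nR) //.
have e1 : (n%:R / (n%:R `^ k%:R) `^ 2) `^ p^-1 <= n%:R `^ (- s) :> R.
  rewrite -powRrM -powRN -{1}(powRr1 (ltW nR)) -powRD; last by rewrite (gt_eqF nR) implybT.
  rewrite -powRrM ler_powR // ler_pdivrMr //; lra.
have e2 : n%:R / n%:R `^ k%:R <= n%:R `^ (- s) :> R.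
  rewrite -powRN -{1}(powRr1 (ltW nR)) -powRD; last by rewrite (gt_eqF nR) implybT.
  rewrite ler_powR //; lra.
have e3 : Num.sqrt (n%:R `^ (- (2 * s)) / (2 * s)) = n%:R `^ (- s) / Num.sqrt (2 * s) :> R.
  rewrite sqrtrM ?powR_ge0 // sqrtrV ?mulr_ge0 ?(ltW s0) //; congr (_ / _).
  rewrite -powR12_sqrt ?powR_ge0 // -powRrM; congr (_ `^ _). by field.
have e4 : (n ^ k).+1%:R `^ (- t) <= n%:R `^ (- s) :> R.
  rewrite !powRN lef_pV2 ?posrE ?powR_gt0 //.
  apply: le_trans (_ : (n%:R `^ k%:R) `^ t <= _).
    by rewrite -powRrM ler_powR // mulrC.
  rewrite ge0_ler_powR ?nnegrE ?powR_ge0 ?(ltW t0) //.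
  by rewrite powR_mulrn ?(ltW nR) // -natrX ler_nat.
rewrite e3; set v := n%:R `^ (- s) in e1 e2 e4 *.
have : B * (n%:R / (n%:R `^ k%:R) `^ 2) `^ p^-1 <= B * v by rewrite ler_pM2l.
have : L * (n%:R / n%:R `^ k%:R) <= L * v by rewrite ler_pM2l.
have : B * (n ^ k).+1%:R `^ (- t) <= B * v by rewrite ler_pM2l.
have -> : L * (K * (v / Num.sqrt (2 * s))) = L * K / Num.sqrt (2 * s) * v by ring.
lra.
Qed.

End rate.

Section dimension_choice.
Context {R : realType}.

(** The dimension is this fraction of [ell / ln ell], so small that the number of
    nodes, [exp (O (n * ln n))], is a small power of the sample size. *)
Definition dimension_rate (s p t : R) : R := (16 * (grid_exponent s p t).+1%:R)^-1.

Lemma sqrt_large (A x : R) : 0 <= A -> A ^+ 2 <= x -> A <= Num.sqrt x.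
Proof.
move=> A0 Ax; rewrite -ler_sqr ?nnegrE ?sqrtr_ge0 // sqr_sqrtr //.
by apply: le_trans Ax; rewrite sqr_ge0.
Qed.

(** Since [n * ln n <= th * ell], the square of the number of nodes times the
    number of coordinates is at most [m] to a power below 1/2. *)
Lemma stochastic_rate (s th q sigma ell x : R) (k n m : nat) :
  0 < s -> 0 < sigma -> 0 < q -> (0 < m)%N -> (0 < n)%N ->
  ell = ln (m%:R / sigma ^+ 2) -> th = (16 * k.+1%:R)^-1 ->
  x = th * (ell / ln ell) -> n%:R <= x -> 1 <= ln ell ->
  32 * ((k%:R + s) * 2 + 1) <= Num.sqrt ell ->
  `|ln q| + `|ln (sigma ^+ 2)| + 1 <= ell / 16 ->
  let c := (n ^ k)%N in
  c%:R * (((2 * c ^ 2) ^ n)%N%:R) ^+ 2 * q / Num.sqrt m%:R <= n%:R `^ (- s).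
Proof.
move=> s0 sg0 q0 m0 n0 ellE thE xE nx lell big1 big2 /=.
have nR : 0 < n%:R :> R by rewrite ltr0n.
have n1 : 1 <= n%:R :> R by rewrite ler1n.
have mR : 0 < m%:R :> R by rewrite ltr0n.
have lnn0 : 0 <= ln n%:R :> R by exact: ln_ge0.
have ell0 : 0 < ell.
  rewrite ltNge; apply/negP => le0; have := ln_le0 (le_trans le0 ler01); lra.
have k1 : 1 <= k.+1%:R :> R by rewrite ler1n.
have thk : th * k.+1%:R = 16^-1.
  by rewrite thE; field; rewrite gt_eqF // (lt_le_trans _ k1).
have th1 : th <= 16^-1.
  rewrite thE lef_pV2 ?posrE ?mulr_gt0 //; lra.
have lell0 : 0 < ln ell by exact: lt_le_trans lell.
have nl : n%:R * ln ell <= th * ell.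
  by rewrite -ler_pdivlMr // -mulrA -xE.
have ntl : n%:R <= th * ell.
  by apply: le_trans nl; rewrite -[leLHS]mulr1 ler_wpM2l // ltW.
have lnnl : ln n%:R <= ln ell.
  rewrite ler_ln ?posrE //; apply: le_trans ntl _.
  by rewrite -[leRHS]mul1r ler_wpM2r ?(ltW ell0) //; lra.
have nlnn : n%:R * ln n%:R <= th * ell.
  by apply: le_trans nl; rewrite ler_wpM2l // ltW.
have knlnn : k%:R * (n%:R * ln n%:R) <= ell / 16.
  have : k%:R * (n%:R * ln n%:R) <= k.+1%:R * (th * ell).
    by apply: ler_pM => //; [rewrite mulr_ge0 // ltW|rewrite ler_nat].
  have -> // : k.+1%:R * (th * ell) = ell / 16.
  by rewrite mulrA (mulrC _ th) thk mulrC.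
have lnell := ln_le_sqrt ell0.
have sq2 : Num.sqrt ell ^+ 2 = ell by rewrite sqr_sqrtr // ltW.
have kslnn : (k%:R + s) * ln n%:R <= ell / 32.
  have : (k%:R + s) * ln n%:R <= (k%:R + s) * (2 * Num.sqrt ell).
    by rewrite ler_wpM2l ?addr_ge0 // ?(ltW s0) //; apply: le_trans lnnl _.
  have := sqrtr_ge0 ell; set v := Num.sqrt ell in big1 sq2 * => v0 h.
  apply: le_trans h _; rewrite -sq2; nra.
have ln2 : ln 2 <= 1 :> R.
  rewrite -[X in _ <= X](expRK (1:R)) ler_ln ?posrE ?expR_gt0 //; exact: expR_half_le.
have lnm : ln m%:R = ell + ln (sigma ^+ 2).
  by rewrite ellE ln_div ?posrE ?exprn_gt0 //; ring.
rewrite ler_pdivrMr ?sqrtr_gt0 //.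
rewrite -powR12_sqrt ?(ltW mR) // (powR_expR _ mR) (powR_expR _ nR) -expRD.
have cE : (n ^ k)%N%:R = expR (k%:R * ln n%:R) :> R.
  by rewrite natrX expRM_natl expR_ln.
have MfE : ((2 * (n ^ k) ^ 2) ^ n)%N%:R = expR (n%:R * (ln 2 + 2 * (k%:R * ln n%:R))) :> R.
  rewrite natrX expRM_natl; congr (_ ^+ _).
  by rewrite natrM expRD expR_ln // natrX cE -expRM_natl.
rewrite MfE cE -expRM_natl -!expRD -[q](expR_ln q0) -expRD ler_expR lnm.
have a1 := ler_norm (ln q).
have a2 : - `|ln (sigma ^+ 2)| <= ln (sigma ^+ 2) by rewrite lerNl -normrN ler_norm.
have a3 := normr_ge0 (ln q); have a4 := normr_ge0 (ln (sigma ^+ 2)).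
have a5 : n%:R * ln 2 <= ell / 16.
  apply: le_trans (_ : n%:R * 1 <= _); first by rewrite ler_wpM2l.
  rewrite mulr1; apply: le_trans ntl _; rewrite mulrC ler_wpM2l ?(ltW ell0) //.
have E1 : 2%:R * (n%:R * (ln 2 + 2 * (k%:R * ln n%:R))) =
   2 * (n%:R * ln 2) + 4 * (k%:R * (n%:R * ln n%:R)) :> R by ring.
rewrite E1.
lra.
Qed.

End dimension_choice.

Lemma moment_bound_ge0 (R : realType) (X : hilbertType R)
    (mu : probability (borel X) R) lambda phi (p : R) :
  (0 <= moment_bound mu lambda phi p)%E.
Proof.
apply: (@le_trans _ _ ('N[mu]_(Num.max p 2)%:E[EFin \o xi lambda phi 0%N])%E).
  exact: Lnorm_ge0.
by apply: ereal_sup_ubound; exists 0%N.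
Qed.

Section log_lower.
Context {R : realType} {X Y : hilbertType R}.
Variables (D : set nat) (psi : nat -> Y).
Hypothesis onb : orthonormal_basis D psi.
Variables (mu : probability (borel X) R) (lambda : nat -> R) (phi : nat -> X).
Hypothesis eig : covariance_eigenbasis mu lambda phi.
Variable tau : R.
Hypothesis tau1 : 1 < tau.
Hypothesis lambdaE : forall i, lambda i = i.+1%:R `^ (- tau).
Context {d : measure_display} {Omega : measurableType d}.
Variables (P : probability Omega R) (E : nat -> {RV P >-> process R Y}).
Hypothesis noiseE : iid_white_noise E.
Variables (w : nat -> R) (t p B L sigma : R).
Hypothesis wE : forall i, w i = i.+1%:R.
Hypotheses (t0 : 0 < t) (p1 : 1 <= p) (B0 : 0 < B) (L0 : 0 < L) (sigma0 : 0 < sigma).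
Hypothesis moment_fin : (moment_bound mu lambda phi p < +oo)%E.

Let K := fine (moment_bound mu lambda phi p).

Let xiK i : ('N[mu]_(Num.max p 2)%:E[EFin \o xi lambda phi i] <= K%:E)%E.
Proof.
rewrite fineK; first by apply: ereal_sup_ubound; exists i.
by rewrite ge0_fin_numE // moment_bound_ge0.
Qed.

Let s := (tau - 1) / 2.
Let s0 : 0 < s. Proof. by rewrite divr_gt0 // subr_gt0. Qed.
Let sE : tau - 1 = 2 * s. Proof. by rewrite /s; field. Qed.

(** [n `^ - s] is the order of the square root of the sum of the [i.+1 `^ - tau]
    from [n] on, the error of keeping [n] coordinates of the input. *)
Lemma grid_risk (k : design) (n m : nat) : (0 < n)%N -> (0 < m)%N ->
  let c := (n ^ grid_exponent s p t)%N in
  (minimax_risk E sigma m (lipschitz_class (X := X) w D psi t B L) mu p k <=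
   ((2 * B + L + L * K / Num.sqrt (2 * s)) * n%:R `^ (- s) +
     c%:R * (((2 * c ^ 2) ^ n)%N%:R) ^+ 2 * (1 + sigma + B) / Num.sqrt m%:R)%:E)%E.
Proof.
move=> n0 m0; set c := (n ^ _)%N => /=; have c0 : (0 < c)%N by rewrite expn_gt0 n0.
have lam1 i : lambda i <= 1.
  rewrite lambdaE powRN invf_le1 ?powR_gt0 // -[leLHS](powRr0 (i.+1%:R : R)).
  by apply: ler_powR; [rewrite ler1n|exact: ltW (lt_trans ltr01 tau1)].
have Lam_tail N : \sum_(n <= i < N) lambda i <= n%:R `^ (- (2 * s)) / (2 * s).
  under eq_bigr do rewrite lambdaE.
  by rewrite -sE; exact: eigenvalue_tail.
have Lam0 : 0 <= n%:R `^ (- (2 * s)) / (2 * s).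
  by apply: divr_ge0; [exact: powR_ge0|rewrite mulr_ge0 // ltW].
have K0 : 0 <= K by rewrite fine_ge0 // moment_bound_ge0.
have gG := grid_error_norm eig c0 p1 B0 L0 K0 Lam0 xiK Lam_tail.
have card0 : (0 < #|{: {ffun 'I_n -> 'I_(2 * c ^ 2)}}|)%N.
  by rewrite card_nodes !expn_gt0 muln_gt0 expn_gt0 c0.
have := minimax_risk_le onb p1 noiseE wE t0 B0 L0 sigma0
  (@measurable_grid_cell _ _ lambda phi n c)
  (@grid_cell_disjoint _ _ lambda phi n c c0)
  (node_inj eig c0) card0 c m0 (@grid_radius_ge0 _ _ phi n c)
  (@grid_radiusP _ _ _ _ _ eig lam1 n c) (measurable_grid_radius eig n c) gG k.
move/le_trans; apply; rewrite lee_fin card_nodes lerD2r.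
exact: deterministic_rate.
Qed.

End log_lower.

Section log_rate.
Context {R : realType}.

(** The summand 1 accounts for the stochastic error. *)
Definition lower_constant (tau t B L p K : R) : R :=
  let s := (tau - 1) / 2 in
  ln ((2 * B + L + L * K / Num.sqrt (2 * s) + 1) *
      (dimension_rate s p t / 2) `^ (- s)).

Lemma exists_dimension (s t p q sigma : R) :
  0 < s -> 0 < t -> 1 <= p -> 0 < q -> 0 < sigma ->
  exists m0, forall m, (m0 <= m)%N -> (0 < m)%N /\
  let ell := ln (m%:R / sigma ^+ 2) in
  0 < ell / ln ell /\
  exists n, [/\ (0 < n)%N,
    n%:R `^ (- s) <= (dimension_rate s p t / 2) `^ (- s) * (ell / ln ell) `^ (- s) :> R &
    let c := (n ^ grid_exponent s p t)%N in
    c%:R * (((2 * c ^ 2) ^ n)%N%:R) ^+ 2 * q / Num.sqrt m%:R <= n%:R `^ (- s) :> R].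
Proof.
move=> s0 t0 p1 q0 sg0; set k := grid_exponent s p t; set th := dimension_rate s p t.
have th0 : 0 < th by rewrite invr_gt0 mulr_gt0.
pose b1 : R := 32 * ((k%:R + s) * 2 + 1).
pose b2 : R := 16 * (`|ln q| + `|ln (sigma ^+ 2)| + 1).
have b10 : 0 <= b1 by rewrite mulr_ge0 // addr_ge0 // mulr_ge0 // addr_ge0 // ltW.
have b20 : 0 <= b2 by rewrite mulr_ge0 // !addr_ge0.
have [m0 hm0] := @log_sample_size_large _ sigma (expR 1 + (2 / th) ^+ 2 + b1 ^+ 2 + b2) sg0.
exists m0 => m /hm0[mpos]; set ell := ln _ => hell; split => //=.
have e0 := expR_gt0 (1 : R).
have s1 := sqr_ge0 (2 / th); have s2 := sqr_ge0 b1.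
have ell0 : 0 < ell by lra.
have lell : 1 <= ln ell.
  by rewrite -[leLHS](expRK (1 : R)) ler_ln ?posrE //; lra.
have lell0 : 0 < ln ell by exact: lt_le_trans lell.
have r0 : 0 < ell / ln ell by rewrite divr_gt0.
split => //.
have v1 : 2 / th <= Num.sqrt ell.
  apply: sqrt_large; first by apply: divr_ge0 => //; exact: ltW.
  lra.
have v2 : b1 <= Num.sqrt ell.
  by apply: (sqrt_large b10); lra.
have vv : Num.sqrt ell ^+ 2 = ell by rewrite sqr_sqrtr // ltW.
have rx : Num.sqrt ell / 2 <= ell / ln ell.
  rewrite ler_pdivlMr // -[leRHS]vv expr2 mulrAC -mulrA ler_wpM2l ?sqrtr_ge0 //.
  by rewrite ler_pdivrMr // mulrC ln_le_sqrt.
pose x := th * (ell / ln ell).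
have x1 : 1 <= x.
  have : th * (2 / th / 2) <= x.
    rewrite ler_wpM2l ?(ltW th0) //; apply: le_trans rx.
    by rewrite ler_wpM2r.
  by rewrite (_ : th * (2 / th / 2) = 1) //; field; rewrite gt_eqF.
have x0 : 0 <= x by exact: le_trans x1.
exists (Num.truncn x).
have n0 : (0 < Num.truncn x)%N by rewrite truncn_gt0.
have nR : 0 < (Num.truncn x)%:R :> R by rewrite ltr0n.
have nx : (Num.truncn x)%:R <= x by rewrite truncn_le.
split => //.
- have hx : th / 2 * (ell / ln ell) <= (Num.truncn x)%:R.
    have h1 := truncnS_gt x; have h2 : 1 <= (Num.truncn x)%:R :> R by rewrite ler1n.
    rewrite -natr1 in h1.
    by rewrite (_ : th / 2 * (ell / ln ell) = x / 2); [lra|rewrite /x; ring].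
  have th2 : 0 < th / 2 by rewrite divr_gt0.
  rewrite -powRM ?(ltW th2) ?(ltW r0) // !powRN lef_pV2 ?posrE ?powR_gt0 ?(mulr_gt0 th2 r0) //.
  by rewrite ge0_ler_powR ?nnegrE ?(ltW s0) ?(ltW nR) // mulr_ge0 // ltW.
- apply: (@stochastic_rate _ s th q sigma ell x k (Num.truncn x) m) => //.
  by rewrite ler_pdivlMr // mulrC -/b2; lra.
Qed.

End log_rate.

Section log_lower_bound.
Context {R : realType} {X Y : hilbertType R}.
Variables (D : set nat) (psi : nat -> Y).
Hypothesis onb : orthonormal_basis D psi.
Variables (mu : probability (borel X) R) (lambda : nat -> R) (phi : nat -> X).
Hypothesis eig : covariance_eigenbasis mu lambda phi.
Variable tau : R.
Hypothesis tau1 : 1 < tau.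
Hypothesis lambdaE : forall i, lambda i = i.+1%:R `^ (- tau).
Context {d : measure_display} {Omega : measurableType d}.
Variables (P : probability Omega R) (E : nat -> {RV P >-> process R Y}).
Hypothesis noiseE : iid_white_noise E.
Variables (w : nat -> R) (t p B L sigma : R).
Hypothesis wE : forall i, w i = i.+1%:R.
Hypotheses (t0 : 0 < t) (p1 : 1 <= p) (B0 : 0 < B) (L0 : 0 < L) (sigma0 : 0 < sigma).
Hypothesis moment_fin : (moment_bound mu lambda phi p < +oo)%E.

Let K := fine (moment_bound mu lambda phi p).

Lemma log_minimax_risk_lower (k : design) :
  exists m0, forall m, (m0 <= m)%N ->
  let ell := ln (m%:R / sigma ^+ 2) in
  (((tau - 1) / 2 * ln (ell / ln ell) - lower_constant tau t B L p K)%:E <=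
   log_minimax_risk E sigma m (lipschitz_class (X := X) w D psi t B L) mu p k)%E.
Proof.
pose s := (tau - 1) / 2; have s0 : 0 < s by rewrite divr_gt0 // subr_gt0.
have q0 : 0 < 1 + sigma + B by rewrite !addr_gt0.
have [m0 hm0] := exists_dimension s0 t0 p1 q0 sigma0.
exists m0 => m /hm0[mpos] /=; set ell := ln _ => -[r0 [n [n0 nrate nstoch]]].
apply: log_minimax_risk_ge.
apply: le_trans (grid_risk onb eig tau1 lambdaE noiseE wE t0 p1 B0 L0 sigma0
  moment_fin k n0 mpos) _.
rewrite lee_fin -/K -/s.
pose C1 := 2 * B + L + L * K / Num.sqrt (2 * s).
have C10 : 0 < C1 + 1.
  have K0 : 0 <= K by rewrite fine_ge0 // moment_bound_ge0.
  have h : 0 <= L * K / Num.sqrt (2 * s).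
    by rewrite divr_ge0 ?sqrtr_ge0 // mulr_ge0 // ltW.
  by apply: ltr_wpDl ltr01; rewrite addr_ge0 // ltW // addr_gt0 // mulr_gt0.
have th20 : 0 < dimension_rate s p t / 2 by rewrite divr_gt0 // invr_gt0 mulr_gt0.
apply: (@le_trans _ _ ((C1 + 1) * n%:R `^ (- s))).
  by rewrite (mulrDl C1) mul1r lerD2l.
apply: (@le_trans _ _ ((C1 + 1) * ((dimension_rate s p t / 2) `^ (- s) *
    (ell / ln ell) `^ (- s)))).
  by rewrite ler_wpM2l // ltW.
rewrite mulrA opprB expRD /lower_constant -/s expR_ln; last first.
  by rewrite mulr_gt0 // powR_gt0.
by rewrite ler_wpM2l ?mulr_ge0 ?powR_ge0 ?(ltW C10) // (powR_expR _ r0) mulNr.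
Qed.

End log_lower_bound.

(* c iota p is the constant of the upper bound; C tau iota t B L p K is the
   O(1) constant of the lower bound, K being the moment bound. *)
Theorem theorem2p10 (R : realType) :
  exists (c : R -> R -> R) (C : R -> R -> R -> R -> R -> R -> R -> R),
  (forall iota p : R, 0 < c iota p) /\
  forall (X Y : hilbertType R)
    (t p B L sigma tau a b iota : R)
    (w : nat -> R) (D : set nat) (psi : nat -> Y)
    (mu : probability (borel X) R) (lambda : nat -> R) (phi : nat -> X)
    (d : measure_display) (Omega : measurableType d) (P : probability Omega R)
    (E : nat -> {RV P >-> process R Y}),
  separable X -> separable Y -> (exists y : Y, y != 0) ->
  0 < t -> 1 <= p -> 0 < B -> 0 < L -> 0 < sigma ->
  mean_zero mu -> finite_second_moment mu ->
  covariance_eigenbasis mu lambda phi ->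
  independent_family mu (xi lambda phi) ->
  0 < a -> 0 < b -> densities_bounded_below mu lambda phi a b ->
  iota = 2 * a * b ->
  (moment_bound mu lambda phi p < +oo)%E ->
  initial_segment D -> orthonormal_basis D psi ->
  (forall i, w i = i.+1%:R) ->
  1 < tau -> (forall i, lambda i = i.+1%:R `^ (- tau)) ->
  iid_white_noise E ->
  forall k : design, exists m0 : nat, forall m : nat, (m0 <= m)%N ->
    let ell := ln (m%:R / sigma ^+ 2) in
    let Lm := log_minimax_risk E sigma m
                (lipschitz_class (X := X) w D psi t B L) mu p k in
    let K := fine (moment_bound mu lambda phi p) in
    (((tau - 1) / 2 * ln (ell / ln ell) - C tau iota t B L p K)%:E <= Lm)%E /\
    (Lm <= (c iota p * Num.sqrt ell)%:E)%E.

Proof.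
exists (fun iota _ => `|ln (iota / 2)| + 6).
exists (fun tau _ t B L p K => lower_constant tau t B L p K).
split=> [iota _|]; first by rewrite ltr_wpDl.
move=> X Y t p B L sigma tau a b iota w D psi mu lambda phi d Omega P E.
move=> _ _ exY t0 p1 B0 L0 sigma0 _ _ eig ind a0 b0 dens iotaE moment_fin.
move=> Dini onb wE tau1 lambdaE noiseE k.
have D0 := initial_segment0 onb Dini exY.
have [m1 upper] := log_minimax_risk_upper onb D0 eig ind a0 b0
  (lt_trans ltr01 tau1) dens lambdaE E t (wE 0%N) p1 B0 L0 sigma0 k.
have [m2 lower] := log_minimax_risk_lower onb eig tau1 lambdaE noiseE wE t0 p1
  B0 L0 sigma0 moment_fin k.
exists (maxn m1 m2) => m; rewrite geq_max => /andP[m1m m2m] /=.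
split; first exact: lower.
rewrite (_ : iota / 2 = a * b); first exact: upper.
by rewrite iotaE; field.
Qed.
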